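(* Let $q\in\mathbb{C}\setminus\{0\}$ and let $a_0(z),\ldots,a_n(z)$ be meromorphic functions of finite $\varphi$-order with $a_0a_n\not\equiv 0$ such that, for some $i\in\{0,\ldots,n\}$, $$\rho_\varphi(a_i)>\max_{j\neq i}\{\rho_\varphi(a_j)\}.$$ Suppose that $\varphi$ is subadditive. Let $f\not\equiv 0$ be a meromorphic solution of $$\sum_{j=0}^n a_j(z)f(q^jz)=0.$$ (a) If $\limsup_{r\to\infty}s(r)/r=\infty$ and $s$ is convex and differentiable, then $$\rho_\varphi(f)\geq \max\{\rho_\varphi(f)-\alpha_{\varphi,s}\gamma_{\varphi,s},\ \alpha_{\varphi,s}\rho_\varphi(f)\}\geq \alpha_{\varphi,s}\rho_\varphi(a_i).$$ Moreover, if $a_0,\ldots,a_n$ are entire, then $\rho_\varphi(f)\geq \alpha_{\varphi,s}\rho_\varphi(a_i)+\alpha_{\varphi,s}\gamma_{\varphi,s}$. (b) If $\limsup_{r\to\infty}s(r)/r<\infty$, then $\rho_\varphi(f)\geq\rho_\varphi(a_i)$.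
   Context: Let $R_0>0$. Throughout, $\varphi:(R_0,\infty)\to(0,\infty)$ is a non-decreasing unbounded function with $\log r\le\varphi(r)\le r$ for $r\ge R_0$. For a non-decreasing function $T$ with positive values, its $\varphi$-order is $\rho_\varphi(T)=\limsup_{r\to\infty}\frac{\log T(r)}{\log\varphi(r)}$; for a meromorphic function $f$ in $\mathbb{C}$, $\rho_\varphi(f)=\rho_\varphi(T(r,f))$ where $T(r,f)$ is the Nevanlinna characteristic. $\varphi$ is subadditive if $\varphi(a+b)\le\varphi(a)+\varphi(b)$ for all $a,b\ge R_0$. The function $s:(R_0,\infty)\to(0,\infty)$ is non-decreasing with $r<s(r)\le r^2$ for $r\ge R_0$ and $\liminf_{r\to\infty}s(r)/r>1$. Standing assumption: every meromorphic function of finite $\varphi$-order considered has classical order $\rho(f)=\limsup_{r\to\infty}\frac{\log T(r,f)}{\log r}<1$. Define $$\alpha_{\varphi,s}=\liminf_{r\to\infty}\frac{\log\varphi(r)}{\log\varphi(s(r))},\qquad \gamma_{\varphi,s}=\liminf_{r\to\infty}\frac{\log\log\frac{s(r)}{r}}{\log\varphi(r)}$$ (under the assumptions, $\alpha_{\varphi,s},\gamma_{\varphi,s}\in[0,1]$). *)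

(* Defs.v *)
(* Complex numbers are R[i] (mathcomp-real-closed)
   over an arbitrary R : realType; complex differentiability is
   MathComp-Analysis' [derivable] on the normed module (R[i])^o over itself. *)
From HB Require Import structures.
From mathcomp Require Import all_boot all_order all_algebra.
From mathcomp Require Import complex.
From mathcomp Require Import all_classical all_reals all_analysis.
Set Implicit Arguments. Unset Strict Implicit. Unset Printing Implicit Defensive.
Import Order.TTheory GRing.Theory Num.Theory.
Import numFieldNormedType.Exports.
Local Open Scope classical_set_scope.
Local Open Scope ring_scope.

Section Nevanlinna.
Variable R : realType.

Definition Cplx : Type := (R[i])^o.

Definition cabs (z : Cplx) : R := Normc.normc (z : R[i]).

Definition holo_near (f : Cplx -> Cplx) (p : Cplx) : Prop :=
  exists e : R, 0 < e /\ forall z : Cplx, cabs (z - p) < e -> derivable f z 1.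

Definition holo_punct (f : Cplx -> Cplx) (p : Cplx) : Prop :=
  exists e : R, 0 < e /\
    forall z : Cplx, 0 < cabs (z - p) < e -> derivable f z 1.

Definition is_pole (f : Cplx -> Cplx) (p : Cplx) : Prop :=
  holo_punct f p /\
  forall M : R, exists e : R, 0 < e /\
    forall z : Cplx, 0 < cabs (z - p) < e -> M < cabs (f z).

(* f is meromorphic in C: every point is a point of holomorphy or a pole
   (the value of f at a pole is irrelevant junk) *)
Definition meromorphic (f : Cplx -> Cplx) : Prop :=
  forall p : Cplx, holo_near f p \/ is_pole f p.

Definition entire (f : Cplx -> Cplx) : Prop :=
  forall z : Cplx, derivable f z 1.

Definition pole_order (f : Cplx -> Cplx) (p : Cplx) (m : nat) : Prop :=
  (0 < m)%N /\
  exists (g : Cplx -> Cplx) (e : R), 0 < e /\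
    (forall z : Cplx, cabs (z - p) < e -> derivable g z 1) /\
    g p != 0 /\
    forall z : Cplx, 0 < cabs (z - p) < e -> f z = g z / (z - p) ^+ m.

(* n(t,f) : number of poles of f in |z| <= t, counted with multiplicity
   (sup of the partial counts over finite lists of distinct poles) *)
Definition npoles (f : Cplx -> Cplx) (t : R) : R :=
  sup [set x : R | exists l : seq (Cplx * nat),
         uniq (map fst l) /\
         (forall pm, pm \in l -> pole_order f pm.1 pm.2 /\ cabs pm.1 <= t) /\
         x = (\sum_(pm <- l) pm.2)%:R].

Definition Ncount (f : Cplx -> Cplx) (r : R) : R :=
  fine (\int[lebesgue_measure]_(t in [set t : R | (0 < t <= r)%R])
          ((npoles f t - npoles f 0) / t)%:E)%E
  + npoles f 0 * ln r.

Definition logplus (x : R) : R := Num.max 0 (ln x).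

Definition mprox (f : Cplx -> Cplx) (r : R) : R :=
  (2 * pi)^-1 *
  fine (\int[lebesgue_measure]_(th in [set th : R | (0 <= th <= 2 * pi)%R])
          (logplus (cabs (f ((r * cos th) +i* (r * sin th))%C)))%:E)%E.

Definition Tchar (f : Cplx -> Cplx) (r : R) : R := mprox f r + Ncount f r.

Definition limsup_infty (g : R -> R) : \bar R :=
  ereal_inf [set ereal_sup [set (g r)%:E | r in `]M, +oo[ ] | M in [set: R]].
Definition liminf_infty (g : R -> R) : \bar R :=
  ereal_sup [set ereal_inf [set (g r)%:E | r in `]M, +oo[ ] | M in [set: R]].

Definition phi_order_fun (phi T : R -> R) : \bar R :=
  limsup_infty (fun r => ln (T r) / ln (phi r)).
Definition phi_order (phi : R -> R) (f : Cplx -> Cplx) : \bar R :=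
  phi_order_fun phi (Tchar f).

Definition classical_order (f : Cplx -> Cplx) : \bar R :=
  limsup_infty (fun r => ln (Tchar f r) / ln r).

Definition alpha_phis (phi s : R -> R) : \bar R :=
  liminf_infty (fun r => ln (phi r) / ln (phi (s r))).
Definition gamma_phis (phi s : R -> R) : \bar R :=
  liminf_infty (fun r => ln (ln (s r / r)) / ln (phi r)).

End Nevanlinna.

(* Main.v *)
(* For |w_1|, |w_2| <= W and S >= 4 W^2 r, the circle mean of
   |log|f(w_1 z)| - log|f(w_2 z)|| over |z| = r is
   O((T(S, f) + T(3S/2, f) + T(4S, f) + 1) / log(S / r)): writing f = A / B * h on
   |z| < 2 S with A, B monic polynomials and h zero-free, the zeros and poles in
   |z| <= sqrt(r S) number O(T(S, f) / log(S / r)) and contribute O(1) each, the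
   others contribute O(sqrt(r / S)) each, and log|h| is controlled by the Poisson
   kernel.  Dividing the equation by f(q^i z) then bounds the proximity function
   of a_i; comparing pole multiplicities in the equation bounds its counting
   function by those of the other coefficients and T(W r, f).  Taking S a constant
   times r gives rho(a_i) <= rho(f), and S a constant times s(r) gives the bound
   for entire coefficients.  The error terms O(1) are harmless because a
   meromorphic function of bounded characteristic has constant characteristic, so
   that every order is nonnegative and rho(a_i) > 0. *)
Require Import Defs.
From HB Require Import structures.
From mathcomp Require Import all_boot all_order all_algebra.
From mathcomp Require Import complex.
From mathcomp Require Import all_classical all_reals all_analysis.
From mathcomp Require Import measurable_realfun.
From mathcomp Require Import ring lra zify.
Set Implicit Arguments. Unset Strict Implicit. Unset Printing Implicit Defensive.
Import Order.TTheory GRing.Theory Num.Theory.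
Import numFieldNormedType.Exports.
Local Open Scope classical_set_scope.
Local Open Scope ring_scope.

(** * Modulus, real and imaginary parts of complex numbers *)

Section ComplexModulus.
Variable R : realType.
Local Notation C := (Cplx R).
Implicit Types (x y z : C) (a b : R).

(** The orders are compared by contradiction, with strict room. If the bound for rho(f) failed, some
    tau < rho(a_i) would exceed the orders of all other coefficients and the exponent of the error
    term; every term bounding T(r, a_i) would be O(phi(r)^tau), forcing rho(a_i) <= tau. Constant
    multiples of r or s(r) inside T(., f) are free, because subadditivity gives phi(k x) <= N
    phi(x). With S comparable to s(r), T(S, f) costs about phi(r)^(rho(f)/alpha) and dividing by
    log(S / r) gains phi(r)^gamma, hence rho(a_i) <= rho(f)/alpha - gamma. The gain concerns the
    proximity function alone; the bound for the counting function through T(W r, f) has no such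
    factor, so the sharper statement is about entire coefficients. The radius sqrt(r S) balances
    near and far zeros and poles, since sqrt(r / S) log(S / r) is bounded. The two inequalities of
    (a) for meromorphic coefficients follow from rho(a_i) <= rho(f) together with 0 <= alpha <= 1
    and gamma >= 0. *)

Definition cre (z : C) : R := complex.Re z.
Definition cim (z : C) : R := complex.Im z.
Definition rc (a : R) : C := (a%:C)%C.

Lemma rcD a b : rc (a + b) = rc a + rc b. Proof. exact: rmorphD. Qed.
Lemma rcB a b : rc (a - b) = rc a - rc b. Proof. exact: rmorphB. Qed.
Lemma rcM a b : rc (a * b) = rc a * rc b. Proof. exact: rmorphM. Qed.
Lemma rcV a : rc a^-1 = (rc a)^-1. Proof. exact: fmorphV. Qed.
Lemma rc0 : rc 0 = 0. Proof. exact: rmorph0. Qed.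
Lemma rc1 : rc 1 = 1. Proof. exact: rmorph1. Qed.
Lemma rc_eq0 a : (rc a == 0) = (a == 0). Proof. exact: fmorph_eq0. Qed.

Lemma cabsE z : `|z| = rc (cabs z). Proof. by []. Qed.
Lemma cabs_ge0 z : 0 <= cabs z.
Proof. by case: z => u v; exact: sqrtr_ge0. Qed.
Lemma cabs0 : cabs (0 : C) = 0. Proof. exact: Normc.normc0. Qed.
Lemma cabs1 : cabs (1 : C) = 1. Proof. exact: Normc.normc1. Qed.
Lemma cabsM x y : cabs (x * y) = cabs x * cabs y.
Proof. exact: Normc.normcM. Qed.
Lemma cabsV x : cabs x^-1 = (cabs x)^-1. Proof. exact: Normc.normcV. Qed.
Lemma cabsN x : cabs (- x) = cabs x. Proof. exact: normcN. Qed.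
Lemma cabsD x y : cabs (x + y) <= cabs x + cabs y. Proof. exact: le_normcD. Qed.
Lemma cabsB x y : cabs (x - y) <= cabs x + cabs y.
Proof. by rewrite -(cabsN y); exact: cabsD. Qed.
Lemma cabs_eq0 z : (cabs z == 0) = (z == 0).
Proof.
apply/idP/idP => [/eqP/Normc.eq0_normc h|/eqP ->]; last by rewrite cabs0.
by apply/eqP.
Qed.
Lemma cabs_gt0 z : (0 < cabs z) = (z != 0).
Proof. by rewrite lt_def cabs_ge0 andbT cabs_eq0. Qed.
Lemma cabsC x y : cabs (x - y) = cabs (y - x).
Proof. by rewrite -cabsN opprB. Qed.
Lemma cabs_triangle y x z : cabs (x - z) <= cabs (x - y) + cabs (y - z).
Proof. by rewrite (_ : x - z = (x - y) + (y - z)) ?cabsD//; ring. Qed.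
Lemma cabs_lower x y : cabs x - cabs y <= cabs (x - y).
Proof. by rewrite lerBlDr -{1}(subrK y x) cabsD. Qed.
Lemma cabsX z n : cabs (z ^+ n) = cabs z ^+ n.
Proof. by elim: n => [|n IH]; rewrite ?expr0 ?cabs1// !exprS cabsM IH. Qed.
Lemma cabs_rc a : cabs (rc a) = `|a|.
Proof. by rewrite /cabs /rc /= expr0n /= addr0 sqrtr_sqr. Qed.
Lemma cabs_prod (s : seq C) (f : C -> C) :
  cabs (\prod_(b <- s) f b) = \prod_(b <- s) cabs (f b).
Proof. exact: (big_morph _ cabsM cabs1). Qed.

Lemma cabs_re z : `|cre z| <= cabs z.
Proof.
case: z => u v; rewrite /cabs /= -sqrtr_sqr ler_wsqrtr// lerDl; exact: sqr_ge0.
Qed.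
Lemma cabs_im z : `|cim z| <= cabs z.
Proof.
case: z => u v; rewrite /cabs /= -sqrtr_sqr ler_wsqrtr// lerDr; exact: sqr_ge0.
Qed.
Lemma cabs_le_reim z : cabs z <= `|cre z| + `|cim z|.
Proof.
case: z => u v; rewrite /cabs /= -(ger0_norm (addr_ge0 (normr_ge0 u) (normr_ge0 v))).
rewrite -[leRHS]sqrtr_sqr ler_wsqrtr// sqrrD !real_normK ?num_real//.
by rewrite lerD2r lerDl mulrn_wge0// mulr_ge0.
Qed.

Lemma creD x y : cre (x + y) = cre x + cre y.
Proof. by case: x => ? ?; case: y. Qed.
Lemma cimD x y : cim (x + y) = cim x + cim y.
Proof. by case: x => ? ?; case: y. Qed.
Lemma creB x y : cre (x - y) = cre x - cre y.
Proof. by case: x => ? ?; case: y. Qed.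
Lemma cimB x y : cim (x - y) = cim x - cim y.
Proof. by case: x => ? ?; case: y. Qed.
Lemma creM x y : cre (x * y) =
  cre x * cre y - cim x * cim y.
Proof. by case: x => ? ?; case: y. Qed.
Lemma cimM x y : cim (x * y) =
  cre x * cim y + cim x * cre y.
Proof. by case: x => ? ?; case: y. Qed.

End ComplexModulus.

Lemma half_pos (R : realType) (e : R) : 0 < e -> 0 < e / 2.
Proof. by move=> e0; rewrite divr_gt0. Qed.

(** * Complex derivatives in epsilon-delta form *)

Section ComplexDerivative.
Variable R : realType.
Local Notation C := (Cplx R).
Implicit Types (f g : C -> C) (z w l : C).

(** The bound is non-strict and includes [h = 0], so that neither quotients nor punctured
    neighbourhoods occur and the rules of calculus become estimates of a remainder. *)
Definition cder f z l := forall e : R, 0 < e -> exists2 d : R, 0 < d &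
  forall h : C, cabs h < d -> cabs (f (z + h) - f z - l * h) <= e * cabs h.

Definition ccont f z := forall e : R, 0 < e -> exists2 d : R, 0 < d &
  forall h : C, cabs h < d -> cabs (f (z + h) - f z) < e.

Lemma derivable_cder f z : derivable f z 1 -> exists l, cder f z l.
Proof.
move=> /cvg_ex[l /cvgrPdist_le H]; exists l => e e0.
have e0' : (0 : R[i]) < rc e by rewrite -(rc0 R) ltcR.
have /nbhs_ballP[d /= d0 dH] := H _ e0'.
(* A positive element of [R[i]] has zero imaginary part, so the radius [d] is real. *)
move: d0 dH; rewrite ltcE /= => /andP[/eqP d2 d1] dH.
exists (complex.Re d) => // h hd.
have [->|h0] := eqVneq h 0.
  by rewrite addr0 subrr mulr0 subr0 cabs0 mulr0.
have := dH h; rewrite /ball /= sub0r normrN cabsE ltcE /= -d2 eqxx hd => /(_ isT h0).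
rewrite /shift /= cabsE lecR => H1.
have -> : f (z + h) - f z - l * h = - h * (l - h^-1 * (f (h *: 1 + z) - f z)).
  have -> : h *: 1 + z = z + h by rewrite addrC /GRing.scale /= mulr1.
  field; exact: h0.
rewrite cabsM cabsN mulrC; apply: ler_wpM2r => //; exact: cabs_ge0.
Qed.

Lemma cder_derivable f z l : cder f z l -> derivable f z 1.
Proof.
move=> H; apply/cvg_ex; exists l; apply/cvgrPdist_le => e.
rewrite ltcE /= => /andP[/eqP e2 e1].
have [d d0 dH] := H _ e1.
apply/nbhs_ballP; exists (rc d); first by rewrite /= ltcR.
move=> h; rewrite /ball /= sub0r normrN cabsE ltcR => hd h0.
rewrite /shift /= cabsE lecE /= -e2 eqxx /=.
have h0' : 0 < cabs h by rewrite cabs_gt0.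
rewrite -(ler_pM2r h0') (le_trans _ (dH h hd))// -cabsM -cabsN.
suff -> : f (z + h) - f z - l * h = - ((l - h^-1 *: (f (h *: 1 + z) - f z)) * h) by [].
have -> : h *: 1 + z = z + h by rewrite addrC /GRing.scale /= mulr1.
rewrite /GRing.scale /=; field; exact: h0.
Qed.

Lemma cder_ccont f z l : cder f z l -> ccont f z.
Proof.
move=> H e e0; have [d d0 dH] := H 1 ltr01.
have l1 : 0 < cabs l + 1 by rewrite ltr_wpDl ?cabs_ge0.
exists (Num.min d (e / (cabs l + 1) / 2)); first by rewrite lt_min d0 !divr_gt0.
move=> h; rewrite lt_min => /andP[/dH h1 h2].
have : cabs (f (z + h) - f z) <= (cabs l + 1) * cabs h.
  rewrite -[X in cabs X](subrK (l * h)) (le_trans (cabsD _ _))// cabsM.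
  by rewrite mulrDl mul1r addrC lerD2l; rewrite mul1r in h1.
move/le_lt_trans; apply; rewrite mulrC -ltr_pdivlMr//.
apply: lt_le_trans h2 _; rewrite ler_pdivrMr// ler_peMr ?ler1n//.
by rewrite divr_ge0// ltW.
Qed.

Lemma cder_ext f g z l (d : R) : 0 < d ->
  (forall h, cabs h < d -> f (z + h) = g (z + h)) -> cder f z l -> cder g z l.
Proof.
move=> d0 fg H e e0; have [d1 d10 H1] := H e e0.
exists (Num.min d d1); first by rewrite lt_min d0.
move=> h; rewrite lt_min => /andP[h1 h2]; rewrite -fg//.
have := fg 0; rewrite cabs0 addr0 => <-//; exact: H1.
Qed.

Lemma cder_unique f z l1 l2 : cder f z l1 -> cder f z l2 -> l1 = l2.
Proof.
move=> H1 H2; apply/eqP; rewrite -subr_eq0 -cabs_eq0 eq_le cabs_ge0 andbT.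
apply/ler_addgt0Pl => e e0; rewrite addr0.
have [d1 d10 D1] := H1 _ (half_pos e0).
have [d2 d20 D2] := H2 _ (half_pos e0).
set d := Num.min d1 d2 / 2.
have d0 : 0 < d by rewrite divr_gt0// lt_min d10.
have dd : d < Num.min d1 d2.
  by rewrite ltr_pdivrMr// ltr_pMr ?ltr1n// lt_min d10.
have dn : cabs (rc d) = d by rewrite cabs_rc ger0_norm// ltW.
move: dd; rewrite lt_min -dn => /andP[/D1 h1 /D2 h2].
have : cabs (l1 - l2) * d <= e * d.
  rewrite -{1}dn -cabsM.
  have -> : (l1 - l2) * rc d = (f (z + rc d) - f z - l2 * rc d) -
    (f (z + rc d) - f z - l1 * rc d) by ring.
  rewrite dn in h1 h2; rewrite (le_trans (cabsB _ _))// (splitr e) mulrDl lerD//.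
by rewrite ler_pM2r.
Qed.

Lemma cder_cst (c z : C) : cder (fun=> c) z 0.
Proof.
move=> e e0; exists 1 => // h _.
by rewrite subrr mul0r subr0 cabs0 mulr_ge0 ?cabs_ge0// ltW.
Qed.

Lemma cder_id z : cder id z 1.
Proof.
move=> e e0; exists 1 => // h _.
have -> : id (z + h) - id z - 1 * h = 0 by rewrite /=; ring.
by rewrite cabs0 mulr_ge0 ?cabs_ge0// ltW.
Qed.

Lemma cderD f g z l m : cder f z l -> cder g z m ->
  cder (fun w => f w + g w) z (l + m).
Proof.
move=> H1 H2 e e0.
have [d1 d10 D1] := H1 _ (half_pos e0).
have [d2 d20 D2] := H2 _ (half_pos e0).
exists (Num.min d1 d2); first by rewrite lt_min d10.
move=> h; rewrite lt_min => /andP[/D1 h1 /D2 h2].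
have -> : f (z + h) + g (z + h) - (f z + g z) - (l + m) * h =
  (f (z + h) - f z - l * h) + (g (z + h) - g z - m * h) by ring.
by rewrite (le_trans (cabsD _ _))// (splitr e) mulrDl lerD.
Qed.

Lemma cderM f g z l m : cder f z l -> cder g z m ->
  cder (fun w => f w * g w) z (l * g z + f z * m).
Proof.
move=> H1 H2 e e0.
(* [M] bounds the moduli of [f z], of [l] and, once [g] varies by less than 1, of [g (z + h)]; each
   of the three remainder terms then costs a third of [e]. *)
pose M := 1 + cabs (f z) + cabs (g z) + cabs l.
have [nf ng nl] : [/\ 0 <= cabs (f z), 0 <= cabs (g z) & 0 <= cabs l].
  by rewrite !cabs_ge0.
have M0 : 0 < M by rewrite /M; lra.
have eM : 0 < e / (3 * M) by rewrite divr_gt0// mulr_gt0.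
have [d1 d10 D1] := H1 _ eM.
have [d2 d20 D2] := H2 _ eM.
have [d3 d30 D3] := cder_ccont H2 eM.
have [d4 d40 D4] := cder_ccont H2 ltr01.
exists (Num.min (Num.min d1 d2) (Num.min d3 d4)).
  by rewrite !lt_min d10 d20 d30.
move=> h; rewrite !lt_min => /andP[/andP[/D1 h1 /D2 h2] /andP[/D3 h3 /D4 h4]].
have -> : f (z + h) * g (z + h) - f z * g z - (l * g z + f z * m) * h =
  (f (z + h) - f z - l * h) * g (z + h) + l * h * (g (z + h) - g z) +
  f z * (g (z + h) - g z - m * h) by ring.
have n0 := cabs_ge0 h.
have B1 : cabs (g (z + h)) <= M.
  by have := cabs_lower (g (z + h)) (g z); rewrite /M; lra.
have B2 : cabs (f z) <= M by rewrite /M; lra.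
have B3 : cabs l <= M by rewrite /M; lra.
have eM3 : e / (3 * M) * M = e / 3 by field; rewrite gt_eqF.
apply: (le_trans (cabsD _ _)); apply: le_trans (lerD (cabsD _ _) (lexx _)) _.
rewrite !cabsM.
have -> : e * cabs h = e / 3 * cabs h + e / 3 * cabs h + e / 3 * cabs h by field.
rewrite -eM3; apply: lerD; first apply: lerD.
- by rewrite mulrAC; apply: ler_pM; rewrite ?cabs_ge0.
- have -> : cabs l * cabs h * cabs (g (z + h) - g z) =
    cabs (g (z + h) - g z) * cabs l * cabs h by ring.
  by apply: ler_wpM2r => //; apply: ler_pM; rewrite ?cabs_ge0// ltW.
- by rewrite mulrC mulrAC; apply: ler_pM; rewrite ?cabs_ge0.
Qed.

Lemma cder_inv z : z != 0 -> cder GRing.inv z (- z ^- 2).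
Proof.
move=> z0 e e0; have n0 : 0 < cabs z by rewrite cabs_gt0.
(* The first bound keeps |z + h| above |z| / 2; the second is what the remainder h^2 / (z^2 (z + h))
   then requires. *)
exists (Num.min (cabs z / 2) (e * cabs z ^+ 3 / 2)).
  by rewrite lt_min !divr_gt0// mulr_gt0// exprn_gt0.
move=> h; rewrite lt_min => /andP[h1 h2].
have zh : cabs z / 2 <= cabs (z + h).
  by have := cabs_lower z (- h); rewrite cabsN opprK; lra.
have zh0 : z + h != 0 by rewrite -cabs_gt0; apply: lt_le_trans zh; rewrite divr_gt0.
have -> : (z + h)^-1 - z^-1 - (- z ^- 2) * h = h * (h / (z ^+ 2 * (z + h))).
  by field; rewrite zh0 z0.
rewrite cabsM mulrC; apply: ler_wpM2r; first exact: cabs_ge0.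
rewrite !cabsM cabsV cabsM cabsX.
rewrite ler_pdivrMr ?mulr_gt0 ?exprn_gt0 ?cabs_gt0//.
apply: (le_trans (ltW h2)).
have -> : e * cabs z ^+ 3 / 2 = e * cabs z ^+ 2 * (cabs z / 2) by ring.
by rewrite [leRHS]mulrA; apply: ler_wpM2l => //; rewrite mulr_ge0 ?exprn_ge0// ltW.
Qed.

Lemma cder_comp f g z l m : cder g z m -> cder f (g z) l ->
  cder (fun w => f (g w)) z (l * m).
Proof.
move=> H2 H1 e e0.
have m1 : 0 < cabs m + 1 by rewrite ltr_wpDl ?cabs_ge0.
have l1 : 0 < cabs l + 1 by rewrite ltr_wpDl ?cabs_ge0.
have e1 : 0 < e / 2 / (cabs m + 1) by rewrite !divr_gt0.
have e2 : 0 < e / 2 / (cabs l + 1) by rewrite !divr_gt0.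
have [d1 d10 D1] := H1 _ e1.
have [d2 d20 D2] := H2 _ e2.
have [d3 d30 D3] := H2 _ ltr01.
have [d4 d40 D4] := cder_ccont H2 d10.
exists (Num.min d2 (Num.min d3 d4)); first by rewrite !lt_min d20 d30.
move=> h; rewrite !lt_min => /and3P[/D2 h2 /D3 h3 /D4 /D1].
rewrite addrCA subrr addr0 => h1.
have n0 := cabs_ge0 h.
have -> : f (g (z + h)) - f (g z) - l * m * h =
   (f (g (z + h)) - f (g z) - l * (g (z + h) - g z)) +
   l * (g (z + h) - g z - m * h) by ring.
rewrite (le_trans (cabsD _ _))// (splitr e) mulrDl lerD//.
  apply: (le_trans h1); have B : cabs (g (z + h) - g z) <= (cabs m + 1) * cabs h.
    rewrite -[X in cabs X](subrK (m * h)) (le_trans (cabsD _ _))// cabsM.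
    by move: h3; rewrite mul1r; lra.
  apply: le_trans (ler_wpM2l (ltW e1) B) _.
  by rewrite mulrA divfK// gt_eqF.
rewrite cabsM; apply: le_trans (ler_wpM2l (cabs_ge0 _) h2) _.
rewrite mulrA; apply: ler_wpM2r => //.
rewrite mulrCA ler_piMr//; first by rewrite ltW// divr_gt0.
by rewrite ler_pdivrMr// mul1r lerDl.
Qed.

Lemma cderN f z l : cder f z l -> cder (fun w => - f w) z (- l).
Proof.
move=> H e e0; have [d d0 D] := H e e0; exists d => // h /D.
by rewrite -cabsN; congr (cabs _ <= _); ring.
Qed.

Lemma cderB f g z l m : cder f z l -> cder g z m ->
  cder (fun w => f w - g w) z (l - m).
Proof. by move=> Hf /cderN; exact: cderD. Qed.

Lemma cderMl (c : C) f z l : cder f z l -> cder (fun w => c * f w) z (c * l).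
Proof.
move=> H; have := cderM (cder_cst c z) H; by rewrite mul0r add0r.
Qed.

Lemma cderV f z l : f z != 0 -> cder f z l ->
  cder (fun w => (f w)^-1) z (- l / f z ^+ 2).
Proof.
move=> fz H; have := cder_comp H (cder_inv fz).
by rewrite mulNr mulrC mulNr.
Qed.

Lemma cder_subr (p z : C) : cder (fun w => w - p) z 1.
Proof. by have := cderB (cder_id z) (cder_cst p z); rewrite subr0. Qed.

Lemma ex_cderM f g z : (exists l, cder f z l) -> (exists l, cder g z l) ->
  exists l, cder (fun w => f w * g w) z l.
Proof. by move=> [l hl] [m hm]; eexists; exact: cderM hl hm. Qed.

Lemma ex_cderV f z : f z != 0 -> (exists l, cder f z l) ->
  exists l, cder (fun w => (f w)^-1) z l.
Proof. by move=> f0 [l hl]; eexists; exact: cderV hl. Qed.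

Lemma ex_cderX f n z : (exists l, cder f z l) ->
  exists l, cder (fun w => f w ^+ n) z l.
Proof.
move=> H; elim: n => [|n IH]; first by exists 0; exact: cder_cst.
have [l hl] := ex_cderM H IH; exists l.
by apply: cder_ext ltr01 _ hl => h _; rewrite exprS.
Qed.

End ComplexDerivative.

(** * Complex-valued functions of a real parameter *)

Section RealParameter.
Variable R : realType.
Local Notation C := (Cplx R).
Local Notation mu := (@lebesgue_measure R).

Definition rcont (g : R -> C) (t : R) := forall e : R, 0 < e ->
  exists2 d : R, 0 < d & forall s : R, `|s - t| < d -> cabs (g s - g t) < e.

Definition rder (g : R -> C) (t : R) (l : C) := forall e : R, 0 < e ->
  exists2 d : R, 0 < d & forall s : R, `|s| < d ->
    cabs (g (t + s) - g t - l * rc s) <= e * `|s|.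

Lemma continuous_epsP (g : R -> R) t :
  (forall e : R, 0 < e -> exists2 d : R, 0 < d &
    forall s, `|s - t| < d -> `|g s - g t| < e) -> {for t, continuous g}.
Proof.
move=> H; apply/cvgrPdist_lt => e e0; have [d d0 D] := H e e0.
apply/nbhs_ballP; exists d => // s; rewrite /ball /= => st.
by rewrite distrC; apply: D; rewrite distrC.
Qed.

Lemma rcont_cre g t : rcont g t -> {for t, continuous (fun s => cre (g s))}.
Proof.
move=> H; apply: continuous_epsP => e e0; have [d d0 D] := H e e0.
by exists d => // s /D; apply: le_lt_trans; rewrite -creB cabs_re.
Qed.

Lemma rcont_cim g t : rcont g t -> {for t, continuous (fun s => cim (g s))}.
Proof.
move=> H; apply: continuous_epsP => e e0; have [d d0 D] := H e e0.
by exists d => // s /D; apply: le_lt_trans; rewrite -cimB cabs_im.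
Qed.

Lemma is_derive_epsP (g : R -> R) (t l : R) :
  (forall e : R, 0 < e -> exists2 d : R, 0 < d & forall s : R, `|s| < d ->
    `|g (t + s) - g t - l * s| <= e * `|s|) -> is_derive t 1 g l.
Proof.
move=> H.
have L : h^-1 *: ((g \o shift t) (h *: 1) - g t) @[h --> 0^'] --> l.
  apply/cvgrPdist_le => e e0; have [d d0 D] := H _ e0.
  apply/nbhs_ballP; exists d => // h; rewrite /ball /= sub0r normrN => hd h0.
  have h0' : 0 < `|h| by rewrite normr_gt0.
  rewrite -(ler_pM2r h0') (le_trans _ (D h hd))// -normrM -normrN.
  rewrite (_ : g (t + h) - g t - l * h =
    - ((l - h^-1 *: (g (h *: 1 + t) - g t)) * h)) //.
  rewrite /GRing.scale /= mulr1 (addrC h); field; exact: h0.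
apply: DeriveDef; first by apply/cvg_ex; exists l.
by apply: cvg_lim L.
Qed.

Lemma is_derive_eps (g : R -> R) (t l : R) : is_derive t 1 g l ->
  forall e : R, 0 < e -> exists2 d : R, 0 < d & forall s : R, `|s| < d ->
    `|g (t + s) - g t - l * s| <= e * `|s|.
Proof.
case=> Hd Hl e e0; move: Hd; rewrite /derivable.
move=> /cvg_ex[l' Hl'].
have ll : l' = l by rewrite -Hl; apply/esym; exact: cvg_lim Hl'.
rewrite {}ll in Hl'; move/cvgrPdist_le : Hl' => H.
have /nbhs_ballP[d /= d0 D] := H _ e0.
exists d => // s sd.
have [->|s0] := eqVneq s 0; first by rewrite addr0 subrr mulr0 subr0 normr0 mulr0.
have := D s; rewrite /ball /= sub0r normrN => /(_ sd s0) H1.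
have -> : g (t + s) - g t - l * s = - s * (l - s^-1 *: (g (s *: 1 + t) - g t)).
  rewrite /GRing.scale /= mulr1 (addrC s); field; exact: s0.
by rewrite normrM normrN mulrC ler_wpM2r.
Qed.

Lemma rder_cre g t l : rder g t l -> is_derive t 1 (fun s => cre (g s)) (cre l).
Proof.
move=> H; apply: is_derive_epsP => e e0; have [d d0 D] := H e e0.
exists d => // s /D; apply: le_trans.
have -> : cre (g (t + s)) - cre (g t) - cre l * s = cre (g (t + s) - g t - l * rc s).
  by rewrite !creB creM /= mulr0 subr0.
exact: cabs_re.
Qed.

Lemma rder_cim g t l : rder g t l -> is_derive t 1 (fun s => cim (g s)) (cim l).
Proof.
move=> H; apply: is_derive_epsP => e e0; have [d d0 D] := H e e0.
exists d => // s /D; apply: le_trans.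
have -> : cim (g (t + s)) - cim (g t) - cim l * s = cim (g (t + s) - g t - l * rc s).
  by rewrite !cimB cimM /= mulr0 add0r.
exact: cabs_im.
Qed.

Lemma rder_reim (u v : R -> R) (t a b : R) : is_derive t 1 u a -> is_derive t 1 v b ->
  rder (fun s => (u s +i* v s)%C) t (a +i* b)%C.
Proof.
move=> /is_derive_eps Hu /is_derive_eps Hv e e0.
have [d1 d10 D1] := Hu _ (half_pos e0); have [d2 d20 D2] := Hv _ (half_pos e0).
exists (Num.min d1 d2); first by rewrite lt_min d10.
move=> s; rewrite lt_min => /andP[/D1 h1 /D2 h2].
apply: le_trans (cabs_le_reim _) _; rewrite (splitr e) mulrDl.
apply: lerD.
  by move: h1; rewrite !creB creM /= mulr0 subr0.
by move: h2; rewrite !cimB cimM /= mulr0 add0r.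
Qed.

Lemma rder_rcont g t l : rder g t l -> rcont g t.
Proof.
move=> H e e0; have [d d0 dH] := H 1 ltr01.
have l1 : 0 < cabs l + 1 by rewrite ltr_wpDl ?cabs_ge0.
exists (Num.min d (e / (cabs l + 1) / 2)); first by rewrite lt_min d0 !divr_gt0.
move=> s; rewrite lt_min => /andP[/dH h1 h2].
have : cabs (g s - g t) <= (cabs l + 1) * `|s - t|.
  rewrite -[X in cabs X](subrK (l * rc (s - t))) (le_trans (cabsD _ _))// cabsM.
  rewrite cabs_rc mulrDl mul1r addrC lerD2l.
  by move: h1; rewrite mul1r (_ : t + (s - t) = s)//; ring.
move/le_lt_trans; apply; rewrite mulrC -ltr_pdivlMr//.
apply: lt_le_trans h2 _; rewrite ler_pdivrMr// ler_peMr ?ler1n//.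
by rewrite divr_ge0// ltW.
Qed.

Lemma rder_comp (F : C -> C) g t l m : rder g t m -> cder F (g t) l ->
  rder (fun s => F (g s)) t (l * m).
Proof.
move=> H2 H1 e e0.
have m1 : 0 < cabs m + 1 by rewrite ltr_wpDl ?cabs_ge0.
have l1 : 0 < cabs l + 1 by rewrite ltr_wpDl ?cabs_ge0.
have e1 : 0 < e / 2 / (cabs m + 1) by rewrite !divr_gt0.
have e2 : 0 < e / 2 / (cabs l + 1) by rewrite !divr_gt0.
have [d1 d10 D1] := H1 _ e1.
have [d2 d20 D2] := H2 _ e2.
have [d3 d30 D3] := H2 _ ltr01.
have [d4 d40 D4] := rder_rcont H2 d10.
exists (Num.min d2 (Num.min d3 d4)); first by rewrite !lt_min d20 d30.
move=> s; rewrite !lt_min => /and3P[/D2 h2 /D3 h3 h4].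
have := D4 (t + s); rewrite (addrC t) addrK => /(_ h4) /D1.
rewrite addrCA subrr addr0 (addrC s) => h1.
have n0 := normr_ge0 s.
have -> : F (g (t + s)) - F (g t) - l * m * rc s =
   (F (g (t + s)) - F (g t) - l * (g (t + s) - g t)) +
   l * (g (t + s) - g t - m * rc s) by ring.
rewrite (le_trans (cabsD _ _))// (splitr e) mulrDl lerD//.
  apply: (le_trans h1); have B : cabs (g (t + s) - g t) <= (cabs m + 1) * `|s|.
    rewrite -[X in cabs X](subrK (m * rc s)) (le_trans (cabsD _ _))// cabsM cabs_rc.
    by move: h3; rewrite mul1r; lra.
  apply: le_trans (ler_wpM2l (ltW e1) B) _.
  by rewrite mulrA divfK// gt_eqF.
rewrite cabsM; apply: le_trans (ler_wpM2l (cabs_ge0 _) h2) _.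
rewrite mulrA; apply: ler_wpM2r => //.
rewrite mulrCA ler_piMr//; first by rewrite ltW// divr_gt0.
by rewrite ler_pdivrMr// mul1r lerDl.
Qed.

Lemma rcont_comp (F : C -> C) g t : rcont g t -> ccont F (g t) ->
  rcont (fun s => F (g s)) t.
Proof.
move=> H2 H1 e e0; have [d d0 D] := H1 e e0; have [d1 d10 D1] := H2 d d0.
exists d1 => // s /D1 /D; by rewrite (_ : g t + (g s - g t) = g s)//; ring.
Qed.

Lemma rcont_cst (c : C) t : rcont (fun=> c) t.
Proof. by move=> e e0; exists 1 => // s _; rewrite subrr cabs0. Qed.

Lemma rcontD g1 g2 t : rcont g1 t -> rcont g2 t -> rcont (fun s => g1 s + g2 s) t.
Proof.
move=> H1 H2 e e0.
have [d1 d10 D1] := H1 _ (half_pos e0); have [d2 d20 D2] := H2 _ (half_pos e0).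
exists (Num.min d1 d2); first by rewrite lt_min d10.
move=> s; rewrite lt_min => /andP[/D1 h1 /D2 h2].
rewrite (_ : _ - _ = (g1 s - g1 t) + (g2 s - g2 t)); last by ring.
by apply: le_lt_trans (cabsD _ _) _; rewrite (splitr e) ltrD.
Qed.

Lemma rcontM g1 g2 t : rcont g1 t -> rcont g2 t -> rcont (fun s => g1 s * g2 s) t.
Proof.
move=> H1 H2 e e0.
pose M := 1 + cabs (g1 t) + cabs (g2 t).
have n1 := cabs_ge0 (g1 t); have n2 := cabs_ge0 (g2 t).
have M0 : 0 < M by rewrite /M; lra.
have eM : 0 < e / (2 * M) by rewrite divr_gt0// mulr_gt0.
have [d1 d10 D1] := H1 _ eM; have [d2 d20 D2] := H2 _ eM.
have [d3 d30 D3] := H2 _ ltr01.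
exists (Num.min d1 (Num.min d2 d3)); first by rewrite !lt_min d10 d20.
move=> s; rewrite !lt_min => /and3P[/D1 h1 /D2 h2 /D3 h3].
rewrite (_ : _ - _ = (g1 s - g1 t) * g2 s + g1 t * (g2 s - g2 t)); last by ring.
have B : cabs (g2 s) <= M.
  by have := cabs_lower (g2 s) (g2 t); rewrite /M; lra.
have B' : cabs (g1 t) <= M by rewrite /M; lra.
have eM2 : e / (2 * M) * M = e / 2 by field; rewrite gt_eqF.
apply: le_lt_trans (cabsD _ _) _; rewrite !cabsM (splitr e) -eM2.
have [s0|s0] := leP (cabs (g1 t)) 0.
  have -> : cabs (g1 t) = 0 by lra.
  rewrite mul0r addr0; apply: (@le_lt_trans _ _ (e / (2 * M) * M)).
    by apply: ler_pM; rewrite ?cabs_ge0// ltW.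
  by rewrite ltrDl mulr_gt0.
apply: ler_ltD.
  by apply: ler_pM; rewrite ?cabs_ge0// ltW.
rewrite mulrC; apply: (@lt_le_trans _ _ (e / (2 * M) * cabs (g1 t))).
  by rewrite ltr_pM2r.
by apply: ler_wpM2l => //; exact: ltW.
Qed.

End RealParameter.

(** * Integrals of complex-valued functions over an interval *)

Section ComplexIntegral.
Variable R : realType.
Local Notation C := (Cplx R).
Local Notation mu := (@lebesgue_measure R).
Implicit Types (a b t : R) (g : R -> C).

Definition cint a b g : C :=
  (\int[mu]_(t in `[a, b]) cre (g t) +i* \int[mu]_(t in `[a, b]) cim (g t))%C.

Definition rcont_on a b g := forall t, a <= t <= b -> rcont g t.

Lemma continuous_on_within a b (u : R -> R) :
  (forall t, a <= t <= b -> {for t, continuous u}) ->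
  {within `[a, b], continuous u}.
Proof.
move=> H; apply: continuous_in_subspaceT => t; rewrite inE /= in_itv /=.
exact: H.
Qed.

Lemma continuous_on_integrable a b (u : R -> R) :
  (forall t, a <= t <= b -> {for t, continuous u}) ->
  mu.-integrable `[a, b] (EFin \o u).
Proof.
move=> H; apply: continuous_compact_integrable; first exact: segment_compact.
exact: continuous_on_within.
Qed.

Lemma integrable_cre a b g : rcont_on a b g ->
  mu.-integrable `[a, b] (EFin \o (fun t => cre (g t))).
Proof. by move=> H; apply: continuous_on_integrable => t /H /rcont_cre. Qed.

Lemma integrable_cim a b g : rcont_on a b g ->
  mu.-integrable `[a, b] (EFin \o (fun t => cim (g t))).
Proof. by move=> H; apply: continuous_on_integrable => t /H /rcont_cim. Qed.

Lemma cint_ext a b g h : (forall t, a <= t <= b -> g t = h t) ->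
  cint a b g = cint a b h.
Proof.
by move=> H; congr (_ +i* _)%C; apply: eq_Rintegral => t;
  rewrite inE /= in_itv /= => /H ->.
Qed.

Lemma cintD a b g h : rcont_on a b g -> rcont_on a b h ->
  cint a b (fun t => g t + h t) = cint a b g + cint a b h.
Proof.
move=> Hg Hh; rewrite /cint.
have -> : (\int[mu]_(t in `[a, b]) cre (g t + h t) =
  \int[mu]_(t in `[a, b]) cre (g t) + \int[mu]_(t in `[a, b]) cre (h t))%R.
  rewrite -RintegralD//; [|exact: integrable_cre|exact: integrable_cre].
  by apply: eq_Rintegral => t _; rewrite creD.
have -> : (\int[mu]_(t in `[a, b]) cim (g t + h t) =
  \int[mu]_(t in `[a, b]) cim (g t) + \int[mu]_(t in `[a, b]) cim (h t))%R.
  rewrite -RintegralD//; [|exact: integrable_cim|exact: integrable_cim].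
  by apply: eq_Rintegral => t _; rewrite cimD.
by [].
Qed.

Lemma cintZ a b (c : C) g : rcont_on a b g ->
  cint a b (fun t => c * g t) = c * cint a b g.
Proof.
move=> Hg.
have [ir ii] := (integrable_cre Hg, integrable_cim Hg).
have ZI (k : R) (u : R -> R) : mu.-integrable `[a, b] (EFin \o u) ->
    mu.-integrable `[a, b] (EFin \o (fun t => k * u t)).
  by move=> iu; apply: (@integrableZl _ _ R mu `[a, b] _ k _ iu).
rewrite /cint.
have -> : (\int[mu]_(t in `[a, b]) cre (c * g t) = cre c *
  \int[mu]_(t in `[a, b]) cre (g t) - cim c * \int[mu]_(t in `[a, b]) cim (g t))%R.
  rewrite -!RintegralZl// -RintegralB//; [|exact: ZI|exact: ZI].
  by apply: eq_Rintegral => t _; rewrite creM.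
have -> : (\int[mu]_(t in `[a, b]) cim (c * g t) = cre c *
  \int[mu]_(t in `[a, b]) cim (g t) + cim c * \int[mu]_(t in `[a, b]) cre (g t))%R.
  rewrite -!RintegralZl// -RintegralD//; [|exact: ZI|exact: ZI].
  by apply: eq_Rintegral => t _; rewrite cimM.
by case: c.
Qed.

Lemma rcont_onZ a b (c : C) g : rcont_on a b g -> rcont_on a b (fun t => c * g t).
Proof. by move=> H t /H; apply: rcontM; exact: rcont_cst. Qed.

Lemma rcontN g t : rcont g t -> rcont (fun s => - g s) t.
Proof.
move=> H e e0; have [d d0 D] := H e e0; exists d => // s /D.
by rewrite -cabsN; congr (cabs _ < _); ring.
Qed.

Lemma cintB a b g h : rcont_on a b g -> rcont_on a b h ->
  cint a b (fun t => g t - h t) = cint a b g - cint a b h.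
Proof.
move=> Hg Hh; rewrite cintD//; last by move=> t /Hh /rcontN.
congr (_ + _); rewrite -[RHS]mulN1r -cintZ//.
by apply: cint_ext => t _; rewrite mulN1r.
Qed.

Lemma cre_cint a b g : cre (cint a b g) = \int[mu]_(t in `[a, b]) cre (g t).
Proof. by []. Qed.

Definition cconj (z : C) : C := (z^*)%C.

Lemma mul_cconj z : cconj z * z = rc (cabs z ^+ 2).
Proof.
case: z => x y; rewrite /rc /cabs /= sqr_sqrtr ?addr_ge0 ?sqr_ge0//.
by apply/eqP; rewrite eq_complex /=; apply/andP; split; apply/eqP; ring.
Qed.

Lemma cabs_conj z : cabs (cconj z) = cabs z.
Proof. by case: z => x y; rewrite /cabs /= sqrrN. Qed.

Lemma cabs_cint a b g (u : R -> R) : rcont_on a b g ->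
  mu.-integrable `[a, b] (EFin \o u) ->
  (forall t, a <= t <= b -> cabs (g t) <= u t) ->
  cabs (cint a b g) <= \int[mu]_(t in `[a, b]) u t.
Proof.
move=> Hg iu gu; set I := cint a b g.
have [I0|I0] := eqVneq I 0.
  rewrite I0 cabs0; apply: Rintegral_ge0 => t /=; rewrite in_itv /= => /gu.
  by apply: le_trans; exact: cabs_ge0.
have nI : 0 < cabs I by rewrite cabs_gt0.
(* Multiplying by this unimodular constant turns the integral into its modulus, so that only a real
   part has to be estimated. *)
pose c := rc (cabs I)^-1 * cconj I.
have c1 : cabs c = 1.
  by rewrite cabsM cabs_conj cabs_rc normfV ger0_norm ?cabs_ge0// mulVf ?gt_eqF.
have -> : cabs I = cre (c * I).
  by rewrite -mulrA mul_cconj -rcM expr2 mulrA mulVf ?gt_eqF// mul1r.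
rewrite /I -cintZ// cre_cint; apply: le_Rintegral => //.
  exact: integrable_cre (rcont_onZ c Hg).
move=> t /=; rewrite in_itv /= => /gu; apply: le_trans.
by rewrite (le_trans (ler_norm _))// (le_trans (cabs_re _))// cabsM c1 mul1r.
Qed.

Lemma cabs_cint_le a b g (M : R) : a < b -> rcont_on a b g ->
  (forall t, a <= t <= b -> cabs (g t) <= M) -> cabs (cint a b g) <= M * (b - a).
Proof.
move=> ab Hg gM.
have -> : M * (b - a) = \int[mu]_(t in `[a, b]) M.
  by rewrite Rintegral_cst//= lebesgue_measure_itv /= lte_fin ab.
apply: cabs_cint => //.
by apply: continuous_on_integrable => t _; exact: cst_continuous.
Qed.

Lemma Rint_FTC a b (u F : R -> R) : a < b ->
  (forall t, a <= t <= b -> {for t, continuous u}) ->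
  (forall t, a <= t <= b -> is_derive t 1 F (u t)) ->
  \int[mu]_(t in `[a, b]) u t = F b - F a.
Proof.
move=> ab cu dF; rewrite /Rintegral (@continuous_FTC2 _ u F a b)//.
- exact: continuous_on_within.
- have cF t : a <= t <= b -> {for t, continuous F}.
    move=> /dF dFt; apply: differentiable_continuous.
    by apply/derivable1_diffP; case: dFt.
  split.
  + by move=> t; rewrite in_itv /= => /andP[/ltW at_ /ltW tb];
      case: (dF t); rewrite ?at_.
  + by apply: cvg_at_right_filter; apply: cF; rewrite lexx ltW.
  + by apply: cvg_at_left_filter; apply: cF; rewrite lexx andbT ltW.
- move=> t; rewrite in_itv /= => /andP[/ltW at_ /ltW tb]; rewrite derive1E.
  by case: (dF t); rewrite ?at_.
Qed.

Lemma cint_FTC a b g (G : R -> C) : a < b -> rcont_on a b g ->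
  (forall t, a <= t <= b -> rder G t (g t)) -> cint a b g = G b - G a.
Proof.
move=> ab cg dG; rewrite /cint.
have -> := @Rint_FTC a b (fun t => cre (g t)) (fun t => cre (G t)) ab
  (fun t h => rcont_cre (cg t h)) (fun t h => rder_cre (dG t h)).
have -> := @Rint_FTC a b (fun t => cim (g t)) (fun t => cim (G t)) ab
  (fun t h => rcont_cim (cg t h)) (fun t h => rder_cim (dG t h)).
by case: (G a) => ? ?; case: (G b).
Qed.

Lemma real_primitive a b (u : R -> R) :
  (forall t, a <= t <= b -> {for t, continuous u}) ->
  exists F : R -> R, forall t, a <= t <= b -> is_derive t 1 F (u t).
Proof.
move=> cu.
have [ab|ba] := leP a b; last first.
  by exists id => t /andP[at_ tb]; have := le_lt_trans (le_trans at_ tb) ba; rewrite ltxx.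
(* Clamping to [[a, b]] extends [u] continuously to the line. The integral below starts at [a - 1],
   which makes both endpoints interior points for the fundamental theorem. *)
pose cl t := Num.max a (Num.min b t).
have clP t : a <= cl t <= b.
  by rewrite /cl le_max lexx /= ge_max ab /= ge_min lexx.
have clE t : a <= t <= b -> cl t = t.
  by move=> /andP[at_ tb]; rewrite /cl min_r// max_r.
have ccl (t : R) : {for t, continuous cl}.
  apply: continuous_epsP => e e0; exists e => // s; apply: le_lt_trans.
  have h1 := ler_norm (s - t); have h2 := ler_norm (t - s); rewrite distrC in h2.
  rewrite ler_norml /cl !maxElt !minElt.
  by case: (ltP b s) => ?; case: (ltP b t) => ?; do 2?[case: ltP => ?];
    apply/andP; split; lra.
pose v t := u (cl t).
have cv : continuous v.
  move=> t; apply: (@continuous_comp _ _ _ cl u); first exact: ccl.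
  exact/cu/clP.
exists (fun x => \int[mu]_(t in `[a - 1, x]) v t)%R => t tab.
have iv : mu.-integrable `[a - 1, b + 1] (EFin \o v).
  by apply: continuous_on_integrable => s _; exact: cv.
have [|||] := @continuous_FTC1_closed R v (a - 1) t (b + 1) _ iv.
- by case/andP: tab; lra.
- by case/andP: tab; lra.
- exact: cv.
move=> d1 d2; apply: DeriveDef => //.
by rewrite -derive1E d2 /v clE.
Qed.

Lemma complex_primitive a b g : rcont_on a b g ->
  exists G : R -> C, forall t, a <= t <= b -> rder G t (g t).
Proof.
move=> cg.
have [|F HF] := @real_primitive a b (fun t => cre (g t)).
  by move=> t /cg /rcont_cre.
have [|G HG] := @real_primitive a b (fun t => cim (g t)).
  by move=> t /cg /rcont_cim.
exists (fun t => (F t +i* G t)%C) => t tab.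
have := rder_reim (HF t tab) (HG t tab).
by case: (g t).
Qed.

End ComplexIntegral.

(** Nested intervals: [2 * c / 2 ^+ n] is the sum of all step bounds from [n] on, so [y] increases,
    [z] decreases, and the supremum of [y] lies in every interval. *)
Lemma dyadic_cvg (R : realType) (x : nat -> R) (c : R) : 0 <= c ->
  (forall n, `|x n.+1 - x n| <= c / 2 ^+ n) ->
  exists l, forall n, `|x n - l| <= 2 * c / 2 ^+ n.
Proof.
move=> c0 xc.
pose y n := x n - 2 * c / 2 ^+ n; pose z n := x n + 2 * c / 2 ^+ n.
have cS n : 2 * c / 2 ^+ n.+1 = c / 2 ^+ n by rewrite exprS; field; rewrite expf_neq0.
have yS n : y n <= y n.+1.
  by have := xc n; rewrite /y cS ler_norml => /andP[]; lra.
have zS n : z n.+1 <= z n.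
  by have := xc n; rewrite /z cS ler_norml => /andP[]; lra.
have yz n : y n <= z n.
  have : 0 <= c / 2 ^+ n by rewrite divr_ge0// exprn_ge0.
  by rewrite /y /z; lra.
have ym n m : (n <= m)%N -> y n <= y m.
  by move=> /subnK <-; elim: (m - n)%N => // k IH; rewrite addSn (le_trans IH).
have zm n m : (n <= m)%N -> z m <= z n.
  by move=> /subnK <-; elim: (m - n)%N => // k IH; rewrite addSn (le_trans _ IH).
have yzm n m : y n <= z m.
  have [nm|/ltnW mn] := leqP n m; first exact: le_trans (ym _ _ nm) (yz m).
  exact: le_trans (yz n) (zm _ _ mn).
have ub : has_sup (range y).
  by split; [exists (y 0%N), 0%N|exists (z 0%N) => _ [n _ <-]].
exists (sup (range y)) => n; rewrite ler_norml; apply/andP; split.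
  have : sup (range y) <= z n by apply: ge_sup; [case: ub|move=> _ [m _ <-]].
  by rewrite /z; lra.
have : y n <= sup (range y) by apply: ub_le_sup; [case: ub|exists n].
by rewrite /y; lra.
Qed.

(** * Integrals along straight segments *)

Section Segment.
Variable R : realType.
Local Notation C := (Cplx R).
Implicit Types (a b c z w : C) (f : C -> C) (s t : R).

Definition lerp a b t : C := a + rc t * (b - a).

Definition seg f a b : C := (b - a) * cint 0 1 (fun t => f (lerp a b t)).

Definition seg_cont f a b := forall t, 0 <= t <= 1 -> ccont f (lerp a b t).

Lemma rder_lerp a b t : rder (lerp a b) t (b - a).
Proof.
move=> e e0; exists 1 => // s _.
have -> : lerp a b (t + s) - lerp a b t - (b - a) * rc s = 0.
  by rewrite /lerp rcD; ring.
by rewrite cabs0 mulr_ge0// ltW.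
Qed.

Lemma rcont_lerp f a b t : ccont f (lerp a b t) -> rcont (fun t => f (lerp a b t)) t.
Proof. by move=> H; apply: rcont_comp H; exact: rder_rcont (rder_lerp a b t). Qed.

Lemma seg_rcont f a b : seg_cont f a b -> rcont_on 0 1 (fun t => f (lerp a b t)).
Proof. by move=> H t /H; exact: rcont_lerp. Qed.

Lemma rder_comp_affine (G : R -> C) (al be t : R) l : rder G (al + be * t) l ->
  rder (fun s => G (al + be * s)) t (l * rc be).
Proof.
move=> H e e0.
have b1 : 0 < `|be| + 1 by rewrite ltr_wpDl.
have [d d0 D] := H (e / (`|be| + 1)) (divr_gt0 e0 b1).
exists (d / (`|be| + 1)); first exact: divr_gt0.
move=> s; rewrite ltr_pdivlMr// => sd.
have bs : `|be * s| <= `|s| * (`|be| + 1) by rewrite normrM mulrC ler_wpM2l// lerDl.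
have := D (be * s) (le_lt_trans bs sd).
rewrite rcM (_ : al + be * t + be * s = al + be * (t + s)); last by ring.
rewrite mulrA => /le_trans; apply.
rewrite -mulrA ler_wpM2l ?(ltW e0)// mulrC ler_pdivrMr//.
Qed.

(** A single primitive of the parametrised integrand serves all subsegments; splitting at the
    midpoint and reversal are then algebra on its values. *)
Lemma seg_additive f a b : seg_cont f a b -> exists G : R -> C, forall al be : R,
  0 <= al <= 1 -> 0 <= be <= 1 -> seg f (lerp a b al) (lerp a b be) = G be - G al.
Proof.
move=> fc; have [G HG] := complex_primitive (seg_rcont fc).
exists (fun t => (b - a) * G t) => al be al01 be01.
have H01 t : 0 <= t <= 1 -> 0 <= al + (be - al) * t <= 1.
  move=> /andP[t0 t1]; case/andP: al01 => a0 a1; case/andP: be01 => b0 b1.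
  have -> : al + (be - al) * t = (1 - t) * al + t * be by ring.
  apply/andP; split; first by rewrite addr_ge0// mulr_ge0// subr_ge0.
  have : (1 - t) * al <= (1 - t) * 1 by apply: ler_wpM2l => //; rewrite subr_ge0.
  have : t * be <= t * 1 by apply: ler_wpM2l.
  lra.
have LL t : lerp (lerp a b al) (lerp a b be) t = lerp a b (al + (be - al) * t).
  by rewrite /lerp rcD rcM rcB; ring.
have cg : rcont_on 0 1 (fun t => f (lerp (lerp a b al) (lerp a b be) t)).
  by move=> t t01; apply: rcont_lerp; rewrite LL; exact/fc/H01.
have E : cint 0 1 (fun t => f (lerp (lerp a b al) (lerp a b be) t) * rc (be - al)) =
   G be - G al.
  rewrite (@cint_FTC _ 0 1 _ (fun t => G (al + (be - al) * t)))//.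
  - by congr (G _ - G _); ring.
  - move=> t t01; apply: rcontM; [exact: cg|exact: rcont_cst].
  - by move=> t t01; rewrite LL; apply: rder_comp_affine; exact/HG/H01.
rewrite -mulrBr -E /seg.
rewrite [X in _ = _ * X](@cint_ext _ 0 1 _ (fun t => rc (be - al) *
  f (lerp (lerp a b al) (lerp a b be) t))); last by move=> t _; rewrite mulrC.
rewrite cintZ// mulrA; congr (_ * _); rewrite /lerp rcB; ring.
Qed.

Lemma lerp0 a b : lerp a b 0 = a. Proof. by rewrite /lerp rc0 mul0r addr0. Qed.
Lemma lerp1 a b : lerp a b 1 = b. Proof. by rewrite /lerp rc1; ring. Qed.

Definition mid a b := lerp a b (2^-1).

Lemma half01 : 0 <= (2^-1 : R) <= 1. Proof. by apply/andP; split; lra. Qed.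

Lemma seg_mid f a b : seg_cont f a b -> seg f a b = seg f a (mid a b) + seg f (mid a b) b.
Proof.
move=> /seg_additive[G HG].
have h01 := half01.
have := HG 0 1; have := HG 0 2^-1; have := HG 2^-1 1.
rewrite !lerp0 !lerp1 -/(mid a b) => -> //; last by rewrite ler01 lexx.
move=> -> //; last by rewrite lexx ler01.
move=> ->; rewrite ?lexx ?ler01//; ring.
Qed.

Lemma seg_rev f a b : seg_cont f a b -> seg f b a = - seg f a b.
Proof.
move=> /seg_additive[G HG].
have := HG 0 1; have := HG 1 0.
rewrite !lerp0 !lerp1 => ->; rewrite ?lexx ?ler01// => ->; rewrite ?lexx ?ler01//; ring.
Qed.

Lemma seg_le f a b (M : R) : seg_cont f a b ->
  (forall t, 0 <= t <= 1 -> cabs (f (lerp a b t)) <= M) ->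
  cabs (seg f a b) <= M * cabs (b - a).
Proof.
move=> fc fM; rewrite cabsM mulrC; apply: ler_wpM2r; first exact: cabs_ge0.
have := cabs_cint_le ltr01 (seg_rcont fc) fM; by rewrite subr0 mulr1.
Qed.

Lemma segB f g a b : seg_cont f a b -> seg_cont g a b ->
  seg (fun z => f z - g z) a b = seg f a b - seg g a b.
Proof.
by move=> /seg_rcont fc /seg_rcont gc; rewrite /seg cintB// mulrBr.
Qed.

Lemma seg_primitive f F a b : seg_cont f a b ->
  (forall t, 0 <= t <= 1 -> cder F (lerp a b t) (f (lerp a b t))) ->
  seg f a b = F b - F a.
Proof.
move=> fc dF; rewrite /seg -cintZ; last exact: seg_rcont.
rewrite (@cint_FTC _ 0 1 _ (fun t => F (lerp a b t)))//.
- by rewrite lerp0 lerp1.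
- exact: rcont_onZ (seg_rcont fc).
- by move=> t /dF H; rewrite mulrC; exact: rder_comp (rder_lerp a b t) H.
Qed.

Lemma lerp_dist a b p t : 0 <= t <= 1 ->
  cabs (lerp a b t - p) <= (1 - t) * cabs (a - p) + t * cabs (b - p).
Proof.
move=> /andP[t0 t1].
have -> : lerp a b t - p = rc (1 - t) * (a - p) + rc t * (b - p).
  by rewrite /lerp rcB rc1; ring.
apply: le_trans (cabsD _ _) _.
by rewrite !cabsM !cabs_rc !ger0_norm// subr_ge0.
Qed.

Lemma lerp_dist_max a b p t (M : R) : 0 <= t <= 1 -> cabs (a - p) <= M ->
  cabs (b - p) <= M -> cabs (lerp a b t - p) <= M.
Proof.
move=> t01 aM bM; apply: le_trans (lerp_dist a b p t01) _.
case/andP: t01 => t0 t1.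
have -> : M = (1 - t) * M + t * M by ring.
by apply: lerD; apply: ler_wpM2l => //; rewrite subr_ge0.
Qed.

End Segment.

(** * Goursat's theorem for triangles in a closed convex set *)

Section Goursat.
Variable R : realType.
Local Notation C := (Cplx R).
Implicit Types (a b c z w p : C) (f : C -> C) (s t : R).

Definition tri f a b c := seg f a b + seg f b c + seg f c a.
Definition perim a b c := cabs (a - b) + cabs (b - c) + cabs (c - a).

Lemma perim_ge0 a b c : 0 <= perim a b c.
Proof. by rewrite !addr_ge0// cabs_ge0. Qed.

Lemma perim_scale a b c a' b' c' : a' - b' = rc (2^-1) * (a - b) ->
  b' - c' = rc (2^-1) * (b - c) -> c' - a' = rc (2^-1) * (c - a) ->
  perim a' b' c' = perim a b c / 2.
Proof.
rewrite /perim => -> -> ->; rewrite !cabsM !cabs_rc ger0_norm; first lra.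
by rewrite invr_ge0.
Qed.

Lemma rc_half : rc (2^-1 : R) = 2^-1.
Proof. by rewrite rcV; congr (_^-1); rewrite -(rmorph_nat (real_complex R)). Qed.

(** The inner edges are run through twice, in opposite directions, and cancel. *)
Lemma tri_subdivide f a b c (ab := mid a b) (bc := mid b c) (ca := mid c a) :
  seg_cont f a b -> seg_cont f b c -> seg_cont f c a ->
  seg_cont f ab bc -> seg_cont f bc ca -> seg_cont f ca ab ->
  tri f a b c = tri f a ab ca + tri f ab b bc + tri f ca bc c + tri f bc ca ab.
Proof.
move=> h1 h2 h3 h4 h5 h6; rewrite /tri (seg_mid h1) (seg_mid h2) (seg_mid h3).
rewrite -/ab -/bc -/ca (seg_rev h4) (seg_rev h5) (seg_rev h6); ring.
Qed.

Variables (K : C -> Prop) (f : C -> C).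
Hypothesis K_convex : forall a b t, K a -> K b -> 0 <= t <= 1 -> K (lerp a b t).
Hypothesis K_closed : forall p,
  (forall e : R, 0 < e -> exists2 z, K z & cabs (z - p) < e) -> K p.
Hypothesis f_der : forall z, K z -> exists l, cder f z l.

Lemma seg_cont_K a b : K a -> K b -> seg_cont f a b.
Proof.
move=> Ka Kb t t01; have [l hl] := f_der (K_convex Ka Kb t01).
exact: cder_ccont hl.
Qed.

(** Near [p] the function differs from its affine part [g] by at most e |z - p|, and [g] has the
    primitive [G], whose increments cancel around the triangle. *)
Lemma tri_local p (e : R) : K p -> 0 < e -> exists2 d : R, 0 < d &
  forall a b c, K a -> K b -> K c -> forall M, M < d ->
    cabs (a - p) <= M -> cabs (b - p) <= M -> cabs (c - p) <= M ->
    cabs (tri f a b c) <= e * M * perim a b c.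
Proof.
move=> Kp e0; have [l hl] := f_der Kp; have [d d0 D] := hl e e0.
exists d => // a b c Ka Kb Kc M Md aM bM cM.
pose g z := f p + l * (z - p).
have dg z : cder g z l.
  have := cderD (cder_cst (f p) z) (cderMl l (cder_subr p z)).
  by rewrite add0r mulr1.
pose G z := f p * z + l * ((z - p) * (z - p)) * 2^-1.
have two0 : (2 : C) != 0 by rewrite pnatr_eq0.
have dG z : cder G z (g z).
  have h1 := cderMl (f p) (cder_id z).
  have h2 := cderMl l (cderM (cder_subr p z) (cder_subr p z)).
  have h3 := cderM h2 (cder_cst (2^-1) z).
  have -> : g z = f p * 1 + (l * (1 * (z - p) + (z - p) * 1) / 2 +
     l * ((z - p) * (z - p)) * 0) by rewrite /g; field.
  exact: cderD h1 h3.
have gc u v : seg_cont g u v by move=> t _; exact: cder_ccont (dg _).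
have gs u v : seg g u v = G v - G u by apply: seg_primitive => // t _; exact: dG.
have S u v : K u -> K v -> cabs (u - p) <= M -> cabs (v - p) <= M ->
    cabs (seg f u v - (G v - G u)) <= e * M * cabs (u - v).
  move=> Ku Kv uM vM; rewrite -gs -segB//; last exact: seg_cont_K.
  rewrite (cabsC u); apply: seg_le.
    move=> t t01; have [l' hl'] := f_der (K_convex Ku Kv t01).
    exact: cder_ccont (cderB hl' (dg _)).
  move=> t t01; have wM := lerp_dist_max t01 uM vM.
  set w := lerp u v t in wM *.
  have := D (w - p) (le_lt_trans wM Md).
  rewrite (_ : p + (w - p) = w); last by ring.
  rewrite (_ : f w - f p - _ = f w - g w); last by rewrite /g; ring.
  move=> /le_trans; apply; apply: ler_wpM2l => //; exact: ltW.
have -> : tri f a b c = (seg f a b - (G b - G a)) + (seg f b c - (G c - G b)) +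
   (seg f c a - (G a - G c)) by rewrite /tri; ring.
rewrite /perim !mulrDr (le_trans (cabsD _ _))// lerD ?S//.
by rewrite (le_trans (cabsD _ _))// lerD ?S.
Qed.

(** Among the four quarter triangles one carries at least a quarter of the integral, while the
    squared perimeter drops by exactly four. A lower bound [c0 * perim ^+ 2] is therefore inherited
    forever, against [tri_local] at the limit point. The set [K] is a general closed convex set so
    that it can later be a disc cut by a half-plane. *)
Theorem goursat a b c : K a -> K b -> K c -> tri f a b c = 0.
Proof.
move=> Ka Kb Kc; apply/eqP; apply: contraT; rewrite -cabs_gt0 => J0.
have P0 : 0 < perim a b c.
  rewrite lt_neqAle perim_ge0 andbT; apply/eqP => P0; move: J0; rewrite ltNge => /negP; apply.
  have := perim_ge0 a b c.
  have [h1 h2 h3] : [/\ cabs (a - b) = 0, cabs (b - c) = 0 & cabs (c - a) = 0].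
    by move: P0; rewrite /perim; have := cabs_ge0 (a - b); have := cabs_ge0 (b - c);
      have := cabs_ge0 (c - a); split; lra.
  have E (u v : C) : cabs (u - v) = 0 -> seg f u v = 0.
    move=> /eqP; rewrite cabs_eq0 subr_eq0 => /eqP ->.
    by rewrite /seg subrr mul0r.
  by rewrite /tri !E// !addr0 cabs0.
(* The factor 2 makes the initial inequality [bad] strict. *)
pose c0 := cabs (tri f a b c) / (2 * perim a b c ^+ 2).
have c00 : 0 < c0 by rewrite divr_gt0// mulr_gt0// exprn_gt0.
pose bad (T : C * C * C) := c0 * perim T.1.1 T.1.2 T.2 ^+ 2 < cabs (tri f T.1.1 T.1.2 T.2).
pose inv T := [/\ K T.1.1, K T.1.2, K T.2 & bad T].
have inv0 : inv (a, b, c).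
  split=> //; rewrite /bad /= /c0.
  have -> : cabs (tri f a b c) / (2 * perim a b c ^+ 2) * perim a b c ^+ 2 =
    cabs (tri f a b c) / 2 by field; rewrite gt_eqF.
  by rewrite ltr_pdivrMr// mulr_natr mulr2n ltrDl.
have step (T : {T | inv T}) : exists T' : {T | inv T},
    perim (sval T').1.1 (sval T').1.2 (sval T').2 =
    perim (sval T).1.1 (sval T).1.2 (sval T).2 / 2 /\
    cabs ((sval T').1.1 - (sval T).1.1) <= perim (sval T).1.1 (sval T).1.2 (sval T).2.
  case: T => -[[u v] w] [/= Ku Kv Kw]; rewrite /bad /= => B.
  have h01 := half01 R.
  have Kuv : K (mid u v) by exact: K_convex.
  have Kvw : K (mid v w) by exact: K_convex.
  have Kwu : K (mid w u) by exact: K_convex.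
  have sub := @tri_subdivide f u v w (seg_cont_K Ku Kv) (seg_cont_K Kv Kw)
    (seg_cont_K Kw Ku) (seg_cont_K Kuv Kvw) (seg_cont_K Kvw Kwu) (seg_cont_K Kwu Kuv).
  have two0 : (2 : C) != 0 by rewrite pnatr_eq0.
  have E1 : perim u (mid u v) (mid w u) = perim u v w / 2.
    by apply: perim_scale; rewrite /mid /lerp rc_half; field.
  have E2 : perim (mid u v) v (mid v w) = perim u v w / 2.
    by apply: perim_scale; rewrite /mid /lerp rc_half; field.
  have E3 : perim (mid w u) (mid v w) w = perim u v w / 2.
    by apply: perim_scale; rewrite /mid /lerp rc_half; field.
  (* The middle triangle is a half-size copy after a half turn, hence the negated vertices. *)
  have E4 : perim (mid v w) (mid w u) (mid u v) = perim u v w / 2.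
    have -> : perim u v w / 2 = perim (- u) (- v) (- w) / 2.
      rewrite /perim; congr (_ / _).
      by rewrite -(cabsN (u - v)) -(cabsN (v - w)) -(cabsN (w - u)) !opprD.
    by apply: perim_scale; rewrite /mid /lerp rc_half; field.
  have n1 := cabs_ge0 (u - v); have n2 := cabs_ge0 (v - w); have n3 := cabs_ge0 (w - u).
  have D1 : cabs (mid u v - u) <= perim u v w.
    have -> : mid u v - u = - (rc (2^-1) * (u - v)) by rewrite /mid /lerp; ring.
    by rewrite cabsN cabsM cabs_rc ger0_norm ?invr_ge0// /perim; lra.
  have D2 : cabs (mid w u - u) <= perim u v w.
    have -> : mid w u - u = rc (2^-1) * (w - u) by rewrite /mid /lerp rc_half; field.
    by rewrite cabsM cabs_rc ger0_norm ?invr_ge0// /perim; lra.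
  have D3 : cabs (mid v w - u) <= perim u v w.
    have -> : mid v w - u = rc (2^-1) * ((w - u) - (u - v)).
      by rewrite /mid /lerp rc_half; field.
    rewrite cabsM cabs_rc ger0_norm ?invr_ge0//.
    by have := cabsB (w - u) (u - v); rewrite /perim; lra.
  have : [\/ bad (u, mid u v, mid w u), bad (mid u v, v, mid v w),
     bad (mid w u, mid v w, w) | bad (mid v w, mid w u, mid u v)].
    rewrite /bad /= E1 E2 E3 E4; set q := c0 * _.
    have q4 : c0 * perim u v w ^+ 2 = 4 * q by rewrite /q; field.
    have [?|g1] := ltP q (cabs (tri f u (mid u v) (mid w u))); first exact: Or41.
    have [?|g2] := ltP q (cabs (tri f (mid u v) v (mid v w))); first exact: Or42.
    have [?|g3] := ltP q (cabs (tri f (mid w u) (mid v w) w)); first exact: Or43.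
    have [?|g4] := ltP q (cabs (tri f (mid v w) (mid w u) (mid u v))); first exact: Or44.
    exfalso; move: B; rewrite sub q4 ltNge => /negP; apply.
    apply: le_trans (cabsD _ _) _; apply: le_trans (lerD (cabsD _ _) (lexx _)) _.
    apply: le_trans (lerD (lerD (cabsD _ _) (lexx _)) (lexx _)) _; lra.
  have n0 : cabs (u - u) <= perim u v w by rewrite subrr cabs0 perim_ge0.
  move=> [Bd|Bd|Bd|Bd].
  - by unshelve eexists (exist _ (u, mid u v, mid w u) _).
  - by unshelve eexists (exist _ (mid u v, v, mid v w) _).
  - by unshelve eexists (exist _ (mid w u, mid v w, w) _).
  - by unshelve eexists (exist _ (mid v w, mid w u, mid u v) _).
have [nx Hnx] := choice step.
pose T n := sval (iter n nx (exist _ _ inv0)).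
pose P := perim a b c.
have PT n : perim (T n).1.1 (T n).1.2 (T n).2 = P / 2 ^+ n.
  elim: n => [|n IH]; first by rewrite expr0 divr1.
  rewrite /T iterS (Hnx _).1 -/(T n) IH exprS; field; rewrite expf_neq0//.
have AT n : cabs ((T n.+1).1.1 - (T n).1.1) <= P / 2 ^+ n.
  by rewrite -PT; exact: (Hnx _).2.
have [x Hx] := @dyadic_cvg R (fun n => cre (T n).1.1) P (perim_ge0 a b c)
  (fun n => le_trans (le_trans (eq_ind_r (fun y => `|y| <= _) (lexx _)
     (esym (creB _ _))) (cabs_re _)) (AT n)).
have [y Hy] := @dyadic_cvg R (fun n => cim (T n).1.1) P (perim_ge0 a b c)
  (fun n => le_trans (le_trans (eq_ind_r (fun y => `|y| <= _) (lexx _)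
     (esym (cimB _ _))) (cabs_im _)) (AT n)).
pose p : C := (x +i* y)%C.
have Hp n : cabs ((T n).1.1 - p) <= 4 * P / 2 ^+ n.
  apply: le_trans (cabs_le_reim _) _; rewrite creB cimB.
  by have := Hx n; have := Hy n; rewrite /=; lra.
have small (e : R) : 0 < e -> exists n, P / 2 ^+ n < e.
  move=> e0; have n0 : 0 <= P / e by rewrite divr_ge0 ?perim_ge0 ?ltW.
  exists (Num.bound (P / e)); rewrite ltr_pdivrMr ?exprn_gt0// mulrC -ltr_pdivrMr//.
  apply: lt_le_trans (archi_boundP n0) _.
  by rewrite -natrX ler_nat ltnW// ltn_expl.
have Kp : K p.
  apply: K_closed => e e0; have [n Hn] := small (e / 4) (divr_gt0 e0 (ltr0Sn _ 3)).
  exists (T n).1.1; first by rewrite /T; case: (iter _ _ _) => ? [].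
  by apply: le_lt_trans (Hp n) _; lra.
(* The first vertex is within 4 Q of [p] (2 Q for each coordinate) and the others within Q of the
   first, Q being the perimeter. Radius 5 Q and tolerance [c0 / 6] bound the integral by 5/6 of
   [c0 * Q ^+ 2], which contradicts [bad]. *)
have [d d0 D] := tri_local Kp (divr_gt0 c00 (ltr0Sn _ 5)).
have [n Hn] := small (d / 5) (divr_gt0 d0 (ltr0Sn _ 4)).
have [K1 K2 K3 B] : inv (T n) by rewrite /T; case: (iter _ _ _).
have Pn0 : 0 < P / 2 ^+ n by rewrite divr_gt0// exprn_gt0.
rewrite -PT in Hn Pn0; move: B; rewrite /bad ltNge; apply: contraNT => _.
have Pn := PT n; have Hpn := Hp n; rewrite -mulrA -PT in Hpn.
have m1 := cabs_ge0 ((T n).1.1 - (T n).1.2); have m2 := cabs_ge0 ((T n).1.2 - (T n).2).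
have m3 := cabs_ge0 ((T n).2 - (T n).1.1).
set Q := perim _ _ _ in Hn Pn0 Pn Hpn *.
apply: le_trans (D _ _ _ K1 K2 K3 (5 * Q) _ _ _ _) _.
- by lra.
- by lra.
- have := cabs_triangle (T n).1.1 (T n).1.2 p; rewrite (cabsC (T n).1.2 (T n).1.1).
  by rewrite /Q /perim in Hpn *; lra.
- have := cabs_triangle (T n).1.1 (T n).2 p.
  by rewrite /Q /perim in Hpn *; lra.
- rewrite -/Q (_ : c0 / 6 * (5 * Q) * Q = 5 / 6 * (c0 * Q ^+ 2)); last by field.
  have : 0 <= c0 * Q ^+ 2 by rewrite mulr_ge0 ?exprn_ge0// ltW.
  by lra.
Qed.

End Goursat.

(** * Primitives on a disc with one exceptional point *)

Section Primitive.
Variable R : realType.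
Local Notation C := (Cplx R).
Implicit Types (a b z : C) (s t : R).
Variables (f : C -> C) (c w : C) (rho : R).
Hypothesis w_in : cabs (w - c) < rho.
Hypothesis f_cont : ccont f w.
Hypothesis f_der : forall z, cabs (z - c) < rho -> z != w -> exists l, cder f z l.

Let f_ccont z : cabs (z - c) < rho -> ccont f z.
Proof.
by have [->//|zw zr] := eqVneq z w; have [l /cder_ccont] := f_der zr zw.
Qed.

Let disc_seg_cont a b : cabs (a - c) < rho -> cabs (b - c) < rho -> seg_cont f a b.
Proof.
move=> ha hb t t01; apply: f_ccont.
apply: le_lt_trans (lerp_dist_max (M := Num.max (cabs (a - c)) (cabs (b - c))) t01 _ _) _.
- by rewrite le_max lexx.
- by rewrite le_max lexx orbT.
- by rewrite gt_max ha.
Qed.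

Lemma seg_near z z' (e : R) : cabs (z - c) < rho -> cabs (z' - c) < rho ->
  (forall t, 0 <= t <= 1 -> cabs (f (lerp z z' t) - f z) <= e) ->
  cabs (seg f z z' - f z * (z' - z)) <= e * cabs (z' - z).
Proof.
move=> hz hz' fe.
have k a b : seg_cont (fun=> f z) a b.
  by move=> t _; exact: cder_ccont (cder_cst _ _).
have -> : f z * (z' - z) = seg (fun=> f z) z z'.
  rewrite (@seg_primitive _ _ (fun y => f z * y))//; first by ring.
  by move=> t _; have := cderMl (f z) (cder_id (lerp z z' t)); rewrite mulr1.
rewrite -segB//; last exact: disc_seg_cont.
apply: seg_le => // t t01; have := disc_seg_cont hz hz' t01.
move=> H e0 e00; have [d d0 D] := H e0 e00; exists d => // h /D.
by rewrite (_ : f (lerp z z' t + h) - f z - (f (lerp z z' t) - f z) =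
  f (lerp z z' t + h) - f (lerp z z' t))//; ring.
Qed.

(* The half-plane functional separates the triangles of the subdivision that do
   not touch the exceptional point [w] from [w]. *)
Let hp (u z : C) := cre (cconj u * (z - w)).

Let hp_lerp u a b t : hp u (lerp a b t) = (1 - t) * hp u a + t * hp u b.
Proof.
rewrite /hp; have -> : cconj u * (lerp a b t - w) =
  rc (1 - t) * (cconj u * (a - w)) + rc t * (cconj u * (b - w)).
  by rewrite /lerp rcB rc1; ring.
by rewrite creD [cre (rc _ * _)]creM [in X in _ + X]creM /= !mul0r !subr0.
Qed.

(** [hp u] vanishes at [w], so the midpoints with [w] still satisfy [eta / 2 <= hp u]. The three
    subtriangles without the vertex [w] thus lie in a closed convex set on which [f] is
    differentiable, and Goursat removes them. *)
Let tri_shrink u z z' (eta : R) : 0 < eta -> cabs (z - c) < rho ->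
  cabs (z' - c) < rho -> eta <= hp u z -> eta <= hp u z' ->
  tri f w z z' = tri f w (mid w z) (mid w z').
Proof.
move=> eta0 hz hz' uz uz'; have h01 := half01 R.
pose M := Num.max (cabs (w - c)) (Num.max (cabs (z - c)) (cabs (z' - c))).
have Mr : M < rho by rewrite !gt_max w_in hz hz'.
have Mw : cabs (w - c) <= M by rewrite le_max lexx.
have Mz : cabs (z - c) <= M by rewrite !le_max lexx orbT.
have Mz' : cabs (z' - c) <= M by rewrite !le_max lexx !orbT.
have two0 : (2 : C) != 0 by rewrite pnatr_eq0.
pose K (y : C) := cabs (y - c) <= M /\ eta / 2 <= hp u y.
have hpw : hp u w = 0 by rewrite /hp subrr mulr0.
have Kz : K z by split => //; lra.
have Kz' : K z' by split => //; lra.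
have Kconv a b t : K a -> K b -> 0 <= t <= 1 -> K (lerp a b t).
  move=> [a1 a2] [b1 b2] t01; split; first exact: lerp_dist_max.
  case/andP: t01 => t0 t1; rewrite hp_lerp.
  have -> : eta / 2 = (1 - t) * (eta / 2) + t * (eta / 2) by ring.
  by apply: lerD; apply: ler_wpM2l => //; rewrite subr_ge0.
have Kwz : K (mid w z).
  by split; [exact: lerp_dist_max|rewrite hp_lerp hpw; lra].
have Kwz' : K (mid w z').
  by split; [exact: lerp_dist_max|rewrite hp_lerp hpw; lra].
have mC : mid z' w = mid w z' by rewrite /mid /lerp rc_half; field.
have Kzz' : K (mid z z') by exact: Kconv.
have Kclosed p : (forall e : R, 0 < e -> exists2 y, K y & cabs (y - p) < e) -> K p.
  move=> H; split.
    apply/ler_addgt0Pl => e e0; have [y [Ky _] yp] := H e e0.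
    by have := cabs_triangle y p c; rewrite (cabsC p y); lra.
  apply/ler_addgt0Pl => e e0.
  have u1 : 0 < cabs u + 1 by rewrite ltr_wpDl ?cabs_ge0.
  have [y [_ Ky] yp] := H (e / (cabs u + 1)) (divr_gt0 e0 u1).
  have : hp u y - hp u p <= e; last by lra.
  rewrite /hp -creB -mulrBr (le_trans (ler_norm _))// (le_trans (cabs_re _))//.
  rewrite cabsM cabs_conj (_ : y - w - (p - w) = y - p); last by ring.
  have := ltW yp; rewrite ler_pdivlMr// mulrC; apply: le_trans.
  by rewrite ler_wpM2r ?cabs_ge0// lerDl.
have Kder y : K y -> exists l, cder f y l.
  move=> [y1 y2]; apply: f_der; first exact: le_lt_trans Mr.
  by apply/eqP => yw; move: y2; rewrite yw hpw; lra.
have Kr y : K y -> cabs (y - c) < rho by move=> [y1 _]; exact: le_lt_trans Mr.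
rewrite (@tri_subdivide _ f w z z'); try exact: disc_seg_cont.
- have g := goursat Kconv Kclosed Kder.
  by rewrite mC (g (mid w z) z)// (g (mid w z') (mid z z'))// (g (mid z z'))// !addr0.
- by apply: disc_seg_cont => //; exact: Kr.
- by rewrite mC; apply: disc_seg_cont; exact: Kr.
- by rewrite mC; apply: disc_seg_cont; exact: Kr.
Qed.

(** Repeated shrinking towards [w] leaves the integral unchanged while the perimeter tends to 0 and
    [f] stays bounded near [w]. The margin [eta] is halved each time but remains positive, which is
    all that is asked. *)
Let tri_star u z z' (eta : R) : 0 < eta -> cabs (z - c) < rho ->
  cabs (z' - c) < rho -> eta <= hp u z -> eta <= hp u z' -> tri f w z z' = 0.
Proof.
move=> eta0 hz hz' uz uz'.
have h01 := half01 R.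
have in_rho y : cabs (y - c) < rho -> cabs (mid w y - c) < rho.
  move=> hy; apply: le_lt_trans (lerp_dist_max (M := Num.max (cabs (w - c)) (cabs (y - c))) h01 _ _) _.
  - by rewrite le_max lexx.
  - by rewrite le_max lexx orbT.
  - by rewrite gt_max hy w_in.
pose P := perim w z z'.
have S n : exists y y', [/\ tri f w z z' = tri f w y y', cabs (y - c) < rho /\ cabs (y' - c) < rho,
    perim w y y' = P / 2 ^+ n &
    exists2 et, 0 < et & et <= hp u y /\ et <= hp u y'].
  elim: n => [|n [y [y' [-> [hy hy'] Py [et et0 [ey ey']]]]]].
    by exists z, z'; split => //; rewrite ?expr0 ?divr1//; exists eta.
  exists (mid w y), (mid w y'); split.
  - exact: tri_shrink et0 _ _ ey ey'.
  - by split; exact: in_rho.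
  - rewrite (_ : P / 2 ^+ n.+1 = perim w y y' / 2); last first.
      by rewrite Py exprS; field; rewrite expf_neq0.
    have two0 : (2 : C) != 0 by rewrite pnatr_eq0.
    by apply: perim_scale; rewrite /mid /lerp rc_half; field.
  - exists (et / 2); first exact: half_pos.
    have hpw : hp u w = 0 by rewrite /hp subrr mulr0.
    by rewrite !hp_lerp hpw; lra.
apply/eqP; rewrite -cabs_eq0 eq_le cabs_ge0 andbT; apply/ler_addgt0Pl => e e0; rewrite addr0.
have [d d0 D] := f_cont ltr01.
pose M := cabs (f w) + 1.
have M0 : 0 < M by rewrite ltr_wpDl ?cabs_ge0.
pose m := Num.min d (e / M).
have m0 : 0 < m by rewrite lt_min d0 divr_gt0.
have [n Hn] : exists n : nat, P / 2 ^+ n < m.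
  have n0 : 0 <= P / m by rewrite divr_ge0 ?perim_ge0 ?ltW.
  exists (Num.bound (P / m)); rewrite ltr_pdivrMr ?exprn_gt0// mulrC -ltr_pdivrMr//.
  apply: lt_le_trans (archi_boundP n0) _.
  by rewrite -natrX ler_nat ltnW// ltn_expl.
have [y [y' [-> [hy hy'] Py _]]] := S n.
move: Hn; rewrite -Py lt_min ltr_pdivlMr// => /andP[Pd Pe].
have n1 := cabs_ge0 (w - y); have n2 := cabs_ge0 (y - y'); have n3 := cabs_ge0 (y' - w).
have near_w a : cabs (a - w) < d -> cabs (f a) <= M.
  move=> /D; rewrite (_ : w + (a - w) = a); last by ring.
  by have := cabs_lower (f a) (f w); rewrite /M; lra.
have yw : cabs (y - w) < d by move: Pd; rewrite /perim (cabsC y w); lra.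
have y'w : cabs (y' - w) < d by move: Pd; rewrite /perim; lra.
have ww : cabs (w - w) < d by rewrite subrr cabs0.
have B a b : cabs (a - c) < rho -> cabs (b - c) < rho ->
    cabs (a - w) < d -> cabs (b - w) < d -> cabs (seg f a b) <= M * cabs (a - b).
  move=> ha hb ad bd; rewrite (cabsC a); apply: seg_le; first exact: disc_seg_cont.
  move=> t t01; apply: near_w.
  apply: le_lt_trans (lerp_dist_max (M := Num.max (cabs (a - w)) (cabs (b - w))) t01 _ _) _.
  - by rewrite le_max lexx.
  - by rewrite le_max lexx orbT.
  - by rewrite gt_max ad.
apply: (@le_trans _ _ (M * perim w y y')); last by rewrite mulrC ltW.
rewrite /perim !mulrDr (le_trans (cabsD _ _))// lerD ?B//.
by rewrite (le_trans (cabsD _ _))// lerD ?B.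
Qed.

(** Integrating from [w] itself means that only triangles with vertex [w] have to be closed. Mere
    continuity at [w] is what lets Cauchy's formula use a difference quotient patched at one
    point. *)
Theorem primitive_disc : exists F, forall z, cabs (z - c) < rho -> cder F z (f z).
Proof.
exists (seg f w) => z hz.
have step : exists2 d : R, 0 < d & forall h, cabs h < d ->
   seg f w (z + h) - seg f w z = seg f z (z + h).
  have [->|zw] := eqVneq z w.
    by exists 1 => // h _; rewrite [seg f w w]/seg subrr mul0r subr0.
  have u0 : 0 < cabs (z - w) by rewrite cabs_gt0 subr_eq0.
  (* With |h| < |z - w| / 2, both [z] and [z + h] have [hp (z - w)] at least |z - w|^2 / 2, so the
     triangle is strictly on one side of [w]. *)
  exists (Num.min (cabs (z - w) / 2) (rho - cabs (z - c))).
    by rewrite lt_min divr_gt0// subr_gt0.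
  move=> h; rewrite lt_min => /andP[h1 h2].
  have hz' : cabs (z + h - c) < rho.
    have := cabsD (z - c) h; rewrite (_ : z - c + h = z + h - c); last by ring.
    by lra.
  have hu : hp (z - w) z = cabs (z - w) ^+ 2 by rewrite /hp mul_cconj.
  have hu' : cabs (z - w) ^+ 2 / 2 <= hp (z - w) (z + h).
    rewrite /hp (_ : cconj _ * _ = cconj (z - w) * (z - w) + cconj (z - w) * h); last by ring.
    rewrite creD mul_cconj [cre (rc _)]/=.
    have : `|cre (cconj (z - w) * h)| <= cabs (z - w) ^+ 2 / 2.
      apply: le_trans (cabs_re _) _; rewrite cabsM cabs_conj expr2 -mulrA.
      by rewrite ler_wpM2l ?cabs_ge0// ltW.
    by rewrite ler_norml => /andP[]; lra.
  have e0 : 0 < cabs (z - w) ^+ 2 / 2 by rewrite divr_gt0// exprn_gt0.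
  have hu'' : cabs (z - w) ^+ 2 / 2 <= hp (z - w) z.
    by rewrite hu ler_pdivrMr// ler_peMr ?exprn_ge0 ?cabs_ge0// ler1n.
  have := tri_star e0 hz hz' hu'' hu'.
  rewrite /tri (seg_rev (disc_seg_cont w_in hz')) => /eqP.
  by rewrite subr_eq0 => /eqP <-; ring.
have [d1 d10 D1] := step; move=> e e0.
have [d2 d20 D2] := f_ccont hz e0.
exists (Num.min (Num.min d1 d2) (rho - cabs (z - c))).
  by rewrite !lt_min d10 d20 subr_gt0.
move=> h; rewrite !lt_min => /andP[/andP[h1 h2] h3].
have hz' : cabs (z + h - c) < rho.
  have := cabsD (z - c) h; rewrite (_ : z - c + h = z + h - c); last by ring.
  by lra.
rewrite D1//; have := @seg_near z (z + h) e hz hz'.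
rewrite (_ : z + h - z = h); last by ring.
apply => t t01; rewrite (_ : lerp z (z + h) t = z + rc t * h); last by rewrite /lerp; ring.
apply: ltW; apply: D2; apply: le_lt_trans h2.
by case/andP: t01 => t0 t1; rewrite cabsM cabs_rc ger0_norm// ler_piMl// cabs_ge0.
Qed.

End Primitive.

(** * Means over circles *)

Section CircleMean.
Variable R : realType.
Local Notation C := (Cplx R).
Local Notation mu := (@lebesgue_measure R).
Implicit Types (c z w : C) (r t : R) (g : R -> C).

Definition eit t : C := (cos t +i* sin t)%C.
Definition circ c r t : C := c + rc r * eit t.
Definition imag1 : C := (0 +i* 1)%C.

Lemma twopi_gt0 : 0 < 2 * pi :> R. Proof. by rewrite mulr_gt0// pi_gt0. Qed.

Lemma cabs_eit t : cabs (eit t) = 1.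
Proof. by rewrite /cabs /= cos2Dsin2 sqrtr1. Qed.

Lemma rder_eit t : rder eit t (imag1 * eit t).
Proof.
have := rder_reim (is_derive_cos t) (is_derive_sin t).
suff -> : imag1 * eit t = (- sin t +i* cos t)%C by [].
by apply/eqP; rewrite eq_complex /=; apply/andP; split; apply/eqP; ring.
Qed.

Lemma rder_circ c r t : rder (circ c r) t (rc r * (imag1 * eit t)).
Proof.
apply: (@rder_comp _ (fun z => c + rc r * z)); first exact: rder_eit.
by have := cderD (cder_cst c (eit t)) (cderMl (rc r) (cder_id (eit t)));
  rewrite add0r mulr1.
Qed.

Lemma rcont_circ c r t : rcont (circ c r) t.
Proof. exact: rder_rcont (rder_circ c r t). Qed.

Lemma circ_sub c r t : circ c r t - c = rc r * eit t.
Proof. by rewrite /circ; ring. Qed.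

Lemma cabs_circ c r t : 0 <= r -> cabs (circ c r t - c) = r.
Proof. by move=> r0; rewrite circ_sub cabsM cabs_eit mulr1 cabs_rc ger0_norm. Qed.

Lemma circ_2pi c r : circ c r (2 * pi) = circ c r 0.
Proof. by rewrite /circ /eit cos0 sin0 mulr_natl cos2pi sin2pi. Qed.

Definition pcont g := rcont_on 0 (2 * pi) g.

(** On a circle dz = i (z - c) dt, so a contour integral divided by 2 pi i is the mean of the
    integrand times [circ c r t - c]. This is the origin of that factor in all statements below. *)
Definition cmean g : C := rc (2 * pi)^-1 * cint 0 (2 * pi) g.
Definition rmean (u : R -> R) : R := (2 * pi)^-1 * \int[mu]_(t in `[0, 2 * pi]) u t.
Definition rintegrable (u : R -> R) := mu.-integrable `[0, 2 * pi] (EFin \o u).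

Lemma cmean_ext g h : (forall t, g t = h t) -> cmean g = cmean h.
Proof. by move=> H; rewrite /cmean (@cint_ext _ _ _ _ h). Qed.

Lemma cmeanD g h : pcont g -> pcont h -> cmean (fun t => g t + h t) = cmean g + cmean h.
Proof. by move=> ? ?; rewrite /cmean cintD// mulrDr. Qed.

Lemma cmeanB g h : pcont g -> pcont h -> cmean (fun t => g t - h t) = cmean g - cmean h.
Proof. by move=> ? ?; rewrite /cmean cintB// mulrBr. Qed.

Lemma cmeanZ (k : C) g : pcont g -> cmean (fun t => k * g t) = k * cmean g.
Proof. by move=> ?; rewrite /cmean cintZ// mulrCA. Qed.

Lemma rmean_cst (k : R) : rmean (fun=> k) = k.
Proof.
rewrite /rmean Rintegral_cst//= lebesgue_measure_itv /= lte_fin twopi_gt0 /=.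
by rewrite subr0 mulrCA mulVf ?mulr1// gt_eqF// twopi_gt0.
Qed.

Lemma cmean_cst (k : C) : cmean (fun=> k) = k.
Proof.
have z0 : rmean (fun=> 0 : R) = 0 := rmean_cst 0.
rewrite -[RHS]mulr1 (@cmean_ext _ (fun=> k * 1)); last by move=> t; rewrite mulr1.
rewrite cmeanZ; last by move=> t _; exact: rcont_cst.
congr (_ * _); rewrite /cmean /cint /=.
have := rmean_cst 1; have := rmean_cst 0; rewrite /rmean /=.
set a := (\int[mu]_(t in _) (0:R))%R; set b := (\int[mu]_(t in _) (1:R))%R => h0 h1.
rewrite /rc; apply/eqP; rewrite eq_complex /= !mul0r subr0 addr0 h0 h1.
by rewrite !eqxx.
Qed.

Lemma pcont_cst (k : C) : pcont (fun=> k).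
Proof. by move=> t _; exact: rcont_cst. Qed.

Lemma pcontM g h : pcont g -> pcont h -> pcont (fun t => g t * h t).
Proof. by move=> Hg Hh t t0; apply: rcontM; [exact: Hg|exact: Hh]. Qed.

Lemma pcontD g h : pcont g -> pcont h -> pcont (fun t => g t + h t).
Proof. by move=> Hg Hh t t0; apply: rcontD; [exact: Hg|exact: Hh]. Qed.

Lemma pcontB g h : pcont g -> pcont h -> pcont (fun t => g t - h t).
Proof. by move=> Hg Hh t t0; apply: rcontD; [exact: Hg|exact/rcontN/Hh]. Qed.

Lemma pcont_circ c r : pcont (circ c r).
Proof. by move=> t _; exact: rcont_circ. Qed.

Lemma pcont_comp (f : C -> C) c r : (forall t, ccont f (circ c r t)) ->
  pcont (fun t => f (circ c r t)).
Proof. by move=> H t _; apply: rcont_comp; [exact: rcont_circ|exact: H]. Qed.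

Lemma pcontV g : pcont g -> (forall t, g t != 0) -> pcont (fun t => (g t)^-1).
Proof.
move=> Hg g0 t /Hg H; apply: (rcont_comp H); exact: cder_ccont (cder_inv (g0 t)).
Qed.

Lemma pcont_bounded g : pcont g -> exists M : R, forall t, 0 <= t <= 2 * pi -> cabs (g t) <= M.
Proof.
move=> Hg; have := @EVT_max R (fun t => cabs (g t)) 0 (2 * pi) (ltW twopi_gt0).
case.
  apply: continuous_on_within => t /Hg H; apply: continuous_epsP => e e0.
  have [d d0 D] := H e e0; exists d => // s /D; apply: le_lt_trans.
  rewrite ler_norml; apply/andP; split; last exact: cabs_lower.
  by have := cabs_lower (g t) (g s); rewrite (cabsC (g t)); lra.
move=> s _ H; exists (cabs (g s)) => t t0; apply: H; by rewrite in_itv.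
Qed.

Lemma cabs_cmean g (u : R -> R) : pcont g -> rintegrable u ->
  (forall t, 0 <= t <= 2 * pi -> cabs (g t) <= u t) -> cabs (cmean g) <= rmean u.
Proof.
move=> Hg iu gu; rewrite /cmean cabsM cabs_rc ger0_norm; last first.
  by rewrite invr_ge0 ltW// twopi_gt0.
by rewrite ler_wpM2l ?invr_ge0 ?(ltW twopi_gt0)// cabs_cint.
Qed.

Lemma rintegrable_cst (k : R) : rintegrable (fun=> k).
Proof. by apply: continuous_on_integrable => t _; exact: cst_continuous. Qed.

Lemma cabs_cmean_le g (M : R) : pcont g ->
  (forall t, 0 <= t <= 2 * pi -> cabs (g t) <= M) ->
  cabs (cmean g) <= M.
Proof.
by move=> Hg gM; rewrite -(rmean_cst M); apply: cabs_cmean => //; exact: rintegrable_cst.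
Qed.

Lemma cconjM z w : cconj (z * w) = cconj z * cconj w.
Proof. exact: rmorphM. Qed.
Lemma cconj1 : cconj (1 : C) = 1. Proof. exact: rmorph1. Qed.
Lemma cconjB z w : cconj (z - w) = cconj z - cconj w.
Proof. exact: rmorphB. Qed.
Lemma cconjV z : cconj z^-1 = (cconj z)^-1.
Proof. exact: fmorphV. Qed.
Lemma cconjK z : cconj (cconj z) = z.
Proof. by case: z => x y; rewrite /cconj /= opprK. Qed.

Lemma pcont_conj g : pcont g -> pcont (fun t => cconj (g t)).
Proof.
move=> H t /H Ht e e0; have [d d0 D] := Ht e e0; exists d => // s /D.
by rewrite -cconjB cabs_conj.
Qed.

Lemma cmean_conj g : pcont g -> cmean (fun t => cconj (g t)) = cconj (cmean g).
Proof.
move=> Hg; rewrite /cmean cconjM.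
have -> : cconj (rc ((2 * pi)^-1 : R)) = rc (2 * pi)^-1 by exact: conjc_real.
congr (_ * _); rewrite /cint /cconj /=; congr (_ +i* _)%C.
  by apply: eq_Rintegral => t _; case: (g t).
have -> : (\int[mu]_(t in `[0, (2 * pi)%R]) cim (cconj (g t)) =
  \int[mu]_(t in `[0, (2 * pi)%R]) (-1 * cim (g t)))%R.
  by apply: eq_Rintegral => t _; rewrite mulN1r; case: (g t).
by rewrite RintegralZl ?mulN1r//; exact: integrable_cim.
Qed.

(** Up to the factor [imag1], the mean integrates the derivative of [F] along a closed curve. *)
Lemma cmean_primitive (f F : C -> C) c r :
  (forall t, ccont f (circ c r t)) ->
  (forall t, cder F (circ c r t) (f (circ c r t))) ->
  cmean (fun t => f (circ c r t) * (circ c r t - c)) = 0.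
Proof.
move=> fc dF.
have gc : pcont (fun t => f (circ c r t) * (circ c r t - c)).
  by apply: pcontM; [exact: pcont_comp|apply: pcontB; [exact: pcont_circ|exact: pcont_cst]].
have i0 : imag1 != 0 by rewrite -cabs_gt0 /cabs /= expr0n add0r expr1n sqrtr1.
apply: (mulfI i0); rewrite mulr0 -cmeanZ// /cmean.
rewrite (@cint_FTC _ _ _ _ (fun t => F (circ c r t)) twopi_gt0).
- by rewrite circ_2pi subrr mulr0.
- exact: rcont_onZ.
- move=> t _; rewrite circ_sub mulrCA [X in _ * X]mulrCA.
  exact: rder_comp (rder_circ c r t) (dF t).
Qed.

End CircleMean.

(** * Cauchy's formula and its consequences *)

Section Cauchy.
Variable R : realType.
Local Notation C := (Cplx R).
Implicit Types (c z w p : C) (r t rho : R) (f g : C -> C).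

Definition holo_disc f c rho := forall z, cabs (z - c) < rho -> exists l, cder f z l.

Lemma holo_disc_ccont f c rho z : holo_disc f c rho -> cabs (z - c) < rho -> ccont f z.
Proof. by move=> H /H[l /cder_ccont]. Qed.

Lemma cauchy_zero f c w r rho : 0 <= r < rho -> cabs (w - c) < rho -> ccont f w ->
  (forall z, cabs (z - c) < rho -> z != w -> exists l, cder f z l) ->
  cmean (fun t => f (circ c r t) * (circ c r t - c)) = 0.
Proof.
move=> /andP[r0 rr] hw fw fd; have [F HF] := primitive_disc hw fw fd.
have circ_in t : cabs (circ c r t - c) < rho by rewrite cabs_circ.
apply: (@cmean_primitive _ _ F) => t; last exact: HF.
have [->//|tw] := eqVneq (circ c r t) w.
by have [l /cder_ccont] := fd _ (circ_in t) tw.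
Qed.

Lemma cauchy_zero_holo f c r rho : 0 <= r < rho -> holo_disc f c rho ->
  cmean (fun t => f (circ c r t) * (circ c r t - c)) = 0.
Proof.
move=> /andP[r0 rr] hf.
have cc : cabs (c - c) < rho by rewrite subrr cabs0 (le_lt_trans r0).
apply: (@cauchy_zero f c c r rho) => //; first by rewrite r0.
  exact: holo_disc_ccont hf cc.
by move=> z hz _; exact: hf.
Qed.

Lemma circ_neq c r t w : 0 < r -> cabs (w - c) < r -> circ c r t - w != 0.
Proof.
move=> r0 wr; rewrite -cabs_gt0.
have := cabs_triangle w (circ c r t) c.
by rewrite (cabs_circ c t (ltW r0)); lra.
Qed.

(** On the circle the conjugate of z - c is r^2 / (z - c). Hence the conjugate of the kernel minus 1
    is k (z - c) / (1 - k (z - c)), where [k / (1 - k * (z - c))] is holomorphic beyond the circle,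
    and its mean is 0 by Cauchy's theorem. *)
Lemma cmean_kernel c r w : 0 < r -> cabs (w - c) < r ->
  cmean (fun t => (circ c r t - c) / (circ c r t - w)) = 1.
Proof.
move=> r0 wr; pose u := w - c; pose k := cconj u / rc (r ^+ 2).
have r2 : rc (r ^+ 2) != 0 by rewrite rc_eq0 gt_eqF// exprn_gt0.
have nu := cabs_ge0 (w - c).
(* This radius lies strictly between [r] and r^2 / |u|, where the denominator could first vanish. *)
pose rho := 2 * r ^+ 2 / (r + cabs u).
have ru : 0 < r + cabs u by rewrite /u; lra.
have rrho : r < rho by rewrite /rho ltr_pdivlMr// expr2; nra.
have nk : cabs k = cabs u / r ^+ 2.
  by rewrite cabsM cabs_conj cabsV cabs_rc ger0_norm// exprn_ge0// ltW.
have den z : cabs (z - c) < rho -> 1 - k * (z - c) != 0.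
  move=> hz; rewrite -cabs_gt0; have := cabs_lower 1 (k * (z - c)).
  rewrite cabs1 cabsM nk => H; apply: lt_le_trans H; rewrite subr_gt0.
  rewrite mulrAC ltr_pdivrMr ?exprn_gt0// mul1r.
  move: hz; rewrite /rho ltr_pdivlMr// => hz.
  have := cabs_ge0 (z - c); rewrite /u in hz *; nra.
have hol : holo_disc (fun z => k / (1 - k * (z - c))) c rho.
  move=> z hz; apply: ex_cderM; first by eexists; exact: cder_cst.
  apply: ex_cderV; first exact: den.
  by eexists; exact: cderB (cder_cst _ _) (cderMl k (cder_subr c z)).
have circ_in t : cabs (circ c r t - c) < rho by rewrite cabs_circ// ltW.
have r0' : 0 <= r < rho by rewrite ltW.
have := cauchy_zero_holo r0' hol.
have Pv : pcont (fun t => circ c r t - c).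
  by apply: pcontB; [exact: pcont_circ|exact: pcont_cst].
have Pw : pcont (fun t => (circ c r t - c) / (circ c r t - w)).
  apply: pcontM => //; apply: pcontV; last by move=> t; exact: circ_neq.
  by apply: pcontB; [exact: pcont_circ|exact: pcont_cst].
have E t : (k / (1 - k * (circ c r t - c))) * (circ c r t - c) =
   cconj ((circ c r t - c) / (circ c r t - w)) - 1.
  have v0 : circ c r t - c != 0 by apply: circ_neq; rewrite // subrr cabs0.
  have cv0 : cconj (circ c r t - c) != 0 by rewrite -cabs_gt0 cabs_conj cabs_gt0.
  have cw0 : cconj (circ c r t - w) != 0 by rewrite -cabs_gt0 cabs_conj cabs_gt0 circ_neq.
  have vv : cconj (circ c r t - c) * (circ c r t - c) = rc (r ^+ 2).
    by rewrite mul_cconj cabs_circ// ltW.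
  rewrite cconjM cconjV.
  have wE : cconj (circ c r t - w) = cconj (circ c r t - c) - cconj u.
    by rewrite -cconjB; congr cconj; rewrite /u; ring.
  have d0 := den _ (circ_in t).
  move: wE vv cw0 cv0 d0; set V := cconj (circ c r t - c); set W := cconj (circ c r t - w).
  rewrite /k; set x := circ c r t - c in v0 *; move: (cconj u) (rc (r ^+ 2)) r2 v0.
  move=> U S S0 x0 WE VS W0 V0 D0; rewrite -VS in S0 D0 *.
  clearbody x V W; rewrite WE in W0 *; field.
  by rewrite W0 x0 V0.
rewrite (cmean_ext E) cmeanB ?cmean_cst; [|exact: pcont_conj|exact: pcont_cst].
move/eqP; rewrite subr_eq0 cmean_conj// => /eqP H.
by rewrite -[LHS]cconjK H cconj1.
Qed.

(** The difference quotient at [w], completed by the derivative, is continuous at [w] and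
    differentiable elsewhere, so its contour mean is 0; the part with [f w] is evaluated by
    [cmean_kernel]. *)
Theorem cauchy_formula f c w r rho : cabs (w - c) < r -> r < rho -> holo_disc f c rho ->
  cmean (fun t => f (circ c r t) * (circ c r t - c) / (circ c r t - w)) = f w.
Proof.
move=> wr rr hf; have r0 : 0 < r := le_lt_trans (cabs_ge0 _) wr.
have wrho := lt_trans wr rr; have [l hl] := hf w wrho.
pose g z := if z == w then l else (f z - f w) / (z - w).
have circ_in t : cabs (circ c r t - c) < rho by rewrite cabs_circ// ltW.
have gw : ccont g w.
  move=> e e0; have [d d0 D] := hl _ (half_pos e0); exists d => // h hd.
  rewrite /g eqxx; case: eqP => [_|/eqP]; first by rewrite subrr cabs0.
  rewrite (_ : w + h - w = h); last by ring.
  move=> hw; have h0 : h != 0 by apply: contra_neq hw => ->; rewrite addr0.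
  have nh : 0 < cabs h by rewrite cabs_gt0.
  have -> : (f (w + h) - f w) / h - l = (f (w + h) - f w - l * h) / h by field.
  rewrite cabsM cabsV ltr_pdivrMr//; apply: le_lt_trans (D h hd) _.
  by rewrite ltr_pM2r// ltr_pdivrMr// ltr_pMr// ltr1n.
have gd z : cabs (z - c) < rho -> z != w -> exists l, cder g z l.
  move=> hz zw; have [m hm] := hf z hz.
  have [m' hm'] : exists m', cder (fun y => (f y - f w) / (y - w)) z m'.
    apply: ex_cderM; first by eexists; exact: cderB hm (cder_cst _ _).
    apply: ex_cderV; first by rewrite subr_eq0.
    by eexists; exact: cder_subr.
  exists m'; have nz : 0 < cabs (z - w) by rewrite cabs_gt0 subr_eq0.
  apply: cder_ext nz _ hm' => h hh; rewrite /g; case: eqP => // zh.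
  by move: hh; rewrite -zh (_ : z - (z + h) = - h) ?cabsN ?ltxx//; ring.
have r0' : 0 <= r < rho by rewrite ltW.
have := cauchy_zero r0' wrho gw gd.
have Pf : pcont (fun t => f (circ c r t)).
  by apply: pcont_comp => t; exact: holo_disc_ccont hf (circ_in t).
have Pk : pcont (fun t => (circ c r t - c) / (circ c r t - w)).
  apply: pcontM; first by apply: pcontB; [exact: pcont_circ|exact: pcont_cst].
  apply: pcontV; last by move=> t; exact: circ_neq.
  by apply: pcontB; [exact: pcont_circ|exact: pcont_cst].
have E t : g (circ c r t) * (circ c r t - c) =
   f (circ c r t) * ((circ c r t - c) / (circ c r t - w)) -
   f w * ((circ c r t - c) / (circ c r t - w)).
  have := circ_neq t r0 wr; rewrite /g subr_eq0 => /negPf tw; rewrite tw.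
  by field; rewrite subr_eq0 tw.
rewrite (cmean_ext E) cmeanB; [|exact: pcontM|exact: pcontM (pcont_cst _) Pk].
rewrite cmeanZ// cmean_kernel// mulr1 => /eqP; rewrite subr_eq0 => /eqP <-.
by apply: cmean_ext => t; rewrite mulrA.
Qed.

Lemma cauchy_bound f c w r rho (M : R) : cabs (w - c) < r -> r < rho -> holo_disc f c rho ->
  (forall t, 0 <= t <= 2 * pi -> cabs (f (circ c r t)) <= M) ->
  cabs (f w) <= M * r / (r - cabs (w - c)).
Proof.
move=> wr rr hf fM; have r0 : 0 < r := le_lt_trans (cabs_ge0 _) wr.
rewrite -(cauchy_formula wr rr hf); apply: cabs_cmean_le.
  apply: pcontM; first apply: pcontM.
  - apply: pcont_comp => t; apply: (holo_disc_ccont hf).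
    by rewrite cabs_circ// ltW.
  - by apply: pcontB; [exact: pcont_circ|exact: pcont_cst].
  - apply: pcontV; last by move=> t; exact: circ_neq.
    by apply: pcontB; [exact: pcont_circ|exact: pcont_cst].
move=> t t0; rewrite !cabsM cabsV (cabs_circ c t (ltW r0)).
have d0 : 0 < r - cabs (w - c) by rewrite subr_gt0.
apply: ler_pM.
- by rewrite mulr_ge0 ?cabs_ge0// ltW.
- by rewrite invr_ge0 cabs_ge0.
- by rewrite ler_wpM2r ?(ltW r0)// fM.
- rewrite lef_pV2 ?posrE//; last by rewrite cabs_gt0 circ_neq.
  by have := cabs_triangle w (circ c r t) c; rewrite (cabs_circ c t (ltW r0)); lra.
Qed.

Lemma cder_cmean (Psi : C -> R -> C) (Psi' : R -> C) w (d B : R) : 0 < d -> 0 <= B ->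
  (forall h, cabs h < d -> pcont (Psi (w + h))) -> pcont Psi' ->
  (forall h t, cabs h < d -> 0 <= t <= 2 * pi ->
    cabs (Psi (w + h) t - Psi w t - h * Psi' t) <= B * cabs h ^+ 2) ->
  cder (fun z => cmean (Psi z)) w (cmean Psi').
Proof.
move=> d0 B0 Pc Pc' H e e0.
have B1 : 0 < B + 1 by rewrite ltr_wpDl.
exists (Num.min d (e / (B + 1))); first by rewrite lt_min d0 divr_gt0.
move=> h; rewrite lt_min ltr_pdivlMr// => /andP[hd he].
have P0 : pcont (Psi w) by have := Pc 0; rewrite addr0 cabs0; apply.
have Ph : pcont (fun t => h * Psi' t) by apply: pcontM => //; exact: pcont_cst.
rewrite mulrC -cmeanZ// -!cmeanB//; [|by apply: pcontB => //; exact: Pc|exact: Pc].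
apply: cabs_cmean_le; first by apply: pcontB => //; apply: pcontB => //; exact: Pc.
move=> t t0; apply: le_trans (H h t hd t0) _; rewrite expr2 mulrA ler_wpM2r ?cabs_ge0//.
rewrite (le_trans _ (ltW he))// mulrC ler_wpM2l ?cabs_ge0// lerDl//.
Qed.

Section Kernel.
Variables (phi : R -> C) (c : C) (r : R).
Hypothesis r0 : 0 < r.
Hypothesis phi_cont : pcont phi.

Lemma pcont_kernel w : cabs (w - c) < r -> pcont (fun t => (circ c r t - w)^-1).
Proof.
move=> wr; apply: pcontV; last by move=> t; exact: circ_neq.
by apply: pcontB; [exact: pcont_circ|exact: pcont_cst].
Qed.

Let kernel_bound w h t : cabs (w - c) < r -> cabs h < (r - cabs (w - c)) / 2 ->
  [/\ circ c r t - w != 0, circ c r t - (w + h) != 0,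
   cabs (circ c r t - w)^-1 <= 2 / (r - cabs (w - c)) &
   cabs (circ c r t - (w + h))^-1 <= 2 / (r - cabs (w - c))].
Proof.
move=> wr hr.
have d0 : 0 < (r - cabs (w - c)) / 2 by rewrite divr_gt0// subr_gt0.
have b1 : r - cabs (w - c) <= cabs (circ c r t - w).
  by have := cabs_triangle w (circ c r t) c; rewrite (cabs_circ c t (ltW r0)); lra.
have b2 : (r - cabs (w - c)) / 2 <= cabs (circ c r t - (w + h)).
  have := cabs_lower (circ c r t - w) h.
  by rewrite (_ : circ c r t - w - h = circ c r t - (w + h)); [lra|ring].
have n1 : 0 < cabs (circ c r t - w) by lra.
have n2 : 0 < cabs (circ c r t - (w + h)) by lra.
split; rewrite -?cabs_gt0// cabsV -invf_div lef_pV2 ?posrE//; lra.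
Qed.

Lemma cder_kernel1 w : cabs (w - c) < r ->
  cder (fun z => cmean (fun t => phi t * (circ c r t - z)^-1)) w
    (cmean (fun t => phi t * (circ c r t - w) ^- 2)).
Proof.
move=> wr; have [M0 M1] := pcont_bounded phi_cont.
have d0 : 0 < (r - cabs (w - c)) / 2 by rewrite divr_gt0// subr_gt0.
set A := 2 / (r - cabs (w - c)).
have A0 : 0 <= A by rewrite divr_ge0// subr_ge0 ltW.
apply: (@cder_cmean _ _ w _ (M0 * A ^+ 3) d0).
- by rewrite mulr_ge0 ?exprn_ge0// (le_trans (cabs_ge0 (phi 0)))// M1// lexx ltW ?twopi_gt0.
- move=> h hd; apply: pcontM => //; apply: pcont_kernel.
  have := cabsD (w - c) h; rewrite (_ : w - c + h = w + h - c); last by ring.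
  by lra.
- apply: pcontM => //; rewrite (_ : (fun t => _) = fun t => (circ c r t - w)^-1 * (circ c r t - w)^-1).
    by apply: pcontM; exact: pcont_kernel.
  by apply/funext => t; rewrite -invfM expr2.
move=> h t hd t0; have [z1 z2 b1 b2] := kernel_bound t wr hd.
have -> : phi t * (circ c r t - (w + h))^-1 - phi t * (circ c r t - w)^-1 -
  h * (phi t * (circ c r t - w) ^- 2) =
  phi t * ((circ c r t - w)^-1 * (circ c r t - w)^-1 * (circ c r t - (w + h))^-1) * h ^+ 2.
  by field; rewrite z1 z2.
rewrite [cabs (_ * h ^+ 2)]cabsM cabsX ler_wpM2r ?exprn_ge0 ?cabs_ge0// !cabsM.
apply: ler_pM; rewrite ?mulr_ge0 ?cabs_ge0//; first exact: M1.
rewrite (_ : A ^+ 3 = A * A * A); last by ring.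
by apply: ler_pM; rewrite ?mulr_ge0 ?cabs_ge0//; apply: ler_pM; rewrite ?cabs_ge0.
Qed.

Lemma cder_kernel2 w : cabs (w - c) < r ->
  exists l, cder (fun z => cmean (fun t => phi t * (circ c r t - z) ^- 2)) w l.
Proof.
move=> wr; have [M0 M1] := pcont_bounded phi_cont.
have d0 : 0 < (r - cabs (w - c)) / 2 by rewrite divr_gt0// subr_gt0.
set A := 2 / (r - cabs (w - c)).
have A0 : 0 <= A by rewrite divr_ge0// subr_ge0 ltW.
have P2 z : cabs (z - c) < r -> pcont (fun t => phi t * (circ c r t - z) ^- 2).
  move=> hz; apply: pcontM => //.
  rewrite (_ : (fun t => _) = fun t => (circ c r t - z)^-1 * (circ c r t - z)^-1).
    by apply: pcontM; exact: pcont_kernel.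
  by apply/funext => t; rewrite -invfM expr2.
exists (cmean (fun t => 2 * (phi t * (circ c r t - w) ^- 2 * (circ c r t - w)^-1))).
apply: (@cder_cmean _ _ w _ (M0 * (A ^+ 3 * (3 * A))) d0).
- have M00 : 0 <= M0 by rewrite (le_trans (cabs_ge0 (phi 0)))// M1// lexx ltW ?twopi_gt0.
  have A3 : 0 <= A ^+ 3 by rewrite exprn_ge0.
  by apply: mulr_ge0 => //; apply: mulr_ge0 => //; apply: mulr_ge0.
- move=> h hd; apply: P2.
  have := cabsD (w - c) h; rewrite (_ : w - c + h = w + h - c); last by ring.
  by lra.
- apply: pcontM; first exact: pcont_cst.
  by apply: pcontM; [exact: P2|exact: pcont_kernel].
move=> h t hd t0; have [z1 z2 b1 b2] := kernel_bound t wr hd.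
have -> : phi t * (circ c r t - (w + h)) ^- 2 - phi t * (circ c r t - w) ^- 2 -
  h * (2 * (phi t * (circ c r t - w) ^- 2 * (circ c r t - w)^-1)) =
  phi t * ((circ c r t - w)^-1 * (circ c r t - w)^-1 * (circ c r t - (w + h))^-1 *
    ((circ c r t - (w + h))^-1 + (circ c r t - w)^-1 + (circ c r t - w)^-1)) * h ^+ 2.
  by field; rewrite z1 z2.
rewrite [cabs (_ * h ^+ 2)]cabsM cabsX ler_wpM2r ?exprn_ge0 ?cabs_ge0// !cabsM.
apply: ler_pM; rewrite ?mulr_ge0 ?cabs_ge0//; first exact: M1.
rewrite (_ : A ^+ 3 = A * A * A); last by ring.
apply: ler_pM; rewrite ?mulr_ge0 ?cabs_ge0//.
  by apply: ler_pM; rewrite ?mulr_ge0 ?cabs_ge0//; apply: ler_pM; rewrite ?cabs_ge0.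
apply: le_trans (cabsD _ _) _; apply: le_trans (lerD (cabsD _ _) (lexx _)) _.
by move: b1 b2; rewrite -/A; lra.
Qed.

End Kernel.

(** Differentiating Cauchy's formula represents [f'] by the squared kernel, by uniqueness of the
    derivative; that integral can be differentiated once more. *)
Lemma holo_deriv f c rho : holo_disc f c rho ->
  exists2 f', (forall z, cabs (z - c) < rho -> cder f z (f' z)) & holo_disc f' c rho.
Proof.
move=> hf.
have [|f' Hf'] := @choice C C (fun z l => cabs (z - c) < rho -> cder f z l).
  move=> z; have [/hf[l hl]|nz] := pselect (cabs (z - c) < rho); first by exists l.
  by exists 0.
exists f' => // z hz.
pose r := (cabs (z - c) + rho) / 2.
have zr : cabs (z - c) < r by rewrite /r; lra.
have rr : r < rho by rewrite /r; lra.
have r0 : 0 < r := le_lt_trans (cabs_ge0 _) zr.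
pose phi t := f (circ c r t) * (circ c r t - c).
have Pphi : pcont phi.
  apply: pcontM; last by apply: pcontB; [exact: pcont_circ|exact: pcont_cst].
  by apply: pcont_comp => t; apply: (holo_disc_ccont hf); rewrite (cabs_circ c t (ltW r0)).
have f'E y : cabs (y - c) < r -> cmean (fun t => phi t * (circ c r t - y) ^- 2) = f' y.
  move=> hy; apply: (@cder_unique _ f y); last exact/Hf'/(lt_trans hy).
  have d0 : 0 < r - cabs (y - c) by rewrite subr_gt0.
  apply: cder_ext d0 _ (cder_kernel1 r0 Pphi hy) => h hh.
  apply: cauchy_formula rr hf.
  have := cabsD (y - c) h; rewrite (_ : y - c + h = y + h - c); last by ring.
  by lra.
have [l hl] := cder_kernel2 r0 Pphi zr; exists l.
have d0 : 0 < r - cabs (z - c) by rewrite subr_gt0.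
apply: cder_ext d0 _ hl => h hh; apply: f'E.
have := cabsD (z - c) h; rewrite (_ : z - c + h = z + h - c); last by ring.
by lra.
Qed.

(** Only differentiability at [p] is at stake. Near [p] the completed difference quotient is the
    Cauchy integral with density [psi], which is differentiable at every point inside the circle. *)
Lemma holo_divide f c rho p : holo_disc f c rho -> cabs (p - c) < rho ->
  exists2 g, holo_disc g c rho &
    forall z, cabs (z - c) < rho -> f z = f p + (z - p) * g z.
Proof.
move=> hf hp; have [l hl] := hf p hp.
pose g z := if z == p then l else (f z - f p) / (z - p).
exists g; last first.
  move=> z hz; rewrite /g; case: eqP => [->|/eqP zp]; first by rewrite subrr mul0r addr0.
  by field; rewrite subr_eq0.
move=> z hz; have [->|zp] := eqVneq z p; last first.
  have [m hm] := hf z hz.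
  have [m' hm'] : exists m', cder (fun y => (f y - f p) / (y - p)) z m'.
    apply: ex_cderM; first by eexists; exact: cderB hm (cder_cst _ _).
    apply: ex_cderV; first by rewrite subr_eq0.
    by eexists; exact: cder_subr.
  exists m'; have nz : 0 < cabs (z - p) by rewrite cabs_gt0 subr_eq0.
  apply: cder_ext nz _ hm' => h hh; rewrite /g; case: eqP => // zh.
  by move: hh; rewrite -zh (_ : z - (z + h) = - h) ?cabsN ?ltxx//; ring.
pose r := (cabs (p - c) + rho) / 2.
have pr : cabs (p - c) < r by rewrite /r; lra.
have rr : r < rho by rewrite /r; lra.
have r0 : 0 < r := le_lt_trans (cabs_ge0 _) pr.
pose phi t := f (circ c r t) * (circ c r t - c).
have Pphi : pcont phi.
  apply: pcontM; last by apply: pcontB; [exact: pcont_circ|exact: pcont_cst].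
  by apply: pcont_comp => t; apply: (holo_disc_ccont hf); rewrite (cabs_circ c t (ltW r0)).
pose psi t := phi t * (circ c r t - p)^-1.
have Ppsi : pcont psi by apply: pcontM => //; exact: pcont_kernel.
have d0 : 0 < r - cabs (p - c) by rewrite subr_gt0.
have d1 := d0.
have in_r h : cabs h < r - cabs (p - c) -> cabs (p + h - c) < r.
  by have := cabsD (p - c) h; rewrite (_ : p - c + h = p + h - c); [lra|ring].
eexists; apply: cder_ext d0 _ (cder_kernel1 r0 Ppsi pr) => h /in_r hh; rewrite /g.
case: eqP => [->|/eqP ph].
  apply: (@cder_unique _ f p) => //.
  rewrite (@cmean_ext _ _ (fun t => phi t * (circ c r t - p) ^- 2)); last first.
    by move=> t; rewrite /psi expr2 invfM mulrA.
  apply: cder_ext d1 _ (cder_kernel1 r0 Pphi pr) => k /in_r hk.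
  exact: cauchy_formula rr hf.
have h0 : p + h - p != 0 by rewrite subr_eq0.
apply: (mulIf h0); rewrite divfK// -(cauchy_formula hh rr hf) -(cauchy_formula pr rr hf).
rewrite -cmeanB; [|by apply: pcontM => //; exact: pcont_kernel
                  |by apply: pcontM => //; exact: pcont_kernel].
rewrite mulrC -cmeanZ; last by apply: pcontM => //; exact: pcont_kernel.
apply: cmean_ext => t; rewrite /psi /phi.
have n1 := circ_neq t r0 pr; have n2 := circ_neq t r0 hh.
by field; rewrite n1 n2.
Qed.

End Cauchy.

(** * Zeros, poles and the identity theorem *)

Section LocalStructure.
Variable R : realType.
Local Notation C := (Cplx R).
Implicit Types (z w p : C) (e r : R) (f g : C -> C).

Lemma geometric_le0 (x K q : R) : 0 <= q < 1 -> (forall n, x <= K * q ^+ n) -> x <= 0.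
Proof.
move=> /andP[q0 q1] H; rewrite leNgt; apply/negP => x0.
have : (fun n => K * q ^+ n) @ \oo --> (K * 0 : R).
  by apply: cvgMr; apply: cvg_expr; rewrite ger0_norm.
rewrite mulr0 => /cvgrPdist_lt /(_ x x0) [n _ /(_ n (leqnn n))].
rewrite sub0r normrN => h; have := le_lt_trans (ler_norm _) h.
by rewrite ltNge H.
Qed.

Lemma holo_disc_sub f p e e' : e' <= e -> holo_disc f p e -> holo_disc f p e'.
Proof. by move=> ee hf z hz; apply: hf; exact: lt_le_trans ee. Qed.

(** Riemann's device: (z - p)^2 f(z) has value and derivative 0 at [p], hence is holomorphic there
    and can be divided twice by z - p. *)
Lemma removable_singularity f p e (M : R) : 0 < e ->
  (forall z, 0 < cabs (z - p) < e -> exists l, cder f z l) ->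
  (forall z, 0 < cabs (z - p) < e -> cabs (f z) <= M) ->
  exists2 g, holo_disc g p e & forall z, 0 < cabs (z - p) < e -> f z = g z.
Proof.
move=> e0 fd fM; pose H z := (z - p) * (z - p) * f z.
have pp : cabs (p - p) < e by rewrite subrr cabs0.
have Hp : H p = 0 by rewrite /H subrr !mul0r.
have dHp : cder H p 0.
  move=> d d0; have M1 : 0 < `|M| + 1 by rewrite ltr_wpDl.
  exists (Num.min e (d / (`|M| + 1))); first by rewrite lt_min e0 divr_gt0.
  move=> h; rewrite lt_min ltr_pdivlMr// => /andP[he hd].
  rewrite Hp mul0r !subr0 /H (_ : p + h - p = h); last by ring.
  have [->|h0] := eqVneq h 0; first by rewrite !mul0r cabs0 mulr0.
  rewrite !cabsM mulrAC ler_wpM2r ?cabs_ge0//.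
  have fh : cabs (f (p + h)) <= M.
    by apply: fM; rewrite (_ : p + h - p = h) ?cabs_gt0 ?h0//; ring.
  apply: le_trans (ltW hd); rewrite ler_wpM2l ?cabs_ge0//.
  by apply: le_trans fh _; rewrite (le_trans (ler_norm _))// lerDl.
have hH : holo_disc H p e.
  move=> z hz; have [->|zp] := eqVneq z p; first by exists 0.
  have z0 : 0 < cabs (z - p) < e by rewrite cabs_gt0 subr_eq0 zp.
  apply: ex_cderM; last exact: fd.
  by apply: ex_cderM; eexists; exact: cder_subr.
have [g1 hg1 E1] := holo_divide hH pp.
have g1p : g1 p = 0.
  apply: (@cder_unique _ H p) => //.
  have [l hl] := hg1 _ pp.
  have := cderM (cder_subr p p) hl; rewrite subrr mul0r addr0 mul1r.
  apply: cder_ext e0 _ => h he; rewrite (E1 (p + h)) ?Hp ?add0r//.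
  by rewrite (_ : p + h - p = h)//; ring.
have [g2 hg2 E2] := holo_divide hg1 pp.
exists g2 => // z /andP[z0 ze].
have zp : z - p != 0 by rewrite -cabs_gt0.
apply: (mulfI zp); apply: (mulfI zp).
have := E1 z ze; rewrite E2// g1p Hp !add0r /H => <-; by rewrite mulrA.
Qed.

(** If z - p can be divided out indefinitely, Cauchy's estimate on a circle of radius [r] gives
    |f(z)| <= C (|z - p| / r)^m for every [m], so [f] vanishes. *)
Lemma zero_order f p e : 0 < e -> holo_disc f p e ->
  (forall z, cabs (z - p) < e -> f z = 0) \/
  exists m g, [/\ holo_disc g p e, g p != 0 &
    forall z, cabs (z - p) < e -> f z = (z - p) ^+ m * g z].
Proof.
move=> e0 hf; have pp : cabs (p - p) < e by rewrite subrr cabs0.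
have [?|N] := pselect (exists m g, [/\ holo_disc g p e, g p != 0 &
    forall z, cabs (z - p) < e -> f z = (z - p) ^+ m * g z]); first by right.
left=> z hz.
have G m : exists2 g, holo_disc g p e &
    forall z, cabs (z - p) < e -> f z = (z - p) ^+ m * g z.
  elim: m => [|m [g hg E]]; first by exists f => // y _; rewrite expr0 mul1r.
  have g0 : g p = 0.
    by apply/eqP; apply: contrapT => g0; apply: N; exists m, g; split=> //; exact/negP.
  have [g1 hg1 E1] := holo_divide hg pp.
  by exists g1 => // y hy; rewrite E// E1// g0 add0r mulrA exprSr.
pose r := (cabs (z - p) + e) / 2.
have zr : cabs (z - p) < r by rewrite /r; lra.
have re : r < e by rewrite /r; lra.
have r0 : 0 < r := le_lt_trans (cabs_ge0 _) zr.
have circ_in t : cabs (circ p r t - p) < e by rewrite (cabs_circ p t (ltW r0)).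
have [|M fM] := @pcont_bounded _ (fun t => f (circ p r t)).
  by apply: pcont_comp => t; exact: holo_disc_ccont hf (circ_in t).
apply/eqP; rewrite -cabs_eq0 eq_le cabs_ge0 andbT.
apply: (@geometric_le0 _ (M * r / (r - cabs (z - p))) (cabs (z - p) / r)).
  by rewrite divr_ge0 ?cabs_ge0 ?(ltW r0)// ltr_pdivrMr// mul1r.
move=> m; have [g hg E] := G m.
have rm : 0 < r ^+ m by rewrite exprn_gt0.
have B := @cauchy_bound _ g p z r e (M / r ^+ m) zr re hg.
rewrite E// cabsM cabsX expr_div_n.
have -> : M * r / (r - cabs (z - p)) * (cabs (z - p) ^+ m / r ^+ m) =
  cabs (z - p) ^+ m * (M / r ^+ m * r / (r - cabs (z - p))).
  by field; rewrite !gt_eqF// subr_gt0.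
rewrite ler_wpM2l ?exprn_ge0 ?cabs_ge0//; apply: B => t t0.
rewrite ler_pdivlMr//; have := fM t t0; rewrite E// cabsM cabsX.
by rewrite (cabs_circ p t (ltW r0)) mulrC.
Qed.

(** [k] is the order of the zero and [l] the order of the pole at [p], one of them being 0. The
    identity is multiplied out and restricted to a punctured disc, because the value of [f] at a
    pole is arbitrary. *)
Definition lord f p (k l : nat) := ((k == 0%N) || (l == 0%N)) /\
  exists g e, [/\ 0 < e, holo_disc g p e,
    forall z, cabs (z - p) < e -> g z != 0 &
    forall z, 0 < cabs (z - p) < e -> f z * (z - p) ^+ l = (z - p) ^+ k * g z].

Lemma ccont_neq0 g p e : 0 < e -> holo_disc g p e -> g p != 0 ->
  exists e', [/\ 0 < e', e' <= e & forall z, cabs (z - p) < e' -> g z != 0].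
Proof.
move=> e0 hg g0; have pp : cabs (p - p) < e by rewrite subrr cabs0.
have n0 : 0 < cabs (g p) by rewrite cabs_gt0.
have [d d0 D] := holo_disc_ccont hg pp n0.
exists (Num.min e d); split; first by rewrite lt_min e0.
  by rewrite ge_min lexx.
move=> z; rewrite lt_min => /andP[_ /D].
rewrite (_ : p + (z - p) = z); last by ring.
move=> h; rewrite -cabs_gt0.
by have := cabs_lower (g p) (g z); rewrite cabsC; lra.
Qed.

Lemma punctured_point p e : 0 < e -> exists2 z : C, 0 < cabs (z - p) < e &
  cabs (z - p) = e / 2.
Proof.
move=> e0; have E : cabs (p + rc (e / 2) - p) = e / 2.
  rewrite (_ : p + rc (e / 2) - p = rc (e / 2)); last by ring.
  by rewrite cabs_rc ger0_norm// divr_ge0// ltW.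
by exists (p + rc (e / 2)) => //; rewrite E; lra.
Qed.

Lemma holo_punctured_zero g p e : 0 < e -> holo_disc g p e ->
  (forall z, 0 < cabs (z - p) < e -> g z = 0) -> g p = 0.
Proof.
move=> e0 hg H; apply/eqP; apply: contraT => g0.
have [e' [e'0 ee' N]] := ccont_neq0 e0 hg g0.
have [z /andP[z1 z2] _] := @punctured_point p e' e'0.
by have := N z z2; rewrite H ?eqxx// z1 (lt_le_trans z2).
Qed.

(** Otherwise [g] equals a positive power of z - p times [g'] near [p], and continuity gives
    [g p = 0]. *)
Lemma lord_le f p k l k' l' : lord f p k l -> lord f p k' l' -> (k' + l <= k + l')%N.
Proof.
move=> [_ [g [e [e0 hg gn E]]]] [_ [g' [e' [e'0 hg' gn' E']]]].
rewrite leqNgt; apply/negP => lt.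
have d0 : 0 < Num.min e e' by rewrite lt_min e0.
pose m := (k' + l - (k + l'))%N.
have m0 : (0 < m)%N by rewrite subn_gt0.
have pe : cabs (p - p) < e by rewrite subrr cabs0.
have hh : holo_disc (fun z => g z - (z - p) ^+ m * g' z) p (Num.min e e').
  move=> z; rewrite lt_min => /andP[ze ze'].
  have [a ha] := hg z ze.
  have [b hb] : exists b, cder (fun y => (y - p) ^+ m * g' y) z b.
    apply: ex_cderM; last exact: hg'.
    by apply: ex_cderX; eexists; exact: cder_subr.
  by eexists; exact: cderB ha hb.
have := holo_punctured_zero d0 hh; rewrite subrr expr0n.
have -> : (m == 0%N) = false by apply/negbTE; rewrite -lt0n.
rewrite mul0r subr0 => H; move: (gn p pe); rewrite H ?eqxx//.
move=> z /andP[z0]; rewrite lt_min => /andP[ze ze'].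
have zp : z - p != 0 by rewrite -cabs_gt0.
apply/eqP; rewrite subr_eq0; apply/eqP.
apply: (mulfI (expf_neq0 (k + l') zp)).
have := E z; rewrite z0 ze => /(_ isT) Ez; have := E' z; rewrite z0 ze' => /(_ isT) Ez'.
rewrite mulrA -exprD subnKC; last exact: ltnW.
rewrite !exprD; transitivity ((z - p) ^+ k * g z * (z - p) ^+ l'); first by ring.
rewrite -Ez; transitivity (f z * (z - p) ^+ l' * (z - p) ^+ l); first by ring.
by rewrite Ez'; ring.
Qed.

Lemma lord_unique f p k l k' l' : lord f p k l -> lord f p k' l' -> k = k' /\ l = l'.
Proof.
move=> H H'; have h1 := lord_le H H'; have h2 := lord_le H' H.
have : (k' + l = k + l')%N by apply/eqP; rewrite eqn_leq h1.
case: H H' => /orP[] /eqP -> _ [/orP[] /eqP -> _]; lia.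
Qed.

Lemma holo_near_disc f p : holo_near f p -> exists2 e, 0 < e & holo_disc f p e.
Proof. by move=> [e [e0 H]]; exists e => // z /H /derivable_cder. Qed.

Lemma holo_disc_derivable f p e z : holo_disc f p e -> cabs (z - p) < e -> derivable f z 1.
Proof. by move=> H /H[l /cder_derivable]. Qed.

Lemma holo_near_self f p : holo_near f p -> exists l, cder f p l.
Proof.
by move=> /holo_near_disc[e e0]; apply; rewrite subrr cabs0.
Qed.

Lemma lord_neq0 f p k l : lord f p k l ->
  exists2 e, 0 < e & forall z, 0 < cabs (z - p) < e -> f z != 0.
Proof.
move=> [_ [g [e [e0 hg gn E]]]]; exists e => // z ze.
have := E z ze; case/andP: ze => z0 ze Ez; apply/eqP => fz0.
move: Ez => /eqP; rewrite fz0 mul0r eq_sym; apply/negP.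
by rewrite mulf_neq0 ?gn// expf_neq0// -cabs_gt0.
Qed.

Lemma mero_lord f p : meromorphic f ->
  (exists2 e, 0 < e & forall z, 0 < cabs (z - p) < e -> f z = 0) \/
  exists k l, lord f p k l.
Proof.
move=> /(_ p)[/holo_near_disc[e e0 hf]|[[e1 [e10 fd]] /(_ 1)[e2 [e20 f1]]]].
  have [f0|[m [g [hg g0 E]]]] := zero_order e0 hf.
    by left; exists e => // z /andP[_]; exact: f0.
  right; exists m, 0%N; split; first by rewrite orbT.
  have [e' [e'0 ee' N]] := ccont_neq0 e0 hg g0.
  exists g, e'; split => //; first exact: holo_disc_sub hg.
  by move=> z /andP[_ ze]; rewrite expr0 mulr1 E// (lt_le_trans ze).
(* At a pole 1/f is bounded by 1 nearby and extends holomorphically; the order of its zero is the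
   order of the pole. *)
right; pose e := Num.min e1 e2.
have e0 : 0 < e by rewrite lt_min e10.
have fz z : 0 < cabs (z - p) < e -> (exists l, cder f z l) /\ 1 < cabs (f z).
  rewrite lt_min => /and3P[z0 z1 z2]; split; last by apply: f1; rewrite z0.
  by apply: derivable_cder; apply: fd; rewrite z0.
have fn z : 0 < cabs (z - p) < e -> f z != 0.
  by move=> /fz[_ h]; rewrite -cabs_gt0 (lt_trans _ h).
have [|z /fz[_ h]|k hk Ek] := @removable_singularity (fun z => (f z)^-1) p e 1 e0.
- by move=> z hz; apply: ex_cderV; [exact: fn|have [] := fz z hz].
- by rewrite cabsV invf_le1 ?(ltW h)// (lt_trans _ h).
have [k0|[m [g [hg g0 E]]]] := zero_order e0 hk.
  have [z ze _] := @punctured_point p e e0.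
  by case/andP: (ze) => _ /k0; rewrite -Ek// => /eqP; rewrite invr_eq0 (negPf (fn z ze)).
exists 0%N, m; split; first by [].
have [e' [e'0 ee' N]] := ccont_neq0 e0 hg g0.
exists (fun z => (g z)^-1), e'; split => //.
- move=> z ze; apply: ex_cderV; first exact: N.
  by apply: hg; exact: lt_le_trans ee'.
- by move=> z /N gz; rewrite invr_eq0.
move=> z /andP[z0 ze']; have ze : 0 < cabs (z - p) < e by rewrite z0 (lt_le_trans ze').
have zp : z - p != 0 by rewrite -cabs_gt0.
have := E z; case/andP: (ze) => _ h /(_ h); rewrite -Ek// => H.
rewrite -[f z]invrK H expr0 mul1r; field.
by rewrite expf_neq0// N.
Qed.

Lemma holo_lord f p k l : holo_near f p -> lord f p k l -> l = 0%N.
Proof.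
move=> hn L; have [e e0 hf] := holo_near_disc hn.
have [f0|[m [g [hg g0 E]]]] := zero_order e0 hf.
  have [e' e'0 N] := lord_neq0 L.
  have d0 : 0 < Num.min e e' by rewrite lt_min e0.
  have [z] := @punctured_point p _ d0; rewrite lt_min => /and3P[z0 z1 z2] _.
  by have := N z; rewrite z0 z2 f0// eqxx => /(_ isT).
have [e' [e'0 ee' N]] := ccont_neq0 e0 hg g0.
have L' : lord f p m 0.
  split; first by rewrite orbT.
  exists g, e'; split => //; first exact: holo_disc_sub hg.
  by move=> z /andP[_ ze]; rewrite expr0 mulr1 E// (lt_le_trans ze).
by have [_ ->] := lord_unique L L'.
Qed.

Lemma pole_lord f p k l : is_pole f p -> lord f p k l -> (0 < l)%N.
Proof.
move=> [_ pf] [_ [g [e [e0 hg gn E]]]]; rewrite lt0n; apply/eqP => l0; subst l.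
have pe : cabs (p - p) < e by rewrite subrr cabs0.
have gk : ccont (fun z => (z - p) ^+ k * g z) p.
  have [a /cder_ccont] : exists a, cder (fun z => (z - p) ^+ k * g z) p a.
    apply: ex_cderM; last exact: hg.
    by apply: ex_cderX; eexists; exact: cder_subr.
  by [].
have [d d0 D] := gk 1 ltr01.
set K := (p - p) ^+ k * g p in D.
have [e' [e'0 N]] := pf (cabs K + 1).
have m0 : 0 < Num.min e (Num.min d e') by rewrite !lt_min e0 d0.
have [z] := @punctured_point p _ m0; rewrite !lt_min => /and4P[z0 z1 z2 z3] _.
have := N z; rewrite z0 z3 => /(_ isT).
have := E z; rewrite z0 z1 => /(_ isT); rewrite expr0 mulr1 => ->.
have := D _ z2; rewrite (_ : p + (z - p) = z); last by ring.
by have := cabs_lower ((z - p) ^+ k * g z) K; lra.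
Qed.

(** Identity theorem. The set [A] of points with a punctured neighbourhood on which [f] vanishes is
    open, and so is its complement by [mero_lord]; connectedness is used along segments only. *)
Lemma mero_dichotomy f : meromorphic f ->
  (forall z, f z = 0) \/ (forall p, exists k l, lord f p k l).
Proof.
move=> mf; pose A p := exists2 e, 0 < e & forall z, 0 < cabs (z - p) < e -> f z = 0.
have [noA|] := pselect (forall p, ~ A p).
  by right=> p; have [/noA|] := mero_lord p mf.
move=> /existsNP[p /contrapT Ap]; left.
have near_pt (q q' : C) e : 0 < e -> cabs (q' - q) < e ->
    exists2 e', 0 < e' & forall z, 0 < cabs (z - q') < e' -> 0 < cabs (z - q) < e.
  move=> e0 qe; have [->|qq] := eqVneq q' q; first by exists e.
  have n0 : 0 < cabs (q' - q) by rewrite cabs_gt0 subr_eq0.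
  exists (Num.min (cabs (q' - q)) (e - cabs (q' - q))); first by rewrite lt_min n0 subr_gt0.
  move=> z; rewrite lt_min => /and3P[z0 z1 z2].
  have := cabs_triangle z q' q; have := cabs_triangle q' z q; rewrite (cabsC q' z).
  by move=> h1 h2; apply/andP; split; lra.
have Aopen q : A q -> exists2 d, 0 < d & forall q', cabs (q' - q) < d -> A q'.
  move=> [e e0 H]; exists e => // q' hq; have [e' e'0 H'] := near_pt q q' e e0 hq.
  by exists e' => // z /H' /H.
have NAopen q : ~ A q -> exists2 d, 0 < d & forall q', cabs (q' - q) < d -> ~ A q'.
  move=> nA; have [/nA//|[k [l /lord_neq0[e e0 H]]]] := mero_lord q mf.
  exists e => // q' hq [e2 e20 H2]; have [e' e'0 H'] := near_pt q q' e e0 hq.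
  have m0 : 0 < Num.min e' e2 by rewrite lt_min e'0.
  have [z] := @punctured_point q' _ m0; rewrite lt_min => /and3P[z0 z1 z2] _.
  have : f z != 0 by apply: H; apply: H'; rewrite z0.
  by rewrite H2 ?eqxx// z0.
have allA q : A q.
  (* At the supremum [tau] of this set, openness of [A] allows a step further unless [tau = 1], and
     openness of the complement excludes that the point at [tau] is outside [A]. *)
  pose S := [set t : R | 0 <= t <= 1 /\ forall s, 0 <= s <= t -> A (lerp p q s)].
  have S0 : S 0.
    by split=> [|s]; [rewrite lexx ler01|rewrite -eq_le => /eqP <-; rewrite lerp0].
  have hS : has_sup S by split; [exists 0|exists 1 => t [/andP[]]].
  pose tau := sup S.
  have tau0 : 0 <= tau by apply: ub_le_sup; [case: hS|].
  have tau1 : tau <= 1 by apply: ge_sup; [case: hS|move=> t [/andP[]]].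
  have lip s t : cabs (lerp p q s - lerp p q t) = `|s - t| * cabs (q - p).
    by rewrite -cabs_rc -cabsM; congr cabs; rewrite /lerp rcB; ring.
  have K0 : 0 < cabs (q - p) + 1 by rewrite ltr_wpDl ?cabs_ge0.
  have close (d : R) s : 0 < d -> `|s - tau| < d / (cabs (q - p) + 1) ->
      cabs (lerp p q s - lerp p q tau) < d.
    move=> d0; rewrite ltr_pdivlMr// lip; apply: le_lt_trans.
    by rewrite ler_wpM2l// lerDl.
  have [At|nAt] := pselect (A (lerp p q tau)).
    have [d d0 D] := Aopen _ At.
    pose d' := d / (cabs (q - p) + 1); have d'0 : 0 < d' by exact: divr_gt0.
    have below s : 0 <= s < tau -> A (lerp p q s).
      move=> /andP[s0 /(sup_gt hS.1)[t [_ H] st]]; apply: H; rewrite s0 ltW//.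
    have Sm : S (Num.min 1 (tau + d' / 2)).
      split; first by rewrite le_min ler01 ge_min lexx /= addr_ge0// ltW// half_pos.
      move=> s /andP[s0]; rewrite le_min => /andP[s1 s2].
      have [st|ts] := ltP s tau; first by apply: below; rewrite s0.
      apply: D; apply: close => //; rewrite ger0_norm ?subr_ge0// -/d'; lra.
    have : Num.min 1 (tau + d' / 2) <= tau by apply: ub_le_sup; [case: hS|].
    rewrite ge_min => /orP[t1|]; last by lra.
    case: Sm => _ /(_ 1); rewrite lerp1; apply.
    by rewrite ler01 le_min lexx /=; lra.
  have [d d0 D] := NAopen _ nAt.
  pose d' := d / (cabs (q - p) + 1); have d'0 : 0 < d' by exact: divr_gt0.
  have [t [t01 H] tt] : exists2 t, S t & tau - d' < t
    by apply: sup_gt; [exact: hS.1|rewrite -/tau ltrBlDr ltrDl].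
  have tle : t <= tau by apply: ub_le_sup; [case: hS|].
  exfalso; apply: (D (lerp p q t)).
    by apply: close => //; rewrite ler0_norm ?subr_le0// -/d'; lra.
  by apply: H; case/andP: t01 => -> _; rewrite lexx.
(* From the punctured disc to the point itself: by continuity where [f] is holomorphic, while a pole
   cannot lie in [A]. *)
move=> z; have [e e0 H] := allA z.
have [/holo_near_disc[e' e'0 hf]|[_ /(_ 0)[e2 [e20 H2]]]] := mf z.
  have m0 : 0 < Num.min e e' by rewrite lt_min e0.
  apply: (holo_punctured_zero m0); first by apply: holo_disc_sub hf; rewrite ge_min lexx orbT.
  by move=> y; rewrite lt_min => /and3P[y0 y1 _]; apply: H; rewrite y0.
have m0 : 0 < Num.min e e2 by rewrite lt_min e0.
have [y] := @punctured_point z _ m0; rewrite lt_min => /and3P[y0 y1 y2] _.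
by have := H2 y; rewrite H ?y0// cabs0 ltxx => /(_ y2).
Qed.

End LocalStructure.

(** * Finite factorization on a disc *)

Section Factorization.
Variable R : realType.
Local Notation C := (Cplx R).
Implicit Types (z w p : C) (e r rho : R) (f g h : C -> C).

Lemma disc_cover (e_ : C -> R) rho : (forall p, 0 < e_ p) ->
  exists s : seq C, forall z, cabs z <= rho -> exists2 p, p \in s & cabs (z - p) < e_ p.
Proof.
move=> e0; pose K := `[- rho, rho]%classic `*` `[- rho, rho]%classic : set (R * R).
have Kc : compact K by apply: compact_setX; exact: segment_compact.
pose U (p : C) : set (R * R) := [set xy | cabs ((xy.1 +i* xy.2)%C - p) < e_ p].
have Uo p : open (U p).
  rewrite openE => -[x y] /= xyp; rewrite /interior.
  pose d := (e_ p - cabs ((x +i* y)%C - p)) / 2.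
  have d0 : 0 < d by rewrite half_pos// subr_gt0.
  apply/nbhs_ballP; exists d => // -[x' y'] [/= hx hy].
  rewrite /ball /= in hx hy; rewrite /U /=.
  have := cabs_triangle (x +i* y)%C (x' +i* y')%C p.
  have := cabs_le_reim ((x' +i* y')%C - (x +i* y)%C : C).
  rewrite creB cimB /= (distrC x') (distrC y') /d in hx hy *; lra.
(* [F] expresses validity for all sufficiently large finite lists of centres. The near-covering form
   of compactness along this filter yields a finite subcover. *)
pose F : set_system (seq C) :=
  fun Q => exists s : seq C, forall s' : seq C, {subset s <= s'} -> Q s'.
have FF : Filter F.
  split; first by exists [::].
    move=> P Q [s1 H1] [s2 H2]; exists (s1 ++ s2) => s' ss.
    by split; [apply: H1|apply: H2] => x xs; apply: ss; rewrite mem_cat xs ?orbT.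
  by move=> P Q PQ [s H]; exists s => s' /H /PQ.
pose P (s : seq C) (xy : R * R) := exists2 p, p \in s & U p xy.
have [|s Hs] := iffLR (compact_near_coveringP K) Kc (seq C) F P FF.
  move=> [x y] _; pose p : C := (x +i* y)%C.
  exists (U p, [set s : seq C | p \in s]) => /=; last by move=> [xy s] [/= h1 h2]; exists p.
  have Up : U p (x, y) by rewrite -[U p (x, y)]/(is_true (cabs (p - p) < e_ p)) subrr cabs0.
  split; first by apply: open_nbhs_nbhs; split; [exact: Uo|].
  by exists [:: p] => s' ss; apply: ss; rewrite mem_head.
have {}Hs := Hs s (fun _ => id); exists s => z zr.
have [|p ps Up] := Hs (cre z, cim z).
  split; rewrite /= in_itv /= -ler_norml.
    exact: le_trans (cabs_re z) zr.
  exact: le_trans (cabs_im z) zr.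
by exists p => //; case: z zr Up.
Qed.

Definition reg f z := holo_near f z /\ f z != 0.

Lemma lord_reg f p k l : lord f p k l ->
  exists2 e, 0 < e & forall z, 0 < cabs (z - p) < e -> reg f z.
Proof.
move=> L; have [e1 e10 N] := lord_neq0 L; case: L => _ [g [e [e0 hg gn E]]].
have m0 : 0 < Num.min e1 e by rewrite lt_min e10.
exists (Num.min e1 e) => // z; rewrite lt_min => /and3P[z0 z1 z2].
split; last by apply: N; rewrite z0.
have d0 : 0 < Num.min (cabs (z - p)) (e - cabs (z - p)).
  by rewrite lt_min z0 subr_gt0.
exists (Num.min (cabs (z - p)) (e - cabs (z - p))); split => // y.
have sub (x : C) : cabs (x - z) < Num.min (cabs (z - p)) (e - cabs (z - p)) ->
    0 < cabs (x - p) < e.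
  rewrite lt_min => /andP[h1 h2].
  have := cabs_triangle z x p; have := cabs_triangle x z p; rewrite (cabsC z x).
  by move=> h3 h4; apply/andP; split; lra.
move=> yz; have /andP[y0 ye] := sub y yz.
have yp : y - p != 0 by rewrite -cabs_gt0.
have [a ha] : exists a, cder (fun x => (x - p) ^+ k * g x * ((x - p) ^+ l)^-1) y a.
  apply: ex_cderM.
    apply: ex_cderM; last exact: hg.
    by apply: ex_cderX; eexists; exact: cder_subr.
  apply: ex_cderV; first by rewrite expf_neq0.
  by apply: ex_cderX; eexists; exact: cder_subr.
apply: (@cder_derivable _ f y a).
set m := Num.min _ _ in yz sub d0.
have d1 : 0 < m - cabs (y - z) by rewrite subr_gt0.
apply: cder_ext d1 _ ha => x hx.
have xz : cabs (y + x - z) < m.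
  by have := cabsD (y - z) x; rewrite (_ : y - z + x = y + x - z); [lra|ring].
have xe := sub _ xz; rewrite -E// mulfK// expf_neq0// -cabs_gt0.
by case/andP: xe.
Qed.

(* The local orders are only prescribed inside the disc of radius [rho], so that
   the hypothesis is inherited by the quotients built in the induction. *)
Lemma factor_list f rho (s : seq C) (kf lf : C -> nat) :
  (forall p, cabs p < rho -> lord f p (kf p) (lf p)) -> uniq s ->
  (forall p, p \in s -> cabs p < rho) ->
  (forall p, cabs p < rho -> p \notin s -> reg f p /\ kf p = 0%N /\ lf p = 0%N) ->
  exists A B h, [/\ forall p, cabs p < rho -> (exists a, cder h p a) /\ h p != 0,
    forall p, cabs p < rho -> count_mem p A = kf p /\ count_mem p B = lf p,
    forall p, (p \in A) || (p \in B) -> p \in s &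
    forall z, cabs z < rho -> z \notin s ->
      f z * \prod_(b <- B) (z - b) = \prod_(a <- A) (z - a) * h z].
Proof.
elim: s f kf lf => [|p s IH] f kf lf Lf us ss Rf.
  exists [::], [::], f; split=> //.
  - move=> p hp; have [|[hn f0] _] := Rf p hp; first by [].
    by split=> //; exact: holo_near_self.
  - by move=> p hp; have [|_ [-> ->]] := Rf p hp.
  - by move=> z _ _; rewrite !big_nil mulr1 mul1r.
have prho : cabs p < rho by apply: ss; rewrite mem_head.
have [D [g [e [e0 hg gn E]]]] := Lf p prho.
pose k := kf p; pose l := lf p.
(* The zero or pole at [p] is divided out, and the value at [p] is set to [g p] to make the quotient
   regular there. *)
pose f1 z := if z == p then g p else f z * (z - p) ^+ l / (z - p) ^+ k.
have f1E z : cabs (z - p) < e -> f1 z = g z.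
  move=> ze; rewrite /f1; case: eqP => [->//|/eqP zp].
  have zp' : z - p != 0 by rewrite subr_eq0.
  rewrite E; last by rewrite cabs_gt0 zp'.
  by rewrite mulrC mulKf// expf_neq0.
pose kf1 q := if q == p then 0%N else kf q.
pose lf1 q := if q == p then 0%N else lf q.
have /andP[ps us'] : (p \notin s) && uniq s by [].
have pp : cabs (p - p) < e by rewrite subrr cabs0.
have trans_pow q (m : nat) : q != p -> exists2 d, 0 < d &
   forall z, cabs (z - q) < d -> (z - p != 0) /\ exists a, cder (fun y => (y - p) ^+ m) z a.
  move=> qp; exists (cabs (q - p)); first by rewrite cabs_gt0 subr_eq0.
  move=> z zq; split; last by apply: ex_cderX; eexists; exact: cder_subr.
  rewrite -cabs_gt0; have := cabs_triangle z q p; rewrite (cabsC q z).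
  by have := cabs_ge0 (z - p); lra.
have reg1 q : q != p -> reg f q -> reg f1 q.
  move=> qp [[d [d0 fd]] fq0].
  have [d1 d10 T1] := trans_pow q l qp; have [d2 d20 T2] := trans_pow q k qp.
  have qp' : q - p != 0 by rewrite subr_eq0.
  split; last first.
    by rewrite /f1 (negPf qp) !mulf_neq0// ?invr_eq0 expf_neq0.
  pose m := Num.min d (Num.min d1 d2).
  have m0 : 0 < m by rewrite !lt_min d0 d10.
  exists m; split => // z zm; have := zm; rewrite !lt_min => /and3P[z0 z1 z2].
  have [zp [a ha]] := T1 z z1; have [_ [b hb]] := T2 z z2.
  have [c hc] : exists c, cder (fun y => f y * (y - p) ^+ l * ((y - p) ^+ k)^-1) z c.
    apply: ex_cderM; first by apply: ex_cderM; [exact/derivable_cder/fd|exists a].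
    by apply: ex_cderV; [exact: expf_neq0|exists b].
  apply: (@cder_derivable _ _ _ c).
  have n0 : 0 < cabs (z - p) by rewrite cabs_gt0.
  apply: cder_ext n0 _ hc => x hx; rewrite /f1; case: eqP => // xp.
  by move: hx; rewrite -xp (_ : z - (z + x) = - x) ?cabsN ?ltxx//; ring.
have [||||A [B [h [H1 H2 H3 H4]]]] := IH f1 kf1 lf1.
- move=> q hq; rewrite /kf1 /lf1; have [->|qp] := eqVneq q p.
    split=> //; exists g, e; split => // z /andP[_ ze].
    by rewrite !expr0 mulr1 mul1r f1E.
  have [Dq [gq [eq_ [eq0 hgq gnq Eq]]]] := Lf q hq.
  split=> //.
  have [d1 d10 T1] := trans_pow q l qp; have [d2 d20 T2] := trans_pow q k qp.
  exists (fun z => gq z * (z - p) ^+ l * ((z - p) ^+ k)^-1), (Num.min eq_ (Num.min d1 d2)); split.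
  + by rewrite !lt_min eq0 d10.
  + move=> z; rewrite !lt_min => /and3P[z0 z1 z2].
    have [zp [a ha]] := T1 z z1; have [_ [b hb]] := T2 z z2.
    apply: ex_cderM; first by apply: ex_cderM; [exact: hgq|exists a].
    by apply: ex_cderV; [exact: expf_neq0|exists b].
  + move=> z; rewrite !lt_min => /and3P[z0 z1 z2]; have [zp _] := T1 z z1.
    by rewrite !mulf_neq0 ?gnq// ?invr_eq0 expf_neq0.
  + move=> z; rewrite !lt_min => /andP[z00 /and3P[z0 z1 z2]]; have [zp _] := T1 z z1.
    rewrite /f1; case: eqP => [zp'|_]; first by move: zp; rewrite zp' subrr eqxx.
    have := Eq z; rewrite z00 z0 => /(_ isT) EE.
    transitivity (f z * (z - q) ^+ lf q * ((z - p) ^+ l / (z - p) ^+ k)); first by ring.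
    by rewrite EE; ring.
- exact: us'.
- by move=> q qs; apply: ss; rewrite in_cons qs orbT.
- move=> q hq qs; rewrite /kf1 /lf1; have [->|qp] := eqVneq q p.
    split=> //; split; last by rewrite f1E// gn.
    exists e; split => // z ze; have [a ha] := hg z ze.
    apply: (@cder_derivable _ _ _ a).
    have d0 : 0 < e - cabs (z - p) by rewrite subr_gt0.
    apply: cder_ext d0 _ ha => x hx; rewrite f1E//.
    by have := cabsD (z - p) x; rewrite (_ : z - p + x = z + x - p); [lra|ring].
  have [|rq kl] := Rf q hq; first by rewrite in_cons negb_or qp.
  by split => //; exact: reg1.
have notp q : (q \in A) || (q \in B) -> q != p.
  by move=> /H3 qs; apply: contraNneq ps => <-.
have cA : count_mem p A = 0%N.
  by apply/count_memPn; apply/negP => pA; have := @notp p; rewrite pA eqxx => /(_ isT).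
have cB : count_mem p B = 0%N.
  by apply/count_memPn; apply/negP => pB; have := @notp p; rewrite pB orbT eqxx => /(_ isT).
exists (nseq k p ++ A), (nseq l p ++ B), h; split => //.
- move=> q hq; have [h1 h2] := H2 q hq; rewrite !count_cat !count_nseq /=.
  rewrite eq_sym; have [->|qp] := eqVneq q p.
    by rewrite !mul1n cA cB !addn0.
  by rewrite !mul0n !add0n h1 h2 /kf1 /lf1 (negPf qp).
- move=> q; rewrite !mem_cat !mem_nseq in_cons.
  have [//|qp] := eqVneq q p; rewrite !andbF !orFb => /H3 ->; by [].
- move=> z hz; rewrite in_cons negb_or => /andP[zp zs].
  have := H4 z hz zs; rewrite /f1 (negPf zp) !big_cat /= !big_nseq => EE.
  have zp' : (z - p) ^+ k != 0 by rewrite expf_neq0// subr_eq0.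
  have it n : iter n ( *%R (z - p)) 1 = (z - p) ^+ n.
    by elim: n => // n IHn; rewrite iterS IHn exprS.
  rewrite !it.
  transitivity ((z - p) ^+ k * (f z * (z - p) ^+ l / (z - p) ^+ k * \prod_(b <- B) (z - b))).
    by field.
  by rewrite EE; ring.
Qed.

End Factorization.

(** * Divisors and the counting function *)

Section Counting.
Variable R : realType.
Local Notation C := (Cplx R).
Local Notation mu := (@lebesgue_measure R).
Implicit Types (z w p b : C) (e r rho t : R) (f g h : C -> C).

Definition divisor f (kf lf : C -> nat) :=
  meromorphic f /\ forall p, lord f p (kf p) (lf p).

(** [A] and [B] repeat zeros and poles according to multiplicity. The identity is required off both
    lists, since [lord] does not constrain the value of [f] at the point. *)
Definition factored f (kf lf : C -> nat) rho (A B : seq C) h :=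
  [/\ forall p, cabs p < rho -> (exists a, cder h p a) /\ h p != 0,
    forall p, cabs p < rho -> count_mem p A = kf p /\ count_mem p B = lf p,
    forall p, (p \in A) || (p \in B) -> cabs p < rho &
    forall z, cabs z < rho -> z \notin A -> z \notin B ->
      f z * \prod_(b <- B) (z - b) = \prod_(a <- A) (z - a) * h z].

Lemma nonzero_divisor f : meromorphic f -> ~ (forall z, f z = 0) ->
  exists kf lf, divisor f kf lf.
Proof.
move=> mf nf; have [//|H] := mero_dichotomy mf.
have [|kl Hkl] := @choice C (nat * nat) (fun p kl => lord f p kl.1 kl.2).
  by move=> p; have [k [l L]] := H p; exists (k, l).
by exists (fun p => (kl p).1), (fun p => (kl p).2).
Qed.

Lemma lord00_reg f z : meromorphic f -> lord f z 0 0 -> reg f z.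
Proof.
move=> mf L; have [hn|pz] := mf z; last by have := pole_lord pz L.
split=> //; have [e e0 hf] := holo_near_disc hn.
case: L => _ [g [e' [e'0 hg gn E]]].
have m0 : 0 < Num.min e e' by rewrite lt_min e0.
have hh : holo_disc (fun y => f y - g y) z (Num.min e e').
  move=> y; rewrite lt_min => /andP[/hf[a ha] /hg[b hb]].
  by eexists; exact: cderB ha hb.
suff -> : f z = g z by apply: gn; rewrite subrr cabs0.
apply/eqP; rewrite -subr_eq0; apply/eqP; apply: (holo_punctured_zero m0 hh).
move=> y; rewrite lt_min => /and3P[y0 _ y1]; have := E y; rewrite y0 y1 => /(_ isT).
by rewrite !expr0 mulr1 mul1r => ->; rewrite subrr.
Qed.

Lemma reg_lord00 f z : reg f z -> lord f z 0 0.
Proof.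
move=> [/holo_near_disc[e e0 hf] f0]; have [e' [e'0 ee' N]] := ccont_neq0 e0 hf f0.
split=> //; exists f, e'; split=> //; first exact: holo_disc_sub hf.
by move=> y _; rewrite !expr0 mulr1 mul1r.
Qed.

Lemma factorization f kf lf rho : divisor f kf lf ->
  exists A B h, factored f kf lf rho A B h.
Proof.
move=> [mf Lf].
have [|e_ He] := @choice C R (fun p e => 0 < e /\ forall z, 0 < cabs (z - p) < e -> reg f z).
  by move=> p; have [e e0 H] := lord_reg (Lf p); exists e.
have [s Hs] := disc_cover rho (fun p => (He p).1).
(* Each disc of the cover is regular except perhaps at its centre, so every zero or pole in the disc
   is one of the finitely many centres. *)
pose s' := [seq p <- undup s | (cabs p < rho) && (0 < kf p + lf p)%N].
have s'P p : cabs p < rho -> (p \in s') = (0 < kf p + lf p)%N.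
  move=> hp; rewrite mem_filter hp /= mem_undup.
  have [kl|//] := ltnP 0 (kf p + lf p); rewrite andTb.
  have [q qs pq] := Hs p (ltW hp); have [<-//|qp] := eqVneq q p.
  have /reg_lord00 L : reg f p.
    by apply: (He q).2; rewrite pq cabs_gt0 subr_eq0 eq_sym qp.
  by have [e1 e2] := lord_unique (Lf p) L; rewrite e1 e2 in kl.
have [|p||A [B [h [H1 H2 H3 H4]]]] := @factor_list _ f rho s' kf lf (fun p _ => Lf p).
- by rewrite filter_uniq// undup_uniq.
- by rewrite mem_filter => /andP[/andP[]].
- move=> p hp; rewrite s'P// lt0n negbK addn_eq0 => /andP[/eqP k0 /eqP l0].
  split; last by [].
  by apply: lord00_reg => //; have := Lf p; rewrite k0 l0.
exists A, B, h; split => //.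
  by move=> p /H3; rewrite mem_filter => /andP[/andP[]].
move=> z hz zA zB; apply: H4 => //; rewrite s'P//.
have [h1 h2] := H2 z hz; rewrite -h1 -h2.
by rewrite (count_memPn zA) (count_memPn zB).
Qed.

Lemma pole_order_lord f p m : pole_order f p m -> lord f p 0 m.
Proof.
move=> [m0 [g [e [e0 [hg [g0 E]]]]]]; split=> //.
have hg' : holo_disc g p e by move=> z /hg /derivable_cder.
have [e' [e'0 ee' N]] := ccont_neq0 e0 hg' g0.
exists g, e'; split=> //; first exact: holo_disc_sub hg'.
move=> z /andP[z0 ze]; rewrite E ?z0 ?(lt_le_trans ze)// expr0 mul1r divfK//.
by rewrite expf_neq0// -cabs_gt0.
Qed.

Lemma lord_pole_order f p m : (0 < m)%N -> lord f p 0 m -> pole_order f p m.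
Proof.
move=> m0 [_ [g [e [e0 hg gn E]]]]; split=> //; exists g, e; split=> //; split.
  by move=> z; exact: holo_disc_derivable.
split; first by apply: gn; rewrite subrr cabs0.
move=> z ze; have := E z ze; rewrite expr0 mul1r => <-; rewrite mulfK//.
by rewrite expf_neq0// -cabs_gt0; case/andP: ze.
Qed.

Lemma sum_count_mem (T : eqType) (s B : seq T) : uniq s ->
  (\sum_(p <- s) count_mem p B = count (mem s) B)%N.
Proof.
move=> us; elim: B => [|b B IH] /=; first by rewrite big1.
rewrite big_split /= IH; congr (_ + _)%N.
by rewrite -count_uniq_mem// -sum1_count [in RHS]big_mkcond; apply: eq_bigr => p _ /=;
  rewrite eq_sym; case: (p == b).
Qed.

(** The supremum is attained by the distinct elements of [B] in |z| <= t, paired with their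
    multiplicities. *)
Lemma npolesE f kf lf rho A B h t : divisor f kf lf -> factored f kf lf rho A B h ->
  t < rho -> npoles f t = (count (fun b => cabs b <= t) B)%:R.
Proof.
move=> [mf Lf] [F1 F2 F3 F4] tr; rewrite /npoles; set X := [set x | _].
pose P b := cabs b <= t.
have ub x : X x -> x <= (count P B)%:R.
  move=> [l [ul [lp ->]]]; rewrite ler_nat.
  have -> : (\sum_(pm <- l) pm.2 = \sum_(p <- map fst l) count_mem p B)%N.
    rewrite big_map !big_seq; apply: eq_bigr => -[p m] pml /=.
    have [/pole_order_lord Lp pt] := lp _ pml.
    have [_ ->] := F2 p (le_lt_trans pt tr).
    by have [_ ->] := lord_unique (Lf p) Lp.
  rewrite sum_count_mem//; apply: sub_count => p /mapP[pm pml ->].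
  by have [_] := lp _ pml.
have Xm : X (count P B)%:R.
  pose s := undup [seq b <- B | P b].
  have sB p : p \in s -> P p /\ p \in B.
    by rewrite mem_undup mem_filter => /andP[].
  exists [seq (p, count_mem p B) | p <- s]; split.
    by rewrite -map_comp map_id_in ?undup_uniq// => p _.
  split.
    move=> _ /mapP[p /sB[Pp pB] ->] /=; split=> //.
    have hp := le_lt_trans Pp tr.
    have [hA hB] := F2 p hp.
    have m0 : (0 < count_mem p B)%N by rewrite -has_count has_pred1.
    apply: lord_pole_order => //; rewrite hB.
    have := Lf p; case=> /orP[] /eqP E L; first by rewrite -E; split=> //; rewrite E eqxx.
    by move: m0; rewrite hB E.
  congr (_%:R); rewrite big_map /= sum_count_mem ?undup_uniq//.
  apply: eq_in_count => p pB /=; rewrite mem_undup mem_filter pB andbT//.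
apply/eqP; rewrite eq_le; apply/andP; split.
  by apply: ge_sup => //; exists (count P B)%:R.
by apply: ub_le_sup => //; exists (count P B)%:R.
Qed.

(** The contribution of a single point to the integrated counting function: the integral of 1/t from
    |b| to [r], and log r at the origin. *)
Definition wt r b : R := if b == 0 then ln r else
  if cabs b <= r then ln (r / cabs b) else 0.

Definition NS (B : seq C) r := \sum_(b <- B) wt r b.

Lemma count_sumr (T : Type) (P : pred T) (s : seq T) :
  (count P s)%:R = \sum_(b <- s) (if P b then 1 else 0) :> R.
Proof.
by elim: s => [|b s IH]; rewrite ?big_nil// big_cons /= natrD IH; case: (P b).
Qed.

Lemma integral_step_inv (m r : R) : 0 < m ->
  (\int[mu]_(t in [set t : R | (0 < t <= r)%R])
     (if m <= t then t^-1 else 0)%R%:E)%E =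
  (if m <= r then ln (r / m) else 0)%:E.
Proof.
move=> m0; set D := [set t : R | _].
have DE : D = `]0, r]%classic by apply/seteqP; split=> t; rewrite /D /= in_itv.
pose P := `[m, +oo[%classic : set R.
have -> : (\int[mu]_(t in D) (if m <= t then t^-1 else 0)%R%:E)%E =
   (\int[mu]_(t in D `&` P) (t^-1)%:E)%E.
  rewrite integral_mkcondr; apply: eq_integral => t _; rewrite patchE.
  have -> : (t \in P) = (m <= t) by apply/idP/idP; rewrite inE /P /= in_itv /= andbT.
  by case: leP.
have -> : D `&` P = `[m, r]%classic.
  rewrite DE /P; apply/seteqP; split=> t /=; rewrite !in_itv /= andbT.
    by move=> [/andP[t0 tr] mt]; rewrite mt.
  by move=> /andP[mt tr]; rewrite tr andbT (lt_le_trans m0).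
have [mr|rm|<-] := ltgtP m r.
- have ci t : m <= t <= r -> {for t, continuous (@GRing.inv R)}.
    by move=> /andP[mt _]; apply: inv_continuous; rewrite gt_eqF// (lt_le_trans m0).
  have dl t : m <= t <= r -> is_derive t 1 (@ln R) t^-1.
    by move=> /andP[mt _]; apply: is_derive1_ln; exact: lt_le_trans mt.
  have Hi := continuous_on_integrable ci.
  rewrite -[LHS]fineK; last exact: integrable_fin_num.
  rewrite -[fine _]/(\int[mu]_(t in `[m, r]) t^-1)%R.
  have -> := Rint_FTC mr ci dl.
  by rewrite ln_div ?posrE// (lt_trans m0).
- by rewrite set_itv_ge ?integral_set0//= bnd_simp -ltNge.
- by rewrite set_itv1 integral_set1 divff ?ln1// gt_eqF.
Qed.

Lemma NcountE f kf lf rho A B h r : divisor f kf lf -> factored f kf lf rho A B h ->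
  0 < r < rho -> Ncount f r = NS B r.
Proof.
move=> df ff /andP[r0 rr]; rewrite /Ncount; set D := [set t : R | _].
have rho0 : 0 < rho := lt_trans r0 rr.
have DE : D = `]0, r]%classic by apply/seteqP; split=> t; rewrite /D /= in_itv.
have mD : measurable D by rewrite DE; exact: measurable_itv.
(* A pole at the origin cancels in n(t) - n(0); it is counted by the term n(0) log r. *)
pose F b t := (if b == 0 then 0 else if cabs b <= t then t^-1 else 0)%R%:E.
have -> : (\int[mu]_(t in D) ((npoles f t - npoles f 0) / t)%:E)%E =
   (\int[mu]_(t in D) \sum_(b <- B) F b t)%E.
  apply: eq_integral => t; rewrite inE /D /= => /andP[t0 tr].
  rewrite (npolesE df ff (le_lt_trans tr rr)) (npolesE df ff rho0).
  rewrite /F sumEFin; congr (_%:E).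
  rewrite !count_sumr -sumrB mulr_suml; apply: eq_bigr => b _.
  have [->|b0] := eqVneq b 0; first by rewrite cabs0 lexx ltW// subrr mul0r.
  have nb : 0 < cabs b by rewrite cabs_gt0.
  rewrite [cabs b <= 0]leNgt nb /= subr0.
  by case: ifP => _; rewrite ?mul1r ?mul0r.
rewrite ge0_integral_sum//; last 2 first.
- move=> b; apply/measurable_EFinP; case: eqP => _; first exact: measurable_cst.
  apply: (@measurable_funS _ _ _ _ (`]0, +oo[%classic : set (measurableTypeR R))) => //.
    by move=> t; rewrite /D /= in_itv /= andbT => /andP[].
  rewrite (_ : (fun _ => _) = (fun t => (\1_`[cabs b, +oo[ t : R) * t^-1)); last first.
    apply/funext => t; rewrite indicE.
    have -> : (t \in `[cabs b, +oo[%classic) = (cabs b <= t).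
      by apply/idP/idP; rewrite inE /= in_itv /= andbT.
    by case: leP; rewrite ?mul1r ?mul0r.
  apply: measurable_funM.
    by apply: measurable_funTS; apply: measurable_indic; exact: measurable_itv.
  apply: open_continuous_measurable_fun; first exact: interval_open.
  move=> t; rewrite inE /= in_itv /= andbT => t0.
  by apply: inv_continuous; rewrite gt_eqF.
- move=> b t; rewrite /D /= => /andP[t0 _]; rewrite /F lee_fin.
  by case: ifP => // _; case: ifP => // _; rewrite invr_ge0 ltW.
rewrite (_ : (\sum_(k <- B) _)%E =
   (\sum_(b <- B) (if b == 0 then 0 else if cabs b <= r then ln (r / cabs b) else 0))%:E); last first.
  rewrite -sumEFin; apply: eq_bigr => b _; rewrite /F.
  have [_|b0] := eqVneq b 0; first by rewrite integral0.
  by rewrite integral_step_inv// cabs_gt0.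
rewrite /= (npolesE df ff rho0) count_sumr mulr_suml.
rewrite -big_split; apply: eq_bigr => b _; rewrite /wt /=.
have [->|b0] := eqVneq b 0; first by rewrite cabs0 lexx add0r mul1r.
by rewrite [cabs b <= 0]leNgt cabs_gt0 b0 /= mul0r addr0.
Qed.

End Counting.

(** * Means of real functions over a circle *)

Section RealMeans.
Variable R : realType.
Local Notation C := (Cplx R).
Local Notation mu := (@lebesgue_measure R).
Implicit Types (u v : R -> R) (r t : R) (a z : C).

Lemma rmeanD u v : rintegrable u -> rintegrable v ->
  rmean (fun t => u t + v t) = rmean u + rmean v.
Proof. by move=> iu iv; rewrite /rmean RintegralD// mulrDr. Qed.

Lemma rmeanB u v : rintegrable u -> rintegrable v ->
  rmean (fun t => u t - v t) = rmean u - rmean v.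
Proof. by move=> iu iv; rewrite /rmean RintegralB// mulrBr. Qed.

Lemma rmeanZ (k : R) u : rintegrable u -> rmean (fun t => k * u t) = k * rmean u.
Proof. by move=> iu; rewrite /rmean RintegralZl// mulrCA. Qed.

Lemma rintegrableD u v : rintegrable u -> rintegrable v -> rintegrable (fun t => u t + v t).
Proof. by move=> iu iv; apply: (@integrableD _ _ R mu `[0, 2 * pi] _ _ _ iu iv). Qed.

Lemma rintegrableZ (k : R) u : rintegrable u -> rintegrable (fun t => k * u t).
Proof. by move=> iu; apply: (@integrableZl _ _ R mu `[0, 2 * pi] _ k _ iu). Qed.

Lemma rintegrableB u v : rintegrable u -> rintegrable v -> rintegrable (fun t => u t - v t).
Proof.
move=> iu iv; have := rintegrableD iu (rintegrableZ (-1) iv).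
by under eq_fun do rewrite mulN1r.
Qed.

Lemma rintegrable_sum (I : Type) (s : seq I) (u : I -> R -> R) :
  (forall i, rintegrable (u i)) -> rintegrable (fun t => \sum_(i <- s) u i t).
Proof.
move=> iu; elim: s => [|i s IH].
  by under eq_fun do rewrite big_nil; exact: rintegrable_cst.
by under eq_fun do rewrite big_cons; exact: rintegrableD.
Qed.

Lemma rmean_sum (I : Type) (s : seq I) (u : I -> R -> R) :
  (forall i, rintegrable (u i)) ->
  rmean (fun t => \sum_(i <- s) u i t) = \sum_(i <- s) rmean (u i).
Proof.
move=> iu; elim: s => [|i s IH].
  by rewrite big_nil; under [X in rmean X]eq_fun do rewrite big_nil; exact: rmean_cst.
rewrite big_cons -IH -rmeanD//; last exact: rintegrable_sum.
by under [X in rmean X]eq_fun do rewrite big_cons.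
Qed.

Lemma rintegrable_abs u : rintegrable u -> rintegrable (fun t => `|u t|).
Proof. by move=> iu; apply: (integrable_norm iu). Qed.

Lemma rintegrable_measurable u : rintegrable u -> measurable_fun `[0, 2 * pi] u.
Proof. by move=> /measurable_int /measurable_EFinP. Qed.

Lemma rmean_le u v : rintegrable u -> rintegrable v ->
  (forall t, 0 <= t <= 2 * pi -> u t <= v t) -> rmean u <= rmean v.
Proof.
move=> iu iv uv; rewrite /rmean ler_wpM2l ?invr_ge0 ?(ltW (twopi_gt0 R))//.
by apply: le_Rintegral => // t /=; rewrite in_itv /=; exact: uv.
Qed.

Lemma rmean_ge0 u : (forall t, 0 <= t <= 2 * pi -> 0 <= u t) -> 0 <= rmean u.
Proof.
move=> u0; rewrite /rmean mulr_ge0 ?invr_ge0 ?(ltW (twopi_gt0 R))//.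
by apply: Rintegral_ge0 => t /=; rewrite in_itv /=; exact: u0.
Qed.

Definition hits r (Z : seq C) : set R := [set t | 0 <= t <= 2 * pi /\ circ 0 r t \in Z].

Lemma finite_hits r Z : 0 < r -> finite_set (hits r Z).
Proof.
move=> r0; elim: Z => [|a Z IH].
  by apply: (@sub_finite_set _ _ set0) => //; move=> t [].
apply: (@sub_finite_set _ _ ([set t | 0 <= t <= 2 * pi /\ circ 0 r t = a] `|` hits r Z)).
  by move=> t [t0]; rewrite in_cons => /orP[/eqP ta|tZ]; [left|right].
rewrite finite_setU; split => //.
have cosE t : circ 0 r t = a -> cos t = cre a / r.
  by move=> <-; rewrite /circ /eit creD creM /= mul0r subr0 add0r mulrC mulKf// gt_eqF.
have half (S : set R) : (forall s t, S s -> S t -> s = t) -> finite_set S.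
  move=> H; have [[s Ss]|N] := pselect (exists s, S s).
    by apply: (@sub_finite_set _ _ [set s]) => // t St; rewrite /=; exact: H.
  by apply: (@sub_finite_set _ _ set0) => // t St; apply: N; exists t.
pose S1 := [set t : R | 0 <= t <= pi /\ circ 0 r t = a].
pose S2 := [set t : R | pi <= t <= 2 * pi /\ circ 0 r t = a].
apply: (@sub_finite_set _ _ (S1 `|` S2)).
  move=> t [/andP[t0 t2] ta]; have [tp|pt] := leP t pi; first by left; rewrite /S1 /= t0.
  by right; rewrite /S2 /= (ltW pt).
rewrite finite_setU; split; apply: half => s t [s0 /cosE sa] [t0 /cosE ta].
  by apply: cos_inj; rewrite ?in_itv//= sa.
(* The cosine is injective on [[0, pi]]; this reflection carries the second half of the circle
   there. *)
have refl (x : R) : cos (2 * pi - x) = cos x.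
  rewrite mulr_natl cosB cos2pi sin2pi mul1r mul0r addr0//.
suff : 2 * pi - s = 2 * pi - t by lra.
by apply: cos_inj; rewrite ?in_itv /= ?refl ?sa//; lra.
Qed.

Lemma hits_measurable r Z : 0 < r -> measurable (hits r Z : set (measurableTypeR R)).
Proof.
move=> r0; apply: countable_measurable; first by move=> t; exact: measurable_set1.
by apply: finite_set_countable; exact: finite_hits.
Qed.

Lemma hits_null r Z : 0 < r -> mu (hits r Z) = 0%E.
Proof.
move=> r0; apply: countable_lebesgue_measure0; apply: finite_set_countable.
exact: finite_hits.
Qed.

Lemma rmean_hits r Z u : 0 < r -> rintegrable u ->
  rmean u = (2 * pi)^-1 * \int[mu]_(t in `[0, 2 * pi] `\` hits r Z) u t.
Proof.
move=> r0 iu; rewrite /rmean /Rintegral; congr (_ * fine _).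
apply: negligible_integral => //; [exact: hits_measurable|exact: hits_null].
Qed.

Lemma rmean_le_ae r (Z : seq C) u v : 0 < r -> rintegrable u -> rintegrable v ->
  (forall t, 0 <= t <= 2 * pi -> circ 0 r t \notin Z -> u t <= v t) ->
  rmean u <= rmean v.
Proof.
move=> r0 iu iv uv; rewrite (rmean_hits Z r0 iu) (rmean_hits Z r0 iv).
rewrite ler_wpM2l ?invr_ge0 ?(ltW (twopi_gt0 R))//.
have mD : measurable (`[0, 2 * pi] `\` hits r Z : set (measurableTypeR R)).
  by apply: measurableD => //; exact: hits_measurable.
have sD : `[0, 2 * pi] `\` hits r Z `<=` `[0, 2 * pi]%classic by move=> t [].
apply: le_Rintegral => //.
- by apply: (@integrableS _ _ R mu `[0, 2 * pi]%classic).
- by apply: (@integrableS _ _ R mu `[0, 2 * pi]%classic).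
move=> t [] /=; rewrite in_itv /= => t0 nh; apply: uv => //.
by apply/negP => tZ; apply: nh.
Qed.

Lemma rmean_eq_ae r (Z : seq C) u v : 0 < r -> rintegrable u -> rintegrable v ->
  (forall t, 0 <= t <= 2 * pi -> circ 0 r t \notin Z -> u t = v t) ->
  rmean u = rmean v.
Proof.
move=> r0 iu iv uv; apply/eqP; rewrite eq_le.
by rewrite (rmean_le_ae (Z := Z) r0)// ?(rmean_le_ae (Z := Z) r0)// => t t0 h; rewrite uv.
Qed.

Lemma measurable_ae r (Z : seq C) u v : 0 < r -> measurable_fun `[0, 2 * pi] v ->
  (forall t, 0 <= t <= 2 * pi -> circ 0 r t \notin Z -> u t = v t) ->
  measurable_fun `[0, 2 * pi] u.
Proof.
move=> r0 mv uv.
have mH : measurable (hits r Z : set (measurableTypeR R)) by exact: hits_measurable.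
have mD : measurable (`[0, 2 * pi] `\` hits r Z : set (measurableTypeR R)).
  exact: measurableD.
have -> : `[0, 2 * pi]%classic = (`[0, 2 * pi] `\` hits r Z) `|` hits r Z.
  apply/seteqP; split=> t /=.
    by move=> h; have [?|?] := pselect (hits r Z t); [right|left].
  by move=> [[]//|[h _]]; rewrite in_itv.
apply/measurable_funU => //; split.
  apply: (@eq_measurable_fun _ _ _ _ _ v).
    move=> t; rewrite inE => -[/=]; rewrite in_itv /= => h nh; apply/esym/uv => //.
    by apply/negP => tZ; apply: nh.
  by apply: (measurable_funS (measurable_itv `[0, 2 * pi])) mv => // t [].
move=> _ Y mY; apply: countable_measurable; first by move=> t; exact: measurable_set1.
apply: (@sub_countable _ _ _ (hits r Z)).
  by apply: subset_card_le => t [].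
by apply: finite_set_countable; exact: finite_hits.
Qed.

End RealMeans.

(** * The logarithm of the modulus of a zero-free function *)

Section LogModulus.
Variable R : realType.
Local Notation C := (Cplx R).
Local Notation mu := (@lebesgue_measure R).
Implicit Types (r rho t : R) (a z w m : C) (h L : C -> C).

Lemma cabs_sqr z : cabs z ^+ 2 = cre z * cre z + cim z * cim z.
Proof.
by case: z => x y; rewrite /cabs /= sqr_sqrtr ?addr_ge0 ?sqr_ge0// !expr2.
Qed.

(** This form avoids differentiating a square root. It holds at [z = 0] too, because [ln 0 = 0]. *)
Lemma ln_cabs_half z : ln (cabs z) = 2^-1 * ln (cre z * cre z + cim z * cim z).
Proof.
rewrite -cabs_sqr; have [z0|z0] := leP (cabs z) 0.
  have -> : cabs z = 0 by apply/eqP; rewrite eq_le z0 cabs_ge0.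
  by rewrite expr0n /= ln0// mulr0.
by rewrite lnXn// -[ln _ *+ 2]mulr_natl mulrA mulVf ?mul1r.
Qed.

Lemma is_derive_ln_cabs (g : R -> C) t m : rder g t m -> g t != 0 ->
  is_derive t 1 (fun s => ln (cabs (g s))) (cre (m / g t)).
Proof.
move=> dg g0.
have [dx dy] := (rder_cre dg, rder_cim dg).
have n0 : 0 < cre (g t) * cre (g t) + cim (g t) * cim (g t).
  by rewrite -cabs_sqr exprn_gt0// cabs_gt0.
have -> : (fun s => ln (cabs (g s))) = (fun s => 2^-1 *
    ln (cre (g s) * cre (g s) + cim (g s) * cim (g s))).
  by apply/funext => s; rewrite ln_cabs_half.
have dl := is_derive1_ln n0.
pose q s := cre (g s) * cre (g s) + cim (g s) * cim (g s).
have dq : is_derive t 1 q (cre (g t) *: cre m + cre (g t) *: cre m +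
    (cim (g t) *: cim m + cim (g t) *: cim m)).
  exact: (is_deriveD (is_deriveM dx dx) (is_deriveM dy dy)).
have dc : is_derive t 1 (@ln R \o q) ((q t)^-1 * (cre (g t) *: cre m + cre (g t) *: cre m +
    (cim (g t) *: cim m + cim (g t) *: cim m))).
  exact: is_derive1_comp.
have dz : is_derive t 1 (fun s => 2^-1 * ln (q s)) _ := is_deriveZ 2^-1 dc.
apply: (is_derive_eq dz); rewrite /GRing.scale /=.
have q0 : q t != 0 by rewrite gt_eqF.
have -> : cre (m / g t) = (cre m * cre (g t) + cim m * cim (g t)) / q t.
  have -> : m / g t = m * cconj (g t) * rc (q t)^-1.
    have -> : (g t)^-1 = cconj (g t) * rc (q t)^-1; last by ring.
    apply: (mulfI g0); rewrite divff// mulrA (mulrC (g t)) mul_cconj cabs_sqr.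
    by rewrite -rcM divff.
  rewrite creM /= mulr0 subr0 creM; congr (_ * _).
  by case: (g t) => x y /=; rewrite mulrN opprK.
by field.
Qed.

(** A primitive of h'/h, shifted to agree at the origin, suffices since only real parts are
    compared: the difference has derivative 0 along each segment from 0. *)
Lemma holo_log h rho : 0 < rho ->
  (forall p, cabs p < rho -> (exists a, cder h p a) /\ h p != 0) ->
  exists2 L, holo_disc L 0 rho & forall z, cabs z < rho -> ln (cabs (h z)) = cre (L z).
Proof.
move=> rho0 H.
have hh : holo_disc h 0 rho by move=> z; rewrite subr0 => /H[].
have [h' dh hh'] := holo_deriv hh.
pose G z := h' z * (h z)^-1.
have c0 : cabs (0 - 0 : C) < rho by rewrite subrr cabs0.
have hG : holo_disc G 0 rho.
  move=> z hz; apply: ex_cderM; first exact: hh'.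
  by apply: ex_cderV; [move: hz; rewrite subr0 => /H[]|exact: hh].
have [L0 dL0] := primitive_disc c0 (holo_disc_ccont hG c0) (fun z hz _ => hG z hz).
exists (fun z => L0 z + rc (ln (cabs (h 0)) - cre (L0 0))).
  by move=> z /dL0 d; eexists; exact: cderD d (cder_cst _ _).
move=> z hz.
pose psi t := ln (cabs (h (lerp 0 z t))) - cre (L0 (lerp 0 z t)).
have dpsi t : 0 <= t <= 1 -> is_derive t 1 psi 0.
  move=> t01; have ht : cabs (lerp 0 z t - 0) < rho.
    apply: le_lt_trans (lerp_dist_max (M := cabs z) t01 _ _) hz.
      by rewrite subrr cabs0 cabs_ge0.
    by rewrite subr0.
  have hn : h (lerp 0 z t) != 0 by move: ht; rewrite subr0 => /H[].
  have d1 := rder_comp (rder_lerp 0 z t) (dh _ ht).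
  have d2 := is_derive_ln_cabs d1 hn.
  have d3 := rder_cre (rder_comp (rder_lerp 0 z t) (dL0 _ ht)).
  apply: (is_derive_eq (is_deriveB d2 d3)).
  rewrite /G -creB (_ : _ - _ = 0)//.
  by field.
have cz (t : R) : 0 <= t <= 1 -> {for t, continuous (fun=> 0 : R)}.
  by move=> _; exact: cst_continuous.
have := Rint_FTC ltr01 cz dpsi; rewrite /Rintegral integral0 /= /psi lerp0 lerp1.
move=> /esym/eqP; rewrite subr_eq0 => /eqP E.
by rewrite creD /= -E; ring.
Qed.

Lemma rmean_cre (g : R -> C) : rmean (fun t => cre (g t)) = cre (cmean g).
Proof. by rewrite /rmean /cmean creM /= mul0r subr0. Qed.

Lemma rintegrable_cre (g : R -> C) : pcont g -> rintegrable (fun t => cre (g t)).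
Proof. exact: integrable_cre. Qed.

Lemma circ0_neq0 r t : 0 < r -> circ 0 r t != 0.
Proof. by move=> r0; rewrite -cabs_gt0 -[circ 0 r t]subr0 (cabs_circ 0 t (ltW r0)). Qed.

Lemma cabs_circ0 r t : 0 <= r -> cabs (circ 0 r t) = r.
Proof. by move=> r0; rewrite -[circ 0 r t]subr0 (cabs_circ 0 t r0). Qed.

Lemma mean_log_holo h r rho : 0 < r < rho ->
  (forall p, cabs p < rho -> (exists a, cder h p a) /\ h p != 0) ->
  rintegrable (fun t => ln (cabs (h (circ 0 r t)))) /\
  rmean (fun t => ln (cabs (h (circ 0 r t)))) = ln (cabs (h 0)).
Proof.
move=> /andP[r0 rr] H; have rho0 := lt_trans r0 rr.
have [L hL E] := holo_log rho0 H.
have c0 : cabs (0 - 0 : C) < r by rewrite subrr cabs0.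
have circ_in t : cabs (circ 0 r t) < rho by rewrite cabs_circ0// ltW.
have PL : pcont (fun t => L (circ 0 r t)).
  by apply: pcont_comp => t; apply: (holo_disc_ccont hL); rewrite subr0.
under eq_fun do rewrite E//.
split; first exact: rintegrable_cre.
rewrite E ?cabs0// rmean_cre; congr cre.
rewrite -(cauchy_formula c0 rr hL); apply: cmean_ext => t.
by rewrite subr0 mulfK// circ0_neq0.
Qed.

(** By the reflection of [cmean_kernel], the conjugate integrand is holomorphic beyond the circle
    and vanishes at the centre. Added to Cauchy's formula, this replaces [L] on the circle by twice
    its real part. *)
Lemma cmean_conj_kernel L r rho z : 0 < r < rho -> holo_disc L 0 rho -> cabs z < r ->
  cmean (fun t => cconj (L (circ 0 r t)) * (z / (circ 0 r t - z))) = 0.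
Proof.
move=> /andP[r0 rr] hL zr.
have nz := cabs_ge0 z.
pose rho1 := 2 * r ^+ 2 / (r + cabs z).
have rz : 0 < r + cabs z by lra.
have rrho1 : r < rho1 by rewrite /rho1 ltr_pdivlMr// expr2; nra.
pose k := cconj z.
have den y : cabs y < rho1 -> rc (r ^+ 2) - k * y != 0.
  move=> hy; rewrite -cabs_gt0; have := cabs_lower (rc (r ^+ 2)) (k * y).
  rewrite cabs_rc ger0_norm ?exprn_ge0 ?(ltW r0)// cabsM cabs_conj => Hl.
  apply: lt_le_trans Hl; rewrite subr_gt0.
  move: hy; rewrite /rho1 ltr_pdivlMr// => hy.
  have := cabs_ge0 y; nra.
pose rho2 := Num.min rho rho1.
have hol : holo_disc (fun y => L y * (k / (rc (r ^+ 2) - k * y))) 0 rho2.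
  move=> y; rewrite lt_min => /andP[y1 y2]; apply: ex_cderM; first exact: hL.
  apply: ex_cderM; first by eexists; exact: cder_cst.
  apply: ex_cderV; first by apply: den; rewrite -[y]subr0.
  by eexists; exact: cderB (cder_cst _ _) (cderMl k (cder_id y)).
have r2 : 0 <= r < rho2 by rewrite lt_min rr rrho1 ltW.
have z0r : cabs (z - 0) < r by rewrite subr0.
have Pk : pcont (fun t => z / (circ 0 r t - z)).
  by apply: pcontM; [exact: pcont_cst|exact: pcont_kernel].
have PL : pcont (fun t => L (circ 0 r t)).
  apply: pcont_comp => t; apply: (holo_disc_ccont hL).
  by rewrite (cabs_circ 0 t (ltW r0)).
apply: (can_inj (@cconjK R)).
rewrite -cmean_conj; last by apply: pcontM => //; exact: pcont_conj.
have -> : cconj 0 = 0 :> C by exact: rmorph0.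
rewrite -[RHS](cauchy_zero_holo r2 hol); apply: cmean_ext => t.
have v0 := circ0_neq0 t r0; set v := circ 0 r t in v0 *.
have vv : cconj v * v = rc (r ^+ 2) by rewrite mul_cconj cabs_circ0// ltW.
rewrite !cconjM cconjK cconjV cconjB subr0 -/k -mulrA; congr (_ * _).
have cv0 : cconj v != 0 by rewrite -cabs_gt0 cabs_conj cabs_gt0.
have dv : rc (r ^+ 2) - k * v != 0.
  by apply: den; rewrite cabs_circ0// ltW.
rewrite -vv -mulrBl in dv *; move: dv; rewrite mulf_eq0 negb_or => /andP[dv _].
move: (cconj v) cv0 dv => V cv0 dv; clearbody v k; field.
by rewrite dv v0.
Qed.

(** A Poisson kernel estimate for differences: the kernel is v (z - z') / ((v - z) (v - z')) with
    |v| = r, so no value of log|h| at the centre enters. *)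
Lemma log_difference h r rho z z' : 0 < r < rho ->
  (forall p, cabs p < rho -> (exists a, cder h p a) /\ h p != 0) ->
  cabs z < r -> cabs z' < r ->
  `|ln (cabs (h z)) - ln (cabs (h z'))| <=
    2 * (r * cabs (z - z') / ((r - cabs z) * (r - cabs z'))) *
    rmean (fun t => `|ln (cabs (h (circ 0 r t)))|).
Proof.
move=> r0r H zr z'r; case/andP: (r0r) => r0 rr; have rho0 := lt_trans r0 rr.
have [L hL E] := holo_log rho0 H.
have circ_in t : cabs (circ 0 r t) < rho by rewrite cabs_circ0// ltW.
have PL : pcont (fun t => L (circ 0 r t)).
  by apply: pcont_comp => t; apply: (holo_disc_ccont hL); rewrite subr0.
rewrite !E ?(lt_trans _ rr)// -creB; apply: le_trans (cabs_re _) _.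
have z0r : cabs (z - 0) < r by rewrite subr0.
have z'0r : cabs (z' - 0) < r by rewrite subr0.
have Pk y : cabs (y - 0) < r -> pcont (fun t => y / (circ 0 r t - y)).
  by move=> hy; apply: pcontM; [exact: pcont_cst|exact: pcont_kernel].
have PLc := pcont_conj PL.
have kz := cmean_conj_kernel r0r hL zr; have kz' := cmean_conj_kernel r0r hL z'r.
pose u t := cre (L (circ 0 r t)).
pose K t := z / (circ 0 r t - z) - z' / (circ 0 r t - z').
(* Since v / (v - z) = 1 + z / (v - z), the constant terms of the two Cauchy formulas cancel and
   both summands carry the same kernel [K]. *)
have -> : L z - L z' = cmean (fun t => rc (2 * u t) * K t).
  transitivity (L z - L z' + (cmean (fun t => cconj (L (circ 0 r t)) * (z / (circ 0 r t - z))) -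
     cmean (fun t => cconj (L (circ 0 r t)) * (z' / (circ 0 r t - z'))))).
    by rewrite kz kz' subrr addr0.
  rewrite -(cauchy_formula z0r rr hL) -(cauchy_formula z'0r rr hL).
  have PLk y : cabs (y - 0) < r ->
      pcont (fun t => L (circ 0 r t) * (circ 0 r t - 0) / (circ 0 r t - y)).
    move=> hy; apply: pcontM; last exact: pcont_kernel.
    by apply: pcontM => //; apply: pcontB; [exact: pcont_circ|exact: pcont_cst].
  have PLck y : cabs (y - 0) < r ->
      pcont (fun t => cconj (L (circ 0 r t)) * (y / (circ 0 r t - y))).
    by move=> hy; apply: pcontM => //; exact: Pk.
  rewrite -!cmeanB; [|exact: PLck|exact: PLck|exact: PLk|exact: PLk].
  rewrite -cmeanD; [|by apply: pcontB; exact: PLk|by apply: pcontB; exact: PLck].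
  apply: cmean_ext => t; rewrite /K /u subr0.
  have n1 := circ_neq t r0 z0r; have n2 := circ_neq t r0 z'0r.
  have -> : rc (2 * cre (L (circ 0 r t))) = L (circ 0 r t) + cconj (L (circ 0 r t)).
    by rewrite mulr_natl mulr2n rcD; case: (L _) => x y; rewrite /rc /=;
      apply/eqP; rewrite eq_complex /= subrr addr0 !eqxx.
  by field; rewrite n1 n2.
have iu : rintegrable (fun t => `|u t|) by apply: rintegrable_abs; exact: rintegrable_cre.
have -> : (fun t => `|ln (cabs (h (circ 0 r t)))|) = (fun t => `|u t|).
  by apply/funext => t; rewrite E.
rewrite -rmeanZ//.
have Pu : pcont (fun t => rc (2 * u t)).
  have -> : (fun t => rc (2 * u t)) = fun t => L (circ 0 r t) + cconj (L (circ 0 r t)).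
    apply/funext => t; rewrite /u mulr_natl mulr2n rcD; case: (L _) => x y; rewrite /rc /=.
    by apply/eqP; rewrite eq_complex /= subrr addr0 !eqxx.
  exact: pcontD.
apply: cabs_cmean.
- apply: pcontM => //; apply: pcontB; exact: Pk.
- exact: rintegrableZ.
move=> t _; rewrite cabsM cabs_rc normrM ger0_norm// -!mulrA.
rewrite ler_wpM2l// mulrC [leRHS](_ : _ =
  (r * cabs (z - z') / ((r - cabs z) * (r - cabs z'))) * `|u t|); last by rewrite !mulrA.
rewrite ler_wpM2r//.
have n1 := circ_neq t r0 z0r; have n2 := circ_neq t r0 z'0r.
have -> : K t = circ 0 r t * (z - z') / ((circ 0 r t - z) * (circ 0 r t - z')).
  by rewrite /K; field; rewrite n1 n2.
rewrite cabsM cabsV !cabsM cabs_circ0 ?(ltW r0)//.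
rewrite ler_wpM2l ?mulr_ge0 ?cabs_ge0 ?(ltW r0)//.
have d1 : 0 < r - cabs z by rewrite subr_gt0.
have d2 : 0 < r - cabs z' by rewrite subr_gt0.
rewrite lef_pV2 ?posrE ?mulr_gt0 ?cabs_gt0//.
apply: ler_pM; rewrite ?(ltW d1) ?(ltW d2)//.
  by have := cabs_lower (circ 0 r t) z; rewrite (cabs_circ0 t (ltW r0)).
by have := cabs_lower (circ 0 r t) z'; rewrite (cabs_circ0 t (ltW r0)).
Qed.

End LogModulus.

(** * Circle means of log|z - a| *)

Section LogLinear.
Variable R : realType.
Local Notation C := (Cplx R).
Local Notation mu := (@lebesgue_measure R).
Implicit Types (r t : R) (a z : C) (u v : R -> R) (Z : seq C).

Lemma cabs_dist (x y : C) : `|cabs x - cabs y| <= cabs (x - y).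
Proof.
rewrite ler_norml; apply/andP; split; last exact: cabs_lower.
by have := cabs_lower y x; rewrite (cabsC y x); lra.
Qed.

Lemma integral_abs_hits r Z u : 0 < r -> measurable_fun `[0, 2 * pi] u ->
  (\int[mu]_(t in `[0%R, (2 * pi)%R]) `|(EFin \o u) t| =
   \int[mu]_(t in `[0%R, (2 * pi)%R] `\` hits r Z) `|(EFin \o u) t|)%E.
Proof.
move=> r0 mu_.
have mH : measurable (hits r Z : set (measurableTypeR R)) by exact: hits_measurable.
have mD : measurable (`[0, 2 * pi] `\` hits r Z : set (measurableTypeR R)).
  exact: measurableD.
have DE : `[0, 2 * pi]%classic = (`[0, 2 * pi] `\` hits r Z) `|` hits r Z.
  apply/seteqP; split=> t /=.
    by move=> h; have [?|?] := pselect (hits r Z t); [right|left].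
  by move=> [[]//|[h _]]; rewrite in_itv.
have mE : measurable_fun `[0, 2 * pi] (fun t => `|(EFin \o u) t|%E).
  by apply: measurableT_comp => //; exact/measurable_EFinP.
rewrite [in LHS]DE ge0_integral_setU//.
- rewrite [X in (_ + X)%E]null_set_integral ?adde0//; last exact: hits_null.
  by move: mE; rewrite {1}DE => /measurable_funU -[].
- by rewrite -DE.
- by apply/disj_setPS => t [[_ /= h1] h2].
Qed.

Lemma rintegrable_ae r Z u v : 0 < r -> rintegrable v ->
  (forall t, 0 <= t <= 2 * pi -> circ 0 r t \notin Z -> u t = v t) -> rintegrable u.
Proof.
move=> r0 iv uv; have mv := rintegrable_measurable iv.
have mu_ := measurable_ae r0 mv uv.
apply/integrableP; split; first exact/measurable_EFinP.
rewrite (integral_abs_hits Z r0 mu_).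
case/integrableP: iv => _; rewrite (integral_abs_hits Z r0 mv); apply: le_lt_trans.
rewrite le_eqVlt; apply/orP; left; apply/eqP; apply: eq_integral => t.
rewrite inE => -[/=]; rewrite in_itv /= => h nh; rewrite uv//.
by apply/negP => tZ; apply: nh.
Qed.

Lemma measurable_cabs_circ r a : measurable_fun setT (fun t => cabs (circ 0 r t - a)).
Proof.
apply: continuous_measurable_fun => t.
apply: continuous_epsP => e e0.
have [d d0 D] := @rcont_circ R 0 r t e e0; exists d => // s /D; apply: le_lt_trans.
apply: le_trans (cabs_dist _ _) _.
by rewrite (_ : _ - _ - _ = circ 0 r s - circ 0 r t)//; ring.
Qed.

Lemma mean_log_outside r a : 0 < r < cabs a ->
  rintegrable (fun t => ln (cabs (circ 0 r t - a))) /\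
  rmean (fun t => ln (cabs (circ 0 r t - a))) = ln (cabs a).
Proof.
move=> ra; have := @mean_log_holo R (fun z => z - a) r (cabs a) ra.
rewrite sub0r cabsN; apply => p hp; split; first by eexists; exact: cder_subr.
by rewrite subr_eq0; apply: contraTneq hp => ->; rewrite ltxx.
Qed.

(** On the circle |z - a| = |r - k z| with k the conjugate of a divided by r. The right-hand
    function is zero-free beyond the circle and takes the value [r] at 0. *)
Lemma mean_log_inside r a : 0 < r -> cabs a < r ->
  rintegrable (fun t => ln (cabs (circ 0 r t - a))) /\
  rmean (fun t => ln (cabs (circ 0 r t - a))) = ln r.
Proof.
move=> r0 ar; have na := cabs_ge0 a.
have rc0' : rc r != 0 by rewrite rc_eq0 gt_eqF.
pose k := cconj a / rc r.
have nk : cabs k = cabs a / r by rewrite cabsM cabs_conj cabsV cabs_rc gtr0_norm.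
pose rho := 2 * r ^+ 2 / (r + cabs a).
have ra : 0 < r + cabs a by lra.
have rrho : 0 < r < rho by rewrite r0 /rho ltr_pdivlMr// expr2; nra.
have := @mean_log_holo R (fun z => rc r - k * z) r rho rrho.
have -> : (fun t => ln (cabs (rc r - k * circ 0 r t))) = (fun t => ln (cabs (circ 0 r t - a))).
  apply/funext => t; congr ln.
  have vv : cconj (circ 0 r t) * circ 0 r t = rc (r ^+ 2).
    by rewrite mul_cconj cabs_circ0// ltW.
  have -> : rc r - k * circ 0 r t = cconj (circ 0 r t - a) * (circ 0 r t / rc r).
    rewrite cconjB /k; rewrite expr2 rcM in vv.
    transitivity (cconj (circ 0 r t) * circ 0 r t / rc r - cconj a / rc r * circ 0 r t).
      by rewrite vv; congr (_ - _); rewrite mulfK.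
    by ring.
  by rewrite cabsM cabs_conj cabsM cabsV cabs_circ0 ?ltW// cabs_rc gtr0_norm// divff ?mulr1// gt_eqF.
rewrite mulr0 subr0 cabs_rc gtr0_norm//; apply => p hp; split.
  by eexists; exact: cderB (cder_cst _ _) (cderMl k (cder_id p)).
rewrite -cabs_gt0; have := cabs_lower (rc r) (k * p).
rewrite cabs_rc gtr0_norm// cabsM nk; apply: lt_le_trans; rewrite subr_gt0.
rewrite mulrAC ltr_pdivrMr//.
move: hp; rewrite /rho ltr_pdivlMr// => hp.
by have := cabs_ge0 p; nra.
Qed.

(** The two sides differ by exactly (1 - s)^2 r^2. This compares a logarithm singular on the circle
    with one whose singularity has moved inside. *)
Lemma sqr_dist_scale r a t (s : R) : cabs a = r ->
  0 <= r -> s * cabs (circ 0 r t - a) ^+ 2 <= cabs (circ 0 r t - rc s * a) ^+ 2.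
Proof.
move=> ar r0; have E1 := cabs_sqr a; have E2 := cabs_sqr (circ 0 r t).
rewrite cabs_circ0// in E2; rewrite ar in E1.
rewrite !cabs_sqr !creB !cimB creM cimM -[cre (rc s)]/s -[cim (rc s)]/(0 : R).
rewrite !mul0r subr0 addr0.
set x := cre (circ 0 r t) in E2 *; set y := cim (circ 0 r t) in E2 *.
set x' := cre a in E1 *; set y' := cim a in E1 *.
have : 0 <= (1 - s) ^+ 2 * r ^+ 2 by rewrite mulr_ge0 ?sqr_ge0.
have -> : (1 - s) ^+ 2 * r ^+ 2 = (x * x + y * y) - s * (x * x + y * y) -
   s * (x' * x' + y' * y') + s ^+ 2 * (x' * x' + y' * y').
  by rewrite -E1 -E2; ring.
by move=> h; rewrite -subr_ge0; apply: le_trans h _; rewrite le_eqVlt; apply/orP; left; apply/eqP; ring.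
Qed.

(** The singular point is approached by the interior points [s n * a], whose means all equal log r.
    Fatou's lemma gives integrability and the lower bound; the upper bound comes from
    [sqr_dist_scale] with a scale close to 1. *)
Lemma mean_log_on r a : 0 < r -> cabs a = r ->
  rintegrable (fun t => ln (cabs (circ 0 r t - a))) /\
  rmean (fun t => ln (cabs (circ 0 r t - a))) = ln r.
Proof.
move=> r0 ar; have r2 : 0 < 2 * r by rewrite mulr_gt0.
(* Starting at 1/2 keeps [s 0] positive. *)
pose s n : R := 1 - n.+2%:R^-1.
have s01 n : 0 < s n < 1.
  rewrite /s subr_gt0 invf_lt1// ltr1n /= ltrBlDr ltrDl invr_gt0//.
have ins n : cabs (rc (s n) * a) < r.
  rewrite cabsM cabs_rc ar gtr0_norm; last by case/andP: (s01 n).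
  by rewrite -[ltRHS]mul1r ltr_pM2r//; case/andP: (s01 n).
(* Distances are at most 2 r, so this normalization gives the nonnegative functions that Fatou's
   lemma needs. *)
pose w t := - ln (cabs (circ 0 r t - a) / (2 * r)).
pose wn n t := - ln (cabs (circ 0 r t - rc (s n) * a) / (2 * r)).
have lnle (x : R) : x <= 1 -> 0 <= - ln x.
  move=> x1; have [x0|x0] := leP x 0; first by rewrite ln0 ?oppr0.
  by rewrite oppr_ge0 ln_le0.
have bnd t b : cabs b <= r -> cabs (circ 0 r t - b) / (2 * r) <= 1.
  move=> br; rewrite ler_pdivrMr// mul1r; have := cabsB (circ 0 r t) b.
  by rewrite (cabs_circ0 t (ltW r0)); lra.
have w0 t : 0 <= w t by apply: lnle; apply: bnd; rewrite ar.
have wn0 n t : 0 <= wn n t by apply: lnle; apply: bnd; exact: ltW.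
have pos n t : 0 < cabs (circ 0 r t - rc (s n) * a).
  by rewrite cabs_gt0; apply: circ_neq => //; rewrite subr0.
have wnE n : wn n = fun t => ln (2 * r) - ln (cabs (circ 0 r t - rc (s n) * a)).
  by apply/funext => t; rewrite /wn ln_div ?posrE// opprB.
have iwn n : rintegrable (wn n).
  rewrite wnE; apply: rintegrableB; first exact: rintegrable_cst.
  by have [] := mean_log_inside r0 (ins n).
have mwn n : rmean (wn n) = ln 2.
  have [il ml] := mean_log_inside r0 (ins n).
  rewrite wnE rmeanB//; last exact: rintegrable_cst.
  by rewrite rmean_cst ml lnM ?posrE// addrK.
have mw : measurable_fun setT w.
  apply: measurableT_comp => //; apply: measurableT_comp => //.
  by apply: measurable_funM => //; exact: measurable_cabs_circ.
pose Z := [:: a]; pose D' := `[0, 2 * pi] `\` hits r Z.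
have mH : measurable (hits r Z : set (measurableTypeR R)) by exact: hits_measurable.
have mD : measurable (D' : set (measurableTypeR R)) by exact: measurableD.
have Iwn n : (\int[mu]_(t in D') (wn n t)%:E = (2 * pi * ln 2)%:E)%E.
  rewrite -(@negligible_integral _ _ _ mu `[0, 2 * pi] (hits r Z) (EFin \o wn n))//.
  - rewrite -[LHS]fineK; last by apply: integrable_fin_num => //; exact: iwn.
    congr EFin; have := mwn n; rewrite /rmean /Rintegral => <-.
    by rewrite mulrA divff ?mul1r// gt_eqF// twopi_gt0.
  - exact: iwn.
  - exact: hits_null.
have cvgw t : D' t -> (wn n t)%:E @[n --> \oo] --> (w t)%:E.
  move=> [/= t0 nh]; rewrite in_itv /= in t0.
  have ta : 0 < cabs (circ 0 r t - a).
    rewrite cabs_gt0 subr_eq0; apply/eqP => ta; apply: nh; split => //.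
    by rewrite ta mem_head.
  apply: cvg_EFin; first by near=> n.
  apply: cvgN; have x0 : 0 < cabs (circ 0 r t - a) / (2 * r) by rewrite divr_gt0.
  apply: (@cvg_comp _ _ _ (fun n => cabs (circ 0 r t - rc (s n) * a) / (2 * r)) (@ln R)
    _ _ _ _ (continuous_ln x0)).
  apply: cvgMr_tmp; apply/cvgrPdist_lt => e e0; exists (Num.bound (r / e)) => // n /= nb.
  have re : 0 <= r / e by rewrite divr_ge0 ?ltW.
  have nS : 0 < n.+2%:R :> R by rewrite ltr0n.
  apply: (@le_lt_trans _ _ (r / n.+2%:R)).
    have -> : r / n.+2%:R = cabs ((circ 0 r t - rc (s n) * a) - (circ 0 r t - a)).
      have -> : (circ 0 r t - rc (s n) * a) - (circ 0 r t - a) = rc (n.+2%:R^-1) * a.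
        by rewrite /s rcB rc1; ring.
      by rewrite cabsM cabs_rc ar gtr0_norm ?invr_gt0// mulrC.
    by rewrite distrC; exact: cabs_dist.
  rewrite ltr_pdivrMr// mulrC -ltr_pdivrMr//; apply: lt_le_trans (archi_boundP re) _.
  by rewrite ler_nat; apply: leq_trans nb _; rewrite -addn2 leq_addr.
have Iw : (\int[mu]_(t in D') (w t)%:E <= (2 * pi * ln 2)%:E)%E.
  have := @fatou _ _ R mu D' mD (fun n t => (wn n t)%:E).
  have -> : (\int[mu]_(t in D') limn_einf (fun n => (wn n t)%:E) =
     \int[mu]_(t in D') (w t)%:E)%E.
    by apply: eq_integral => t; rewrite inE => /cvgw /cvg_limn_einf_sup[->].
  have -> : limn_einf (fun n => \int[mu]_(t in D') (wn n t)%:E)%E = (2 * pi * ln 2)%:E.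
    have -> : (fun n => \int[mu]_(t in D') (wn n t)%:E)%E = cst (2 * pi * ln 2)%:E.
      by apply/funext => n; rewrite Iwn.
    have cc : cst (2 * pi * ln 2)%:E @ \oo --> ((2 * pi * ln 2)%:E : \bar R) by exact: cvg_cst.
    by have [->] := cvg_limn_einf_sup cc.
  apply => n.
    apply/measurable_EFinP; have := rintegrable_measurable (iwn n).
    by apply: measurable_funS => // t [].
  by move=> t _; rewrite lee_fin.
have mwD : measurable_fun `[0, 2 * pi] w by apply: measurable_funTS.
have iw : rintegrable w.
  apply/integrableP; split; first exact/measurable_EFinP.
  rewrite (integral_abs_hits Z r0 mwD); apply: (@le_lt_trans _ _ (2 * pi * ln 2)%:E); last first.
    exact: ltry.
  apply: le_trans Iw; rewrite le_eqVlt; apply/orP; left; apply/eqP.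
  by apply: eq_integral => t _; rewrite /= ger0_norm.
have mw2 : rmean w <= ln 2.
  rewrite (rmean_hits Z r0 iw) -/D' mulrC ler_pdivrMr ?twopi_gt0// mulrC.
  have fI : (\int[mu]_(t in D') (w t)%:E)%E \is a fin_num.
    rewrite ge0_fin_numE; first by apply: le_lt_trans Iw _; exact: ltry.
    by apply: integral_ge0 => t _; rewrite lee_fin.
  by rewrite -lee_fin /Rintegral fineK.
pose u t := ln (cabs (circ 0 r t - a)).
have uw t : 0 <= t <= 2 * pi -> circ 0 r t \notin Z -> u t = ln (2 * r) - w t.
  rewrite inE -subr_eq0 -cabs_gt0 => _ h; rewrite /u /w ln_div ?posrE//; ring.
have iv : rintegrable (fun t => ln (2 * r) - w t).
  by apply: rintegrableB => //; exact: rintegrable_cst.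
have iu : rintegrable u by exact: rintegrable_ae r0 iv uw.
split=> //; apply/eqP; rewrite eq_le; apply/andP; split; last first.
  rewrite (rmean_eq_ae r0 iu iv uw) rmeanB//; last exact: rintegrable_cst.
  by rewrite rmean_cst lnM ?posrE//; lra.
apply/ler_addgt0Pl => e e0.
(* Taking logarithms in q |z - a|^2 <= |z - q a|^2 then gives log|z - a| <= e + log|z - q a|. *)
pose q : R := expR (- (2 * e)).
have q0 : 0 < q by exact: expR_gt0.
have q1 : q < 1 by rewrite -expR0 ltr_expR oppr_lt0 mulr_gt0.
have qa : cabs (rc q * a) < r by rewrite cabsM cabs_rc ar gtr0_norm// -[ltRHS]mul1r ltr_pM2r.
have [il ml] := mean_log_inside r0 qa.
apply: (@le_trans _ _ (rmean (fun t => e + ln (cabs (circ 0 r t - rc q * a))))); last first.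
  by rewrite rmeanD ?rmean_cst ?ml//; exact: rintegrable_cst.
apply: (rmean_le_ae (Z := Z) r0 iu); first by apply: rintegrableD => //; exact: rintegrable_cst.
move=> t t0; rewrite inE -subr_eq0 -cabs_gt0 => h.
have h' : 0 < cabs (circ 0 r t - rc q * a).
  by rewrite cabs_gt0; apply: circ_neq => //; rewrite subr0.
have := @sqr_dist_scale r a t q ar (ltW r0).
rewrite -ler_ln ?posrE ?mulr_gt0 ?exprn_gt0// lnM ?posrE ?exprn_gt0//.
have -> : ln q = - (2 * e) by rewrite expRK.
by rewrite !lnXn// /u -/q !mulr2n; lra.
Unshelve. all: by end_near.
Qed.

Lemma mean_log_sub r a : 0 < r ->
  rintegrable (fun t => ln (cabs (circ 0 r t - a))) /\ rmean (fun t => ln (cabs (circ 0 r t - a))) = ln (Num.max r (cabs a)).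
Proof.
move=> r0; have [ra|ar|/esym ra] := ltgtP r (cabs a).
- by apply: mean_log_outside; rewrite r0.
- exact: mean_log_inside.
- exact: mean_log_on.
Qed.

(** The normalized distance x is at most 2 and log x has mean 0; hence |log x| <= 2 log 2 - log x
    integrates to a bound independent of [r] and [a]. *)
Lemma mean_abs_log_sub r a : 0 < r ->
  rintegrable (fun t => `|ln (cabs (circ 0 r t - a) / Num.max r (cabs a))|) /\ rmean (fun t => `|ln (cabs (circ 0 r t - a) / Num.max r (cabs a))|) <= 2 * ln 2.
Proof.
move=> r0; have [il ml] := mean_log_sub a r0; set M := Num.max r (cabs a) in ml *.
have M0 : 0 < M by rewrite lt_max r0.
have eqn t : 0 <= t <= 2 * pi -> circ 0 r t \notin [:: a] ->
    ln (cabs (circ 0 r t - a) / M) = ln (cabs (circ 0 r t - a)) - ln M.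
  by move=> _; rewrite inE -subr_eq0 -cabs_gt0 => h; rewrite ln_div ?posrE.
have i1 : rintegrable (fun t => ln (cabs (circ 0 r t - a)) - ln M).
  by apply: rintegrableB => //; exact: rintegrable_cst.
have i2 : rintegrable (fun t => ln (cabs (circ 0 r t - a) / M)).
  exact: rintegrable_ae r0 i1 eqn.
split; first exact: rintegrable_abs.
apply: (@le_trans _ _ (rmean (fun t => 2 * ln 2 - ln (cabs (circ 0 r t - a) / M)))).
  apply: rmean_le; first exact: rintegrable_abs.
    by apply: rintegrableB => //; exact: rintegrable_cst.
  move=> t _; set x := cabs _ / M.
  have x2 : x <= 2.
    rewrite ler_pdivrMr//; have := cabsB (circ 0 r t) a.
    have : r <= M by rewrite le_max lexx.
    have : cabs a <= M by rewrite le_max lexx orbT.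
    by rewrite (cabs_circ0 t (ltW r0)); lra.
  have l2 : ln x <= ln 2.
    have [x0|x0] := leP x 0; first by rewrite ln0// ln_ge0// ler1n.
    by rewrite ler_ln ?posrE.
  have l20 : 0 <= ln (2 : R) by rewrite ln_ge0// ler1n.
  by rewrite ler_norml; apply/andP; split; lra.
rewrite rmeanB//; last exact: rintegrable_cst.
rewrite rmean_cst (rmean_eq_ae r0 i2 i1 eqn) rmeanB//; last exact: rintegrable_cst.
by rewrite rmean_cst ml subrr subr0.
Qed.

End LogLinear.

(** * Jensen's formula and the first main theorem *)

Section Jensen.
Variable R : realType.
Local Notation C := (Cplx R).
Local Notation mu := (@lebesgue_measure R).
Implicit Types (r rho t : R) (a b z w : C) (f h : C -> C) (A B Z : seq C).

Lemma mproxE f r : mprox f r = rmean (fun t => Num.max 0 (ln (cabs (f (circ 0 r t))))).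
Proof.
rewrite /mprox /rmean /Rintegral /logplus; congr (_ * fine _).
have -> : [set th : R | 0 <= th <= 2 * pi] = `[0, 2 * pi]%classic.
  by apply/seteqP; split=> t; rewrite /= in_itv.
apply: eq_integral => t _; congr (_%:E); congr (Num.max 0 (ln (cabs (f _)))).
by rewrite /circ add0r /rc /eit; apply/eqP; rewrite eq_complex /= !mul0r subr0 addr0 !eqxx.
Qed.

Definition logfac A B h z : R :=
  \sum_(a <- A) ln (cabs (z - a)) - \sum_(b <- B) ln (cabs (z - b)) + ln (cabs (h z)).

Lemma ln_prod (s : seq C) z : z \notin s ->
  0 < \prod_(b <- s) cabs (z - b) /\
  ln (\prod_(b <- s) cabs (z - b)) = \sum_(b <- s) ln (cabs (z - b)).
Proof.
elim: s => [|b s IH]; first by rewrite !big_nil ln1.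
rewrite in_cons negb_or => /andP[zb /IH[p0 E]]; rewrite !big_cons.
have z0 : 0 < cabs (z - b) by rewrite cabs_gt0 subr_eq0.
by split; [rewrite mulr_gt0|rewrite lnM ?posrE// E].
Qed.

Lemma log_factored f kf lf rho A B h z : factored f kf lf rho A B h -> cabs z < rho ->
  z \notin A ++ B -> ln (cabs (f z)) = logfac A B h z /\ f z != 0.
Proof.
move=> [F1 F2 F3 F4] hz; rewrite mem_cat negb_or => /andP[zA zB].
have [pA EA] := ln_prod zA; have [pB EB] := ln_prod zB.
have [_ hn] := F1 z hz; have h0 : 0 < cabs (h z) by rewrite cabs_gt0.
have E : cabs (f z) * \prod_(b <- B) cabs (z - b) =
   \prod_(a <- A) cabs (z - a) * cabs (h z).
  by rewrite -!cabs_prod -!cabsM F4.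
have f0 : 0 < cabs (f z).
  by rewrite -(pmulr_lgt0 _ pB) E mulr_gt0.
split; last by rewrite -cabs_gt0.
rewrite /logfac -EA -EB; have := congr1 (@ln R) E.
by rewrite !lnM ?posrE//; lra.
Qed.

Lemma mean_log_scaled r a w : 0 < r -> w != 0 ->
  rintegrable (fun t => ln (cabs (w * circ 0 r t - a))) /\
  rmean (fun t => ln (cabs (w * circ 0 r t - a))) = ln (Num.max (cabs w * r) (cabs a)).
Proof.
move=> r0 w0; have [il ml] := mean_log_sub (a / w) r0.
have nw : 0 < cabs w by rewrite cabs_gt0.
have E t : 0 <= t <= 2 * pi -> circ 0 r t \notin [:: a / w] ->
   ln (cabs (w * circ 0 r t - a)) = ln (cabs w) + ln (cabs (circ 0 r t - a / w)).
  move=> _; rewrite inE -subr_eq0 -cabs_gt0 => h.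
  rewrite -lnM ?posrE// -cabsM; congr (ln (cabs _)); field; exact: w0.
have i1 : rintegrable (fun t => ln (cabs w) + ln (cabs (circ 0 r t - a / w))).
  by apply: rintegrableD => //; exact: rintegrable_cst.
have i2 := rintegrable_ae r0 i1 E; split=> //.
rewrite (rmean_eq_ae r0 i2 i1 E) rmeanD//; last exact: rintegrable_cst.
rewrite rmean_cst ml -lnM ?posrE//; last by rewrite lt_max r0.
by rewrite maxr_pMr ?(ltW nw)// cabsM cabsV mulrCA divff ?mulr1// gt_eqF.
Qed.

Lemma rintegrable_log_h h rho r w : (forall p, cabs p < rho -> (exists a, cder h p a) /\ h p != 0) ->
  0 < r -> cabs w * r < rho -> rintegrable (fun t => ln (cabs (h (w * circ 0 r t)))).
Proof.
move=> H r0 wr.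
have rho0 : 0 < rho by apply: le_lt_trans wr; rewrite mulr_ge0 ?cabs_ge0 ?ltW.
have [L hL E] := holo_log rho0 H.
have cin t : cabs (w * circ 0 r t) < rho by rewrite cabsM cabs_circ0// ltW.
under eq_fun do rewrite E//.
apply: rintegrable_cre => t _.
apply: (@rcont_comp _ L (fun t => w * circ 0 r t)).
  by apply: rcontM; [exact: rcont_cst|exact: rcont_circ].
by apply: (holo_disc_ccont hL); rewrite subr0.
Qed.

Lemma rintegrable_logfac f kf lf rho A B h r w : factored f kf lf rho A B h ->
  0 < r -> w != 0 -> cabs w * r < rho ->
  rintegrable (fun t => logfac A B h (w * circ 0 r t)).
Proof.
move=> [F1 F2 F3 F4] r0 w0 wr.
apply: rintegrableD; last exact: rintegrable_log_h F1 r0 wr.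
by apply: rintegrableB; apply: rintegrable_sum => a; have [] := mean_log_scaled a r0 w0.
Qed.

Lemma log_factored_circ f kf lf rho A B h r w t : factored f kf lf rho A B h ->
  0 < r -> w != 0 -> cabs w * r < rho ->
  circ 0 r t \notin [seq a / w | a <- A ++ B] ->
  ln (cabs (f (w * circ 0 r t))) = logfac A B h (w * circ 0 r t) /\
  f (w * circ 0 r t) != 0.
Proof.
move=> F r0 w0 wr tZ; apply: log_factored F _ _.
  by rewrite cabsM cabs_circ0// ltW.
apply: contra tZ => zA; apply/mapP; exists (w * circ 0 r t) => //.
by rewrite mulrC mulKf.
Qed.

Lemma rintegrable_log f kf lf rho A B h r w : factored f kf lf rho A B h ->
  0 < r -> w != 0 -> cabs w * r < rho ->
  rintegrable (fun t => ln (cabs (f (w * circ 0 r t)))).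
Proof.
move=> F r0 w0 wr; apply: (rintegrable_ae r0 (rintegrable_logfac F r0 w0 wr)).
by move=> t t0 tZ; have [] := log_factored_circ F r0 w0 wr tZ.
Qed.

Lemma rintegrable_log1 f kf lf rho A B h r : factored f kf lf rho A B h ->
  0 < r < rho -> rintegrable (fun t => ln (cabs (f (circ 0 r t)))).
Proof.
move=> F /andP[r0 rr]; have := @rintegrable_log f kf lf rho A B h r 1 F r0 (oner_neq0 _).
by rewrite cabs1 mul1r => /(_ rr); under eq_fun do rewrite mul1r.
Qed.

Lemma ln_max_wt r a : 0 < r -> ln (Num.max r (cabs a)) = wt r a + ln (cabs a).
Proof.
move=> r0; rewrite /wt; have [->|a0] := eqVneq a 0.
  (* The convention [ln 0 = 0] makes the formula correct for a zero or pole at the origin. *)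
  by rewrite cabs0 max_l ?(ltW r0)// [ln 0]ln0// addr0.
have na : 0 < cabs a by rewrite cabs_gt0.
by case: leP => h; rewrite ?add0r// ln_div ?posrE// subrK.
Qed.

(** Term by term integration of [logfac]. The bracket depends on the factorization but not on [r],
    so it drops out when two radii are compared. *)
Lemma jensen f kf lf rho A B h r : factored f kf lf rho A B h -> 0 < r < rho ->
  rmean (fun t => ln (cabs (f (circ 0 r t)))) = NS A r - NS B r +
    (\sum_(a <- A) ln (cabs a) - \sum_(b <- B) ln (cabs b) + ln (cabs (h 0))).
Proof.
move=> F rr; case/andP: (rr) => r0 rrho.
have i1 := rintegrable_log1 F rr.
have i2 : rintegrable (fun t => logfac A B h (circ 0 r t)).
  have := rintegrable_logfac F r0 (oner_neq0 _); rewrite cabs1 mul1r => /(_ rrho).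
  by under eq_fun do rewrite mul1r.
rewrite (rmean_eq_ae (Z := A ++ B) r0 i1 i2); last first.
  move=> t t0 tZ; have [] := log_factored F _ tZ => //.
  by rewrite cabs_circ0// ltW.
have is_ (s : seq C) : rintegrable (fun t => \sum_(a <- s) ln (cabs (circ 0 r t - a))).
  by apply: rintegrable_sum => a; have [] := mean_log_sub a r0.
have ms (s : seq C) : rmean (fun t => \sum_(a <- s) ln (cabs (circ 0 r t - a))) =
    NS s r + \sum_(a <- s) ln (cabs a).
  rewrite rmean_sum; last by move=> a; have [] := mean_log_sub a r0.
  rewrite /NS -big_split; apply: eq_bigr => a _ /=.
  by have [_ ->] := mean_log_sub a r0; rewrite ln_max_wt.
case: F => F1 _ _ _; have [ih mh] := mean_log_holo rr F1.
rewrite /logfac rmeanD//; last exact: rintegrableB.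
by rewrite rmeanB// !ms mh; ring.
Qed.

(** Multiplicities come from the divisor, so factorizations on different discs agree, up to order,
    on any region common to both. *)
Lemma factored_perm f kf lf rho A B h rho' A' B' h' (P : pred C) :
  factored f kf lf rho A B h -> factored f kf lf rho' A' B' h' ->
  (forall p, P p -> cabs p < rho /\ cabs p < rho') ->
  perm_eq [seq a <- A | P a] [seq a <- A' | P a] /\
  perm_eq [seq b <- B | P b] [seq b <- B' | P b].
Proof.
move=> [_ F2 _ _] [_ F2' _ _] HP.
have cnt (s s' : seq C) : (forall p, P p -> count_mem p s = count_mem p s') ->
    perm_eq [seq a <- s | P a] [seq a <- s' | P a].
  move=> H; apply/allP => p _ /=; rewrite !count_filter; apply/eqP.
  have [Pp|nP] := boolP (P p).
    have E (l : seq C) : count (predI (pred1 p) P) l = count_mem p l.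
      by apply: eq_count => q /=; case: eqP => // ->; rewrite Pp.
    by rewrite !E H.
  have E (l : seq C) : count (predI (pred1 p) P) l = 0%N.
    rewrite (@eq_count _ _ pred0) ?count_pred0// => q /=.
    by case: eqP => // ->; rewrite (negPf nP).
  by rewrite !E.
split; apply: cnt => p /HP[h1 h2].
  by rewrite (F2 p h1).1 (F2' p h2).1.
by rewrite (F2 p h1).2 (F2' p h2).2.
Qed.

Lemma wt_gt r a : r < cabs a -> 0 < r -> wt r a = 0.
Proof.
move=> ra r0; rewrite /wt.
have -> : (a == 0) = false by apply/negbTE; rewrite -cabs_gt0 (lt_trans r0).
by rewrite leNgt ra.
Qed.

Lemma NS_filter s r : 0 < r -> NS s r = NS [seq a <- s | cabs a <= r] r.
Proof.
move=> r0; rewrite /NS big_filter [RHS]big_mkcond; apply: eq_bigr => a _.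
by case: leP => // ra; rewrite wt_gt.
Qed.

Lemma NS_indep f kf lf rho A B h rho' A' B' h' r :
  factored f kf lf rho A B h -> factored f kf lf rho' A' B' h' ->
  0 < r -> r < rho -> r < rho' -> NS A r = NS A' r /\ NS B r = NS B' r.
Proof.
move=> F F' r0 h1 h2.
have [|pA pB] := @factored_perm _ _ _ _ _ _ _ _ _ _ _ (fun a => cabs a <= r) F F'.
  by move=> p pr; split; exact: le_lt_trans pr _.
by rewrite (NS_filter A)// (NS_filter A')// (NS_filter B)// (NS_filter B')//; split;
  rewrite /NS; apply: perm_big.
Qed.

(** The proximity function of 1/f. *)
Definition mneg f r := rmean (fun t => Num.max 0 (- ln (cabs (f (circ 0 r t))))).

Lemma max0E (x : R) : Num.max 0 x = 2^-1 * (x + `|x|).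
Proof.
by case: (leP 0 x) => h; rewrite ?(ger0_norm h) ?(ltr0_norm h); lra.
Qed.

Lemma rintegrable_max0 (u : R -> R) : rintegrable u -> rintegrable (fun t => Num.max 0 (u t)).
Proof.
move=> iu; under eq_fun do rewrite max0E.
by apply: rintegrableZ; apply: rintegrableD => //; exact: rintegrable_abs.
Qed.

Lemma mprox_mneg f kf lf rho A B h r : factored f kf lf rho A B h -> 0 < r < rho ->
  mprox f r - mneg f r = rmean (fun t => ln (cabs (f (circ 0 r t)))) /\
  mprox f r + mneg f r = rmean (fun t => `|ln (cabs (f (circ 0 r t)))|).
Proof.
move=> F rr; have iu := rintegrable_log1 F rr; rewrite mproxE /mneg.
set u := fun t => ln (cabs (f (circ 0 r t))) in iu *.
have i1 := rintegrable_max0 iu.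
have iN : rintegrable (fun t => - u t).
  by have := rintegrableZ (-1) iu; under eq_fun do rewrite mulN1r.
have i2 := rintegrable_max0 iN.
rewrite -rmeanB// -rmeanD//; split; congr rmean; apply/funext => t.
  by rewrite /u !max0E normrN; lra.
by rewrite !max0E normrN; lra.
Qed.

Lemma mneg_ge0 f r : 0 <= mneg f r.
Proof. by apply: rmean_ge0 => t _; rewrite le_max lexx. Qed.

Lemma mprox_ge0 f r : 0 <= mprox f r.
Proof. by rewrite mproxE; apply: rmean_ge0 => t _; rewrite le_max lexx. Qed.

Lemma wt_ge0 r a : 1 <= r -> 0 <= wt r a.
Proof.
move=> r1; rewrite /wt; case: eqP => [_|/eqP a0]; first exact: ln_ge0.
case: ifP => // ar; apply: ln_ge0.
by rewrite ler_pdivlMr ?mul1r// cabs_gt0.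
Qed.

Lemma NS_ge0 s r : 1 <= r -> 0 <= NS s r.
Proof. by move=> r1; apply: sumr_ge0 => a _; exact: wt_ge0. Qed.

(** Jensen's formula at [r] and at 1 in the same factorization eliminates the constant at the
    origin. What remains at radius 1 is read off a fixed factorization in |z| < 2, so [Cf] does not
    depend on [rho]. *)
Theorem first_main f kf lf : divisor f kf lf -> exists Cf : R,
  forall rho A B h r, factored f kf lf rho A B h -> 1 <= r < rho ->
  mneg f r + NS A r = Tchar f r + Cf /\ Tchar f r = mprox f r + NS B r.
Proof.
move=> df; have [A1 [B1 [h1 F1]]] := factorization 2 df.
pose u1 := rmean (fun t => ln (cabs (f (circ 0 1 t)))).
exists (NS A1 1 - NS B1 1 - u1) => rho A B h r F /andP[r1 rr].
have r0 : 0 < r := lt_le_trans ltr01 r1.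
have rr0 : 0 < r < rho by rewrite r0.
have rho1 : 1 < rho := le_lt_trans r1 rr.
have TE : Tchar f r = mprox f r + NS B r by rewrite /Tchar (NcountE df F rr0).
split=> //; rewrite TE.
have [mm _] := mprox_mneg F rr0.
have J := jensen F rr0; rewrite -mm in J.
have one0 : 0 < (1 : R) < rho by rewrite ltr01 rho1.
have J1 := jensen F one0; rewrite -/u1 in J1.
have l12 : 1 < 2 :> R by rewrite ltr1n.
have [EA EB] := NS_indep F F1 ltr01 rho1 l12.
by rewrite -EA -EB; lra.
Qed.

Lemma count_NS s r t : 1 <= t <= r ->
  (count (fun a => cabs a <= t) s)%:R * ln (r / t) <= NS s r.
Proof.
move=> /andP[t1 tr]; have t0 : 0 < t := lt_le_trans ltr01 t1.
have r0 : 0 < r := lt_le_trans t0 tr.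
have r1 : 1 <= r := le_trans t1 tr.
rewrite count_sumr mulr_suml; apply: ler_sum => a _.
case: ifP => at_; last by rewrite mul0r wt_ge0.
rewrite mul1r /wt; have [a0|a0] := eqVneq a 0.
  by rewrite ler_ln ?posrE ?divr_gt0// ler_pdivrMr// ler_peMr// ltW.
have na : 0 < cabs a by rewrite cabs_gt0.
rewrite (le_trans at_ tr) ler_ln ?posrE ?divr_gt0//.
by rewrite ler_pM2l// lef_pV2 ?posrE.
Qed.

End Jensen.

(** * Comparing log|f(w1 z)| with log|f(w2 z)| *)

Section QDifference.
Variable R : realType.
Local Notation C := (Cplx R).
Implicit Types (r rho t S W : R) (a b z w : C) (f h : C -> C) (A B Z : seq C).

Lemma ln_le_sub1 (x : R) : 0 < x -> ln x <= x - 1.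
Proof. by move=> x0; have := @le_ln1Dx R (x - 1); rewrite (_ : 1 + (x - 1) = x); [apply; lra|ring]. Qed.

Lemma ln_diff_le (x y m : R) : 0 < m -> m <= x -> m <= y -> `|ln x - ln y| <= `|x - y| / m.
Proof.
move=> m0 mx my.
have x0 : 0 < x := lt_le_trans m0 mx; have y0 : 0 < y := lt_le_trans m0 my.
have H (u v : R) : 0 < u -> m <= v -> ln u - ln v <= `|u - v| / m.
  move=> u0 mv; have v0 : 0 < v := lt_le_trans m0 mv.
  rewrite -ln_div ?posrE//; apply: le_trans (ln_le_sub1 (divr_gt0 u0 v0)) _.
  have -> : u / v - 1 = (u - v) / v by field; rewrite gt_eqF.
  apply: (@le_trans _ _ (`|u - v| / v)); first by rewrite ler_pM2r ?invr_gt0// ler_norm.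
  by rewrite ler_wpM2l// lef_pV2 ?posrE.
rewrite ler_norml; apply/andP; split; last exact: H.
by rewrite distrC lerNl opprB; exact: H.
Qed.

Lemma ln_max_diff (x y c : R) : 0 < x -> 0 < y ->
  `|ln (Num.max x c) - ln (Num.max y c)| <= `|ln x - ln y|.
Proof.
move=> x0 y0; wlog xy : x y x0 y0 / x <= y.
  move=> H; have [/H|/ltW /H] := leP x y; first exact.
  by rewrite distrC (distrC (ln x)); apply.
have lxy : ln x <= ln y by rewrite ler_ln ?posrE.
have E : `|ln x - ln y| = ln y - ln x by rewrite ler0_norm ?opprB// subr_le0.
have [cx|xc] := leP c x.
  by rewrite !max_l// (le_trans cx).
have c0 : 0 < c := lt_trans x0 xc.
have lxc : ln x <= ln c by rewrite ler_ln ?posrE// ltW.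
rewrite E; have [cy|yc] := leP c y.
  rewrite ler0_norm ?subr_le0; last by rewrite ler_ln ?posrE.
  by lra.
by rewrite subrr normr0; lra.
Qed.

(** The cost of a near zero or pole, uniform in [r] and [a]: each logarithm is split into a
    normalized part of bounded mean and a normalizer, and the normalizers differ by at most |log|w1|
    - log|w2||. *)
Lemma lin_mean r a w1 w2 : 0 < r -> w1 != 0 -> w2 != 0 ->
  rintegrable (fun t => `|ln (cabs (w1 * circ 0 r t - a)) - ln (cabs (w2 * circ 0 r t - a))|) /\
  rmean (fun t => `|ln (cabs (w1 * circ 0 r t - a)) - ln (cabs (w2 * circ 0 r t - a))|) <=
  4 * ln 2 + `|ln (cabs w1) - ln (cabs w2)|.
Proof.
move=> r0 w10 w20.
have [i1 _] := mean_log_scaled a r0 w10; have [i2 _] := mean_log_scaled a r0 w20.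
have i12 := rintegrable_abs (rintegrableB i1 i2); split=> //.
have [j1 b1] := mean_abs_log_sub (a / w1) r0; have [j2 b2] := mean_abs_log_sub (a / w2) r0.
pose M w := Num.max r (cabs (a / w)).
have M0 w : 0 < M w by rewrite lt_max r0.
have E w t : w != 0 -> circ 0 r t != a / w -> ln (cabs (w * circ 0 r t - a)) =
   ln (cabs (circ 0 r t - a / w) / M w) + ln (Num.max (cabs w * r) (cabs a)).
  move=> w0; rewrite -subr_eq0 -cabs_gt0 => h.
  have nw : 0 < cabs w by rewrite cabs_gt0.
  have -> : Num.max (cabs w * r) (cabs a) = cabs w * M w.
    by rewrite maxr_pMr ?(ltW nw)// cabsM cabsV mulrCA divff ?mulr1// gt_eqF.
  have -> : w * circ 0 r t - a = w * (circ 0 r t - a / w) by field; exact: w0.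
  rewrite cabsM ln_div ?posrE// !lnM ?posrE//; ring.
have n1 : 0 < cabs w1 by rewrite cabs_gt0.
have n2 : 0 < cabs w2 by rewrite cabs_gt0.
apply: (@le_trans _ _ (rmean (fun t => `|ln (cabs (circ 0 r t - a / w1) / M w1)| +
   `|ln (cabs (circ 0 r t - a / w2) / M w2)| + `|ln (cabs w1) - ln (cabs w2)|))).
  apply: (rmean_le_ae (Z := [:: a / w1; a / w2]) r0 i12).
    by apply: rintegrableD; [exact: rintegrableD|exact: rintegrable_cst].
  move=> t _; rewrite !inE negb_or => /andP[t1 t2]; rewrite (E w1)// (E w2)//.
  have lm := @ln_max_diff (cabs w1 * r) (cabs w2 * r) (cabs a) (mulr_gt0 n1 r0) (mulr_gt0 n2 r0).
  rewrite !lnM ?posrE// in lm.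
  set x := ln (_ / M w1); set y := ln (_ / M w2).
  set p := ln (Num.max _ _) in lm *; set q := ln (Num.max _ _) in lm *.
  have -> : x + p - (y + q) = (x - y) + (p - q) by ring.
  apply: le_trans (ler_normD _ _) _; apply: lerD; first exact: ler_normB.
  apply: le_trans lm _; rewrite le_eqVlt; apply/orP; left; apply/eqP; congr `|_|; ring.
rewrite rmeanD; [|exact: rintegrableD|exact: rintegrable_cst].
by rewrite rmean_cst rmeanD//; lra.
Qed.

(** Both points w z stay at distance at least t0 / 2 from [a] and are within 2 W r of each other. *)
Lemma lin_far r a w1 w2 W t0 t : 0 < r -> 1 <= W -> cabs w1 <= W -> cabs w2 <= W ->
  2 * W * r <= t0 -> t0 < cabs a ->
  `|ln (cabs (w1 * circ 0 r t - a)) - ln (cabs (w2 * circ 0 r t - a))| <= 4 * W * r / t0.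
Proof.
move=> r0 W1 h1 h2 Wt ta.
have W0 : 0 < W := lt_le_trans ltr01 W1.
have t00 : 0 < t0 by apply: lt_le_trans Wt; rewrite !mulr_gt0.
have low w : cabs w <= W -> t0 / 2 <= cabs (w * circ 0 r t - a).
  move=> hw; have := cabs_lower a (w * circ 0 r t).
  rewrite cabsC cabsM (cabs_circ0 t (ltW r0)).
  have : cabs w * r <= W * r by rewrite ler_pM2r.
  by lra.
have t2 : 0 < t0 / 2 by rewrite divr_gt0.
apply: le_trans (ln_diff_le t2 (low w1 h1) (low w2 h2)) _.
have -> : 4 * W * r / t0 = 2 * W * r / (t0 / 2) by field; rewrite gt_eqF.
rewrite ler_pM2r ?invr_gt0//; apply: le_trans (cabs_dist _ _) _.
have -> : w1 * circ 0 r t - a - (w2 * circ 0 r t - a) = (w1 - w2) * circ 0 r t by ring.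
rewrite cabsM (cabs_circ0 t (ltW r0)) ler_pM2r//.
by have := cabsB w1 w2; lra.
Qed.

Lemma sum_le_count A (t0 c1 c2 : R) : 0 <= c1 -> 0 <= c2 ->
  \sum_(a <- A) (if cabs a <= t0 then c1 else c2) <=
  c1 * (count (fun a => cabs a <= t0) A)%:R + c2 * (size A)%:R.
Proof.
move=> c10 c20; elim: A => [|a A IH]; first by rewrite big_nil /= !mulr0 addr0.
rewrite big_cons /=; rewrite natrD -[(size A).+1]addn1 natrD !mulrDr mulr1.
case: (cabs a <= t0); rewrite ?mulr1 ?mulr0; lra.
Qed.

(** The constant [c] distributes a factor 1 / S' to every linear factor, and it disappears again in
    differences of log|h|. Each point then costs 2 log 2 from [mean_abs_log_sub] and log 2 from
    max(S', |a|) <= 2 S'. *)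
Lemma mean_log_h f kf lf S A B h S' (c : R) : factored f kf lf (2 * S) A B h -> 0 < S ->
  S' = 3 / 2 * S -> 0 < c -> ln c = ((size A)%:R - (size B)%:R) * ln S' ->
  rmean (fun t => `|ln (cabs (rc c * h (circ 0 S' t)))|) <=
  rmean (fun t => `|ln (cabs (f (circ 0 S' t)))|) + 3 * ln 2 * (size (A ++ B))%:R.
Proof.
move=> F S0 S'E c0 lc.
have S'0 : 0 < S' by rewrite S'E; lra.
have SS' : 0 < S' < 2 * S by rewrite S'0 S'E; lra.
have i1 := rintegrable_abs (rintegrable_log1 F SS').
case: (F) => F1 _ F3 _.
have F1c p : cabs p < 2 * S -> (exists a, cder (fun z => rc c * h z) p a) /\ rc c * h p != 0.
  move=> hp; have [[a ha] hn] := F1 p hp; split; first by eexists; exact: cderMl ha.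
  by rewrite mulf_neq0// rc_eq0 gt_eqF.
have [ih _] := mean_log_holo SS' F1c.
have il a : rintegrable (fun t => `|ln (cabs (circ 0 S' t - a)) - ln S'|).
  apply: rintegrable_abs; apply: rintegrableB; last exact: rintegrable_cst.
  by have [] := mean_log_sub a S'0.
apply: (@le_trans _ _ (rmean (fun t => `|ln (cabs (f (circ 0 S' t)))| +
   \sum_(a <- A ++ B) `|ln (cabs (circ 0 S' t - a)) - ln S'|))).
  apply: (rmean_le_ae (Z := A ++ B) S'0); first exact: rintegrable_abs.
    by apply: rintegrableD => //; exact: rintegrable_sum.
  move=> t _ tZ; have tin : cabs (circ 0 S' t) < 2 * S.
    by rewrite (cabs_circ0 t (ltW S'0)); case/andP: SS'.
  have [lf_E _] := log_factored F tin tZ.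
  have [_ hn] := F1 _ tin.
  rewrite cabsM cabs_rc (gtr0_norm c0) lnM ?posrE ?cabs_gt0//.
  have -> : ln c + ln (cabs (h (circ 0 S' t))) = ln (cabs (f (circ 0 S' t))) -
     \sum_(a <- A) (ln (cabs (circ 0 S' t - a)) - ln S') +
     \sum_(b <- B) (ln (cabs (circ 0 S' t - b)) - ln S').
    rewrite lf_E /logfac !sumrB !big_const_seq !count_predT.
    have it n : iter n (+%R (ln S')) 0 = n%:R * ln S'.
      by elim: n => [|n IH]; rewrite ?mul0r// iterS IH -addn1 natrD mulrDl mul1r addrC.
    by rewrite !it lc; ring.
  rewrite big_cat /= addrA; apply: le_trans (ler_normD _ _) _.
  apply: lerD; last exact: ler_norm_sum.
  apply: le_trans (ler_normB _ _) _; rewrite lerD2l; exact: ler_norm_sum.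
rewrite rmeanD//; last exact: rintegrable_sum.
rewrite lerD2l rmean_sum//.
have -> : 3 * ln 2 * (size (A ++ B))%:R = \sum_(a <- A ++ B) (3 * ln 2 : R).
  rewrite big_const_seq count_predT; elim: (size _) => [|n IH]; first by rewrite mulr0.
  by rewrite iterS -IH -[n.+1%:R]natr1 mulrDr mulr1 addrC.
rewrite !big_seq; apply: ler_sum => a aAB.
have aS : cabs a < 2 * S by apply: F3; rewrite -mem_cat.
have [j b] := mean_abs_log_sub a S'0; set M := Num.max S' (cabs a) in j b.
have M0 : 0 < M by rewrite lt_max S'0.
apply: (@le_trans _ _ (rmean (fun t => `|ln (cabs (circ 0 S' t - a) / M)| + ln 2))).
  apply: (rmean_le_ae (Z := [:: a]) S'0 (il a)).
    by apply: rintegrableD => //; exact: rintegrable_cst.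
  move=> t _; rewrite inE -subr_eq0 -cabs_gt0 => h0.
  rewrite ln_div ?posrE//; set x := ln _.
  have -> : x - ln S' = (x - ln M) + (ln M - ln S') by ring.
  apply: le_trans (ler_normD _ _) _; rewrite lerD2l.
  have MS : S' <= M by rewrite le_max lexx.
  rewrite ger0_norm; last by rewrite subr_ge0 ler_ln ?posrE.
  rewrite lerBlDr -lnM ?posrE// ler_ln ?posrE ?mulr_gt0// ge_max.
  by apply/andP; split; lra.
by rewrite rmeanD ?rmean_cst//; [lra|exact: rintegrable_cst].
Qed.

Lemma Tchar_parts f kf lf : divisor f kf lf -> exists2 c : R, 0 <= c &
  forall rho A B h r, factored f kf lf rho A B h -> 1 <= r < rho ->
  [/\ 0 <= Tchar f r, NS A r <= Tchar f r + c, NS B r <= Tchar f r &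
      rmean (fun t => `|ln (cabs (f (circ 0 r t)))|) <= 2 * Tchar f r + c].
Proof.
move=> df; have [Cf HC] := first_main df; exists `|Cf| => // rho A B h r F rr.
have [E1 E2] := HC _ _ _ _ _ F rr; case/andP: (rr) => r1 rrho.
have rr0 : 0 < r < rho by rewrite (lt_le_trans ltr01 r1).
have [_ <-] := mprox_mneg F rr0.
have m1 := mprox_ge0 f r; have m2 := mneg_ge0 f r.
have n1 := NS_ge0 A r1; have n2 := NS_ge0 B r1; have := ler_norm Cf.
by split; lra.
Qed.

(** Points of |z| < 2 S are counted by the integrated counting function at radius 4 S, with weight
    at least log 2; this needs a factorization on a disc larger than 4 S. *)
Lemma size_bound f kf lf (c : R) S A B h : divisor f kf lf ->
  (forall rho A B h r, factored f kf lf rho A B h -> 1 <= r < rho ->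
  [/\ 0 <= Tchar f r, NS A r <= Tchar f r + c, NS B r <= Tchar f r &
      rmean (fun t => `|ln (cabs (f (circ 0 r t)))|) <= 2 * Tchar f r + c]) ->
  1 <= S -> factored f kf lf (2 * S) A B h ->
  (size (A ++ B))%:R * ln 2 <= 2 * Tchar f (4 * S) + c.
Proof.
move=> df HC S1 F; have [A' [B' [h' F']]] := factorization (5 * S) df.
have S4 : 1 <= 4 * S < 5 * S by lra.
have S2 : 1 <= 2 * S <= 4 * S by lra.
have [_ nA nB _] := HC _ _ _ _ _ F' S4.
have cA := count_NS A' S2; have cB := count_NS B' S2.
have E2 : 4 * S / (2 * S) = 2 by field; rewrite gt_eqF//; lra.
rewrite E2 in cA cB.
have [|pA pB] := @factored_perm _ _ _ _ _ _ _ _ _ _ _ _ (fun a => cabs a < 2 * S) F F'.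
  by move=> p pr; split=> //; lra.
case: F => _ _ F3 _.
have fA : [seq a <- A | cabs a < 2 * S] = A.
  by apply/all_filterP/allP => a aA; apply: F3; rewrite aA.
have fB : [seq a <- B | cabs a < 2 * S] = B.
  by apply/all_filterP/allP => a aB; apply: F3; rewrite aB orbT.
have l20 : 0 <= ln (2 : R) by rewrite ln_ge0// ler1n.
have sA : (size A)%:R <= (count (fun a => cabs a <= 2 * S) A')%:R :> R.
  rewrite ler_nat -fA (perm_size pA) size_filter; apply: sub_count => a /=; exact: ltW.
have sB : (size B)%:R <= (count (fun a => cabs a <= 2 * S) B')%:R :> R.
  rewrite ler_nat -fB (perm_size pB) size_filter; apply: sub_count => a /=; exact: ltW.
have hA := ler_wpM2r l20 sA; have hB := ler_wpM2r l20 sB.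
by rewrite size_cat natrD mulrDl; lra.
Qed.

(** Both arguments have modulus at most S / 4, so their distance from the circle of radius 3 S / 2
    exceeds [S]; the kernel is at most S' (2 W r) / S^2. *)
Lemma log_unit_diff f kf lf S A B h S' (cc : R) r w1 w2 W t :
  factored f kf lf (2 * S) A B h -> 0 < S -> S' = 3 / 2 * S -> 0 < cc -> 0 < r ->
  4 * (W * r) <= S -> cabs w1 <= W -> cabs w2 <= W ->
  `|ln (cabs (h (w1 * circ 0 r t))) - ln (cabs (h (w2 * circ 0 r t)))| <=
  6 * W * (r / S) * rmean (fun t => `|ln (cabs (rc cc * h (circ 0 S' t)))|).
Proof.
move=> F S0 S'E cc0 r0 WrS h1 h2.
set HH := rmean _; have HH0 : 0 <= HH by apply: rmean_ge0.
case: (F) => F1 _ _ _.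
have F1c p : cabs p < 2 * S -> (exists a, cder (fun z => rc cc * h z) p a) /\ rc cc * h p != 0.
  move=> hp; have [[a ha] hn] := F1 p hp; split; first by eexists; exact: cderMl ha.
  by rewrite mulf_neq0// rc_eq0 gt_eqF.
have S'0 : 0 < S' < 2 * S by rewrite S'E; lra.
have nz w : cabs w <= W -> cabs (w * circ 0 r t) <= W * r.
  by move=> hw; rewrite cabsM (cabs_circ0 t (ltW r0)) ler_pM2r.
have z1 := nz w1 h1; have z2 := nz w2 h2.
have z1' : cabs (w1 * circ 0 r t) < S' by rewrite S'E; lra.
have z2' : cabs (w2 * circ 0 r t) < S' by rewrite S'E; lra.
have hn w : cabs w <= W -> 0 < cabs (h (w * circ 0 r t)).
  by move=> /nz hw; rewrite cabs_gt0; apply: (F1 _ _).2; lra.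
have := log_difference S'0 F1c z1' z2'.
rewrite !cabsM cabs_rc (gtr0_norm cc0) -/HH.
rewrite -!cabsM !lnM ?posrE ?hn//.
rewrite (_ : ln cc + _ - _ = ln (cabs (h (w1 * circ 0 r t))) -
   ln (cabs (h (w2 * circ 0 r t)))); last by ring.
move=> /le_trans; apply; rewrite ler_wpM2r//.
have -> : 6 * W * (r / S) = 2 * (S' * (2 * W * r) / (S * S)).
  by rewrite S'E; field; rewrite gt_eqF.
rewrite ler_wpM2l//; apply: ler_pM.
- by rewrite mulr_ge0 ?cabs_ge0// S'E; lra.
- by rewrite invr_ge0 mulr_ge0// subr_ge0 ltW.
- rewrite ler_wpM2l//; first by rewrite S'E; lra.
  by have := cabsB (w1 * circ 0 r t) (w2 * circ 0 r t); lra.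
- have d1 : S <= S' - cabs (w1 * circ 0 r t) by rewrite S'E; lra.
  have d2 : S <= S' - cabs (w2 * circ 0 r t) by rewrite S'E; lra.
  rewrite lef_pV2 ?posrE ?mulr_gt0//; [|lra|lra].
  by apply: ler_pM => //; exact: ltW.
Qed.

Theorem log_qdifference f kf lf w1 w2 W : divisor f kf lf -> w1 != 0 -> w2 != 0 ->
  1 <= W -> cabs w1 <= W -> cabs w2 <= W -> exists2 K : R, 0 <= K &
  forall r S, 1 <= r -> 4 * W ^+ 2 * r <= S ->
  rintegrable (fun t => `|ln (cabs (f (w1 * circ 0 r t))) - ln (cabs (f (w2 * circ 0 r t)))|) /\
  rmean (fun t => `|ln (cabs (f (w1 * circ 0 r t))) - ln (cabs (f (w2 * circ 0 r t)))|) <=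
  K * (Tchar f S + Tchar f (3 / 2 * S) + Tchar f (4 * S) + 1) / ln (S / r).
Proof.
move=> df w10 w20 W1 h1 h2; have [c c0 HC] := Tchar_parts df.
pose C1 := 4 * ln 2 + `|ln (cabs w1) - ln (cabs w2)|.
have l2 : 0 < ln (2 : R) by rewrite ln_gt0// ltr1n.
have C10 : 0 <= C1 by rewrite addr_ge0// mulr_ge0// ltW.
(* [K0] dominates all coefficients produced by [q1] (near points), [q2] (far points) and [q3]
   (zero-free factor). *)
pose K0 := 4 * C1 + 16 * W / ln 2 + 96 * W.
have W0 : 0 < W := lt_le_trans ltr01 W1.
have WL : 0 <= W / ln 2 by rewrite divr_ge0 ?ltW.
have K00 : 0 <= K0 by rewrite /K0 -mulrA; lra.
exists (K0 * (1 + c)); first by rewrite mulr_ge0//; lra.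
move=> r S r1 WS; have r0 : 0 < r := lt_le_trans ltr01 r1.
have W2 : 1 <= W ^+ 2 by rewrite exprn_ege1.
have W2W : W <= W ^+ 2 by rewrite expr2 ler_peMl// ltW.
have Wr2 : W * r <= W ^+ 2 * r by rewrite ler_pM2r.
have rW2 : r <= W ^+ 2 * r by rewrite -{1}[r]mul1r ler_pM2r.
have rS : 4 * r <= S by lra.
have WrS : 4 * (W * r) <= S by lra.
have S0 : 0 < S by lra.
have S1 : 1 <= S by lra.
have [A [B [h F]]] := factorization (2 * S) df.
pose S' := 3 / 2 * S.
have SS : 1 <= S < 2 * S by lra.
have SS' : 1 <= S' < 2 * S by rewrite /S'; lra.
have [T1 nA nB _] := HC _ _ _ _ _ F SS.
have [T2 _ _ mf] := HC _ _ _ _ _ F SS'.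
have N2 := size_bound df HC S1 F.
have T3 : 0 <= Tchar f (4 * S).
  have [A' [B' [h' F']]] := factorization (5 * S) df.
  by have [] := HC _ _ _ _ (4 * S) F'; lra.
set x1 := Tchar f S in T1 nA nB *; set x2 := Tchar f S' in T2 mf *.
set x3 := Tchar f (4 * S) in T3 N2 *.
(* The geometric mean makes log(S / t0) half of log(S / r), so at most O(T(S, f) / log(S / r))
   points are near, while a far point costs only r / t0 = sqrt(r / S). *)
pose t0 : R := Num.sqrt (r * S).
have rS0 : 0 < r * S by rewrite mulr_gt0.
have t00 : 0 < t0 by rewrite sqrtr_gt0.
have t0sq : t0 * t0 = r * S by rewrite -expr2 sqr_sqrtr// ltW.
have sq_le (x y : R) : 0 <= x -> 0 < y -> x * x <= y * y -> x <= y.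
  by move=> x0 y0 xy; rewrite leNgt; apply/negP => yx; nra.
(* Squared, this is [r] times the hypothesis on [S]. *)
have Wt0 : 2 * W * r <= t0.
  apply: sq_le => //; first by rewrite !mulr_ge0// ltW.
  rewrite t0sq (_ : _ * _ = r * (4 * W ^+ 2 * r)); last by ring.
  by rewrite ler_pM2l.
have t01 : 1 <= t0 <= S.
  apply/andP; split; apply: sq_le => //.
    by rewrite t0sq mul1r -[leLHS]mul1r ler_pM.
  by rewrite ltW.
  by rewrite t0sq ler_pM2r//; lra.
pose ell := ln (S / r).
have Sr1 : 1 < S / r by rewrite ltr_pdivlMr// mul1r; lra.
have ell0 : 0 < ell by rewrite ln_gt0.
pose sg : R := t0 / S.
have sgE : r / t0 = sg.
  have -> : r = t0 * t0 / S by rewrite t0sq mulfK// gt_eqF.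
  by rewrite /sg mulrAC mulfK// gt_eqF.
have sg0 : 0 < sg by rewrite divr_gt0.
have sg1 : sg <= 1 by rewrite ler_pdivrMr// mul1r; case/andP: t01.
have rSsg : r / S <= sg.
  have -> : r / S = sg * sg.
    by rewrite /sg mulf_div t0sq invfM mulrA mulfK// gt_eqF.
  by rewrite ler_piMl// ltW.
have ellE : ln (S / t0) = ell / 2.
  have : ln (t0 * t0) = ln (r * S) by rewrite t0sq.
  by rewrite /ell !ln_div ?posrE// (lnM t00)// (lnM r0)//; lra.
(* From log y <= y - 1 at y = S / t0: the decay sqrt(r / S) of the far terms absorbs the factor
   log(S / r). *)
have ellsg : ell * sg <= 2.
  have St0 : 0 < S / t0 by rewrite divr_gt0.
  have := ln_le_sub1 St0; rewrite ellE => hl.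
  have -> : (2 : R) = 2 * (S / t0) * sg by rewrite /sg; field; rewrite !gt_eqF.
  by rewrite ler_pM2r//; lra.
pose n0 : R := (count (fun a => cabs a <= t0) (A ++ B))%:R.
have n0b : n0 * (ell / 2) <= 2 * x1 + c.
  have := count_NS A t01; have := count_NS B t01; rewrite ellE /n0 count_cat natrD mulrDl.
  by lra.
have n00 : 0 <= n0 by rewrite ler0n.
pose nn : R := (size (A ++ B))%:R.
have nn0 : 0 <= nn by rewrite ler0n.
pose cc := expR (((size A)%:R - (size B)%:R) * ln S').
have cc0 : 0 < cc by exact: expR_gt0.
have lcc : ln cc = ((size A)%:R - (size B)%:R) * ln S' by rewrite expRK.
have Hh := mean_log_h F S0 (erefl S') cc0 lcc.
pose HH := rmean (fun t => `|ln (cabs (rc cc * h (circ 0 S' t)))|).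
have HHb : HH <= 2 * x2 + c + 3 * (2 * x3 + c).
  by move: Hh; rewrite -/HH -/nn -mulrA (mulrC (ln 2)); rewrite -/nn in N2; lra.
have HH0 : 0 <= HH by apply: rmean_ge0.
have w1r : cabs w1 * r < 2 * S.
  have : cabs w1 * r <= W * r by rewrite ler_pM2r.
  by lra.
have w2r : cabs w2 * r < 2 * S.
  have : cabs w2 * r <= W * r by rewrite ler_pM2r.
  by lra.
have i12 := rintegrable_abs (rintegrableB (rintegrable_log F r0 w10 w1r)
  (rintegrable_log F r0 w20 w2r)).
split=> //.
pose dl a t := `|ln (cabs (w1 * circ 0 r t - a)) - ln (cabs (w2 * circ 0 r t - a))|.
have idl a : rintegrable (dl a) by have [] := lin_mean a r0 w10 w20.
have hdiff t : `|ln (cabs (h (w1 * circ 0 r t))) - ln (cabs (h (w2 * circ 0 r t)))| <=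
    6 * W * (r / S) * HH.
  exact: (@log_unit_diff f kf lf S A B h S' cc r w1 w2 W t).
have M1 : rmean (fun t => `|ln (cabs (f (w1 * circ 0 r t))) - ln (cabs (f (w2 * circ 0 r t)))|) <=
   \sum_(a <- A ++ B) rmean (dl a) + 6 * W * (r / S) * HH.
  rewrite -rmean_sum// -(rmean_cst (6 * W * (r / S) * HH)) -rmeanD; last 2 first.
    exact: rintegrable_sum.
    exact: rintegrable_cst.
  pose Z := [seq a / w1 | a <- A ++ B] ++ [seq a / w2 | a <- A ++ B].
  apply: (rmean_le_ae (Z := Z) r0 i12).
    by apply: rintegrableD; [exact: rintegrable_sum|exact: rintegrable_cst].
  move=> t _; rewrite mem_cat negb_or => /andP[t1 t2].
  have [E1 _] := log_factored_circ F r0 w10 w1r t1.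
  have [E2 _] := log_factored_circ F r0 w20 w2r t2.
  rewrite E1 E2 /logfac.
  set a1 := \sum_(a <- A) _; set b1 := \sum_(b <- B) _; set a2 := \sum_(a <- A) _.
  set b2 := \sum_(b <- B) _; set g1 := ln (cabs (h _)); set g2 := ln (cabs (h _)).
  have -> : a1 - b1 + g1 - (a2 - b2 + g2) = (a1 - a2) - (b1 - b2) + (g1 - g2) by ring.
  apply: le_trans (ler_normD _ _) _; apply: lerD; last exact: hdiff.
  rewrite big_cat /=; apply: le_trans (ler_normB _ _) _.
  by rewrite /a1 /a2 /b1 /b2 -!sumrB; apply: lerD; exact: ler_norm_sum.
have M2 : \sum_(a <- A ++ B) rmean (dl a) <= C1 * n0 + 4 * W * sg * nn.
  have Wsg : 0 <= 4 * W * sg by rewrite mulr_ge0 ?(ltW sg0)// mulr_ge0// ltW.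
  apply: le_trans (sum_le_count (A ++ B) t0 C10 Wsg).
  apply: ler_sum => a _; case: ifP => at_; first by have [] := lin_mean a r0 w10 w20.
  rewrite -(rmean_cst (4 * W * sg)); apply: rmean_le => //; first exact: rintegrable_cst.
  move=> t _; rewrite -sgE mulrA; apply: lin_far => //.
  by rewrite ltNge at_.
apply: le_trans M1 _; rewrite ler_pdivlMr// -/ell.
have q1 : ell * (C1 * n0) <= C1 * (2 * (2 * x1 + c)).
  by rewrite mulrCA; apply: ler_wpM2l => //; lra.
have q2 : ell * (4 * W * sg * nn) <= 8 * (W / ln 2) * (2 * x3 + c).
  have nb : nn <= (2 * x3 + c) / ln 2 by rewrite ler_pdivlMr.
  have -> : ell * (4 * W * sg * nn) = 4 * W * (ell * sg) * nn by ring.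
  have -> : 8 * (W / ln 2) * (2 * x3 + c) = 4 * W * 2 * ((2 * x3 + c) / ln 2).
    by field; rewrite gt_eqF.
  apply: ler_pM => //.
    exact: mulr_ge0 (mulr_ge0 (ler0n _ 4) (ltW W0)) (mulr_ge0 (ltW ell0) (ltW sg0)).
  by rewrite ler_wpM2l// mulr_ge0// ltW.
have q3 : ell * (6 * W * (r / S) * HH) <= 12 * W * (2 * x2 + c + 3 * (2 * x3 + c)).
  have e1 : ell * (r / S) <= 2.
    by apply: le_trans ellsg; rewrite ler_pM2l.
  have -> : ell * (6 * W * (r / S) * HH) = 6 * W * (ell * (r / S)) * HH by ring.
  have -> : 12 * W = 6 * W * 2 by ring.
  have rS00 : 0 <= r / S by rewrite divr_ge0 ?ltW.
  apply: ler_pM => //.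
    exact: mulr_ge0 (mulr_ge0 (ler0n _ 6) (ltW W0)) (mulr_ge0 (ltW ell0) rS00).
  by rewrite ler_wpM2l// mulr_ge0// ltW.
apply: (@le_trans _ _ (K0 * (x1 + x2 + x3) + K0 * c)).
  have k1 : 0 <= C1 * x1 by rewrite mulr_ge0.
  have k2 : 0 <= C1 * x2 by rewrite mulr_ge0.
  have k3 : 0 <= C1 * x3 by rewrite mulr_ge0.
  have k4 : 0 <= C1 * c by rewrite mulr_ge0.
  have l1 : 0 <= W / ln 2 * x1 by rewrite mulr_ge0.
  have l2' : 0 <= W / ln 2 * x2 by rewrite mulr_ge0.
  have l3 : 0 <= W / ln 2 * x3 by rewrite mulr_ge0.
  have l4 : 0 <= W / ln 2 * c by rewrite mulr_ge0.
  have m1 : 0 <= W * x1 by rewrite mulr_ge0// ltW.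
  have m2 : 0 <= W * x2 by rewrite mulr_ge0// ltW.
  have m3 : 0 <= W * x3 by rewrite mulr_ge0// ltW.
  have m4 : 0 <= W * c by rewrite mulr_ge0// ltW.
  rewrite /K0 -(mulrA 16); move: q1 q2 q3; move: (W / ln 2) l1 l2' l3 l4 => V l1 l2' l3 l4.
  have M2' := ler_wpM2l (ltW ell0) M2; rewrite mulrDr in M2'.
  rewrite mulrC mulrDr; move: (\sum_(a <- A ++ B) _) M2' => sm M2' q1 q2 q3.
  clear -k1 k2 k3 k4 l1 l2' l3 l4 m1 m2 m3 m4 M2' q1 q2 q3; lra.
have p1 : 0 <= K0 * c * (x1 + x2 + x3)
  := mulr_ge0 (mulr_ge0 K00 c0) (addr_ge0 (addr_ge0 T1 T2) T3).
have -> : K0 * (1 + c) * (x1 + x2 + x3 + 1) = K0 * (x1 + x2 + x3) + K0 +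
   K0 * c * (x1 + x2 + x3) + K0 * c by ring.
clear -p1 K00; lra.
Qed.

End QDifference.

(** * Pole multiplicities and counting over distinct points *)

Section Poles.
Variable R : realType.
Local Notation C := (Cplx R).
Implicit Types (r rho t S W e M : R) (a b z w p : C) (f g h : C -> C) (A B Z : seq C) (l k : C -> nat).

(* The zero function has no divisor; it is given pole multiplicity [0]. *)
Definition pole_mult g l :=
  ((forall z, g z = 0) /\ (forall p, l p = 0%N)) \/ exists k, divisor g k l.

Lemma mero_pole_mult g : meromorphic g -> exists l, pole_mult g l.
Proof.
move=> mg; have [g0|ng] := pselect (forall z, g z = 0).
  by exists (fun _ => 0%N); left.
by have [k [l d]] := nonzero_divisor mg ng; exists l; right; exists k.
Qed.

Lemma zero_no_pole g z : (forall z, g z = 0) -> ~ is_pole g z.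
Proof.
move=> g0 [_ /(_ 0)[e [e0 H]]]; have [w hw _] := punctured_point z e0.
by have := H w hw; rewrite g0 cabs0 ltxx.
Qed.

Lemma reg_not_pole g z : reg g z -> ~ is_pole g z.
Proof. by move=> /reg_lord00 L /pole_lord /(_ L). Qed.

Lemma near_le1 p e : 0 < e -> exists2 e', 0 < e' & forall z, 0 < cabs (z - p) < e' ->
  0 < cabs (z - p) < e /\ cabs (z - p) <= 1.
Proof.
move=> e0; exists (Num.min e 1); first by rewrite lt_min e0 ltr01.
by move=> z /andP[z0]; rewrite lt_min => /andP[-> z1]; rewrite z0 (ltW z1).
Qed.

(** Poles are compared through local growth instead of Laurent expansions: near [p] the zero-free
    factor has modulus between half and twice its value at [p], and |z - p| <= 1. *)
Lemma lord_bounds g p (k l : nat) : lord g p k l -> exists (c M e : R), [/\ 0 < c, 0 < e &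
  forall z, 0 < cabs (z - p) < e -> cabs (g z) * cabs (z - p) ^+ l <= M /\
    c * cabs (z - p) ^+ k <= cabs (g z) * cabs (z - p) ^+ l].
Proof.
move=> [_ [u [e [e0 hu un ue]]]].
have [d hd] : exists d, cder u p d by apply: hu; rewrite subrr cabs0.
have up : 0 < cabs (u p) by rewrite cabs_gt0; apply: un; rewrite subrr cabs0.
have uc := cder_ccont hd.
have u2 : 0 < cabs (u p) / 2 by rewrite divr_gt0.
have [e1 e10 h1] := uc _ u2.
have [e2 e20 h2] : exists2 e2, 0 < e2 & forall z, 0 < cabs (z - p) < e2 ->
    [/\ 0 < cabs (z - p) < e, cabs (z - p) < e1 & cabs (z - p) <= 1].
  have [|e2 e20 H] := @near_le1 p (Num.min e e1); first by rewrite lt_min e0.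
  by exists e2 => // z /H[]; rewrite lt_min => /andP[-> /andP[-> ->]].
exists (cabs (u p) / 2), (2 * cabs (u p)), e2; split=> // z /h2[ze z1 zle].
have E : cabs (g z) * cabs (z - p) ^+ l = cabs (z - p) ^+ k * cabs (u z).
  by rewrite -!cabsX -!cabsM ue.
have d1 := h1 _ z1; rewrite subrKC in d1; case/andP: ze => z0 _.
have x0 : 0 <= cabs (z - p) ^+ k by rewrite exprn_ge0// cabs_ge0.
have x1 : cabs (z - p) ^+ k <= 1 by rewrite exprn_ile1// cabs_ge0.
have ub : cabs (u z) <= 2 * cabs (u p).
  by have := cabs_lower (u z) (u p); lra.
have lb : cabs (u p) / 2 <= cabs (u z).
  by have := cabs_lower (u p) (u z); rewrite cabsC; lra.
rewrite E; split; last by rewrite mulrC ler_wpM2l.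
by apply: le_trans ub; rewrite ler_piMl// cabs_ge0.
Qed.

Lemma pole_mult_near g l p : pole_mult g l -> exists (M e : R), [/\ 0 <= M, 0 < e &
  forall z, 0 < cabs (z - p) < e -> ~ is_pole g z /\ cabs (g z) * cabs (z - p) ^+ l p <= M].
Proof.
move=> [[g0 l0]|[k [_ /(_ p) L]]].
  exists 0, 1; split=> // z _; split; first exact: zero_no_pole.
  by rewrite g0 cabs0 mul0r.
have [c [M [e [c0 e0 H]]]] := lord_bounds L; have [e' e'0 H'] := lord_reg L.
exists `|M|, (Num.min e e'); rewrite lt_min e0 e'0; split=> // z.
rewrite lt_min => /andP[z0 /andP[z1 z2]]; split.
  by apply: reg_not_pole; apply: H'; rewrite z0.
by have [|h _] := H z; [rewrite z0|exact: le_trans (ler_norm _)].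
Qed.

Lemma npoles0 g t : (forall z, g z = 0) -> npoles g t = 0.
Proof.
move=> g0; rewrite /npoles (_ : [set _ | _] = [set 0]) ?sup1//.
apply/seteqP; split=> x /=; last by move=> ->; exists [::]; rewrite big_nil.
move=> [[|[p m] s] [_ [H ->]]]; first by rewrite big_nil.
have [/pole_order_lord /lord_neq0[e e0 L] _] := H (p, m) (mem_head _ _).
by have [z /L] := punctured_point p e0; rewrite g0 eqxx.
Qed.

Lemma Ncount0 g r : (forall z, g z = 0) -> Ncount g r = 0.
Proof.
move=> g0; rewrite /Ncount !npoles0// mul0r addr0.
under eq_integral do rewrite !npoles0// subrr mul0r.
by rewrite integral0.
Qed.

Lemma pole_list g l rho : pole_mult g l -> exists B,
  [/\ forall p, cabs p < rho -> count_mem p B = l p, forall p, p \in B -> cabs p < rho,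
   forall r, 0 < r < rho -> Ncount g r = NS B r &
   forall p, cabs p < rho -> is_pole g p -> p \in B].
Proof.
move=> [[g0 l0]|[k d]].
  exists [::]; split=> // [r _|p _ pp]; last by case: (zero_no_pole g0 pp).
  by rewrite Ncount0// /NS big_nil.
have [A [B [h F]]] := factorization rho d; exists B.
case: (F) => _ F2 F3 _; split=> [p /F2[]//|p pB|r rr|p pr pp].
- by apply: F3; rewrite pB orbT.
- exact: NcountE F rr.
- by rewrite -has_pred1 has_count (F2 _ pr).2; exact: pole_lord pp (d.2 p).
Qed.

Lemma rintegrable_logplus g l r : pole_mult g l -> 0 < r ->
  rintegrable (fun t => Num.max 0 (ln (cabs (g (circ 0 r t))))).
Proof.
move=> [[g0 _] _|[k d] r0].
  rewrite (_ : (fun _ => _) = fun=> 0); first exact: rintegrable_cst.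
  by apply/funext => t; rewrite g0 cabs0 ln0// maxxx.
have [A [B [h F]]] := factorization (r + 1) d.
by apply: rintegrable_max0; apply: (rintegrable_log1 F); rewrite r0; lra.
Qed.

Lemma entire_pole_mult g l p : pole_mult g l -> entire g -> l p = 0%N.
Proof.
move=> [[_ ->]//|[k [_ /(_ p) L]]] eg; apply: holo_lord L.
by exists 1; split=> // z _; exact: eg.
Qed.

Lemma entire_Ncount g l r : pole_mult g l -> entire g -> 0 < r -> Ncount g r = 0.
Proof.
move=> pg eg r0; have [B [B1 B2 B3 _]] := pole_list (r + 1) pg.
rewrite B3; last by rewrite r0; lra.
case: B B1 B2 B3 => [|b B] B1 B2 _; first by rewrite /NS big_nil.
by have := B1 b (B2 b (mem_head _ _)); rewrite (entire_pole_mult b pg eg) /= eqxx.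
Qed.

Lemma Ncount_ge0 g l r : pole_mult g l -> 1 <= r -> 0 <= Ncount g r.
Proof.
move=> pg r1; have [B [_ _ H _]] := pole_list (r + 1) pg.
by rewrite H; [exact: NS_ge0|lra].
Qed.

(** Summing over a common set of distinct points, with multiplicities as coefficients, allows the
    pole multiplicities of several functions to be compared pointwise. *)
Lemma NS_uniq B U (c : C -> nat) rho r : 1 <= r -> uniq U ->
  (forall p, p \in U -> cabs p < rho) -> (forall p, cabs p < rho -> count_mem p B = c p) ->
  \sum_(p <- U) (c p)%:R * wt r p <= NS B r /\
  ((forall p, p \in B -> p \in U) -> NS B r = \sum_(p <- U) (c p)%:R * wt r p).
Proof.
move=> r1 uU HU HB.
have E : \sum_(p <- U) (c p)%:R * wt r p = NS [seq b <- B | b \in U] r.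
  have -> : \sum_(p <- U) (c p)%:R * wt r p = \sum_(p <- U) (count_mem p B)%:R * wt r p.
    by rewrite !big_seq; apply: eq_bigr => p pU; rewrite HB// HU.
  elim: B {HB} => [|b B IH]; first by rewrite /NS big_nil big1// => p _; rewrite mul0r.
  under eq_bigr do rewrite /= natrD mulrDl.
  rewrite big_split /= IH; have [bU|bU] := boolP (b \in U).
    rewrite /NS big_cons; congr (_ + _); rewrite (bigD1_seq b)//= eqxx mul1r.
    by rewrite big1 ?addr0// => p pb; rewrite eq_sym (negbTE pb) mul0r.
  rewrite big_seq big1 ?add0r// => p pU; case: eqP => [bp|_]; last by rewrite mul0r.
  by rewrite bp pU in bU.
rewrite E; split=> [|HBU]; last by congr NS; apply/esym/all_filterP/allP.
rewrite /NS big_filter [leRHS](bigID (mem U))/= lerDl.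
by apply: sumr_ge0 => b _; exact: wt_ge0.
Qed.

(** Transfers zeros and poles of f(w z) in |z| <= r to those of [f] in |z| <= K r: here r / |p| <= K
    r / |w p|. *)
Lemma wt_scale r K w p : 1 <= r -> w != 0 -> cabs w <= K -> 1 <= K ->
  wt r p <= wt (K * r) (w * p).
Proof.
move=> r1 w0 wK K1; have r0 : 0 < r := lt_le_trans ltr01 r1.
have K0 : 0 < K := lt_le_trans ltr01 K1.
rewrite /wt mulf_eq0 (negbTE w0) /=; case: ifPn => p0.
  by rewrite ler_ln ?posrE ?mulr_gt0// ler_peMl// ltW.
have np : 0 < cabs p by rewrite cabs_gt0.
have nw : 0 < cabs w by rewrite cabs_gt0.
rewrite cabsM; case: ifP => pr; last first.
  case: ifP => // pr'; apply: ln_ge0.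
  by rewrite ler_pdivlMr ?mulr_gt0// mul1r.
have wpK : cabs w * cabs p <= K * r by apply: ler_pM => //; exact: cabs_ge0.
rewrite wpK ler_ln ?posrE ?divr_gt0 ?mulr_gt0//.
rewrite ler_pdivrMr// mulrAC ler_pdivlMr ?mulr_gt0//.
have -> : r * (cabs w * cabs p) = cabs w * (r * cabs p) by ring.
by rewrite -[leRHS]mulrA ler_pM2r// mulr_gt0.
Qed.

End Poles.

(** * Counting and proximity functions of a coefficient of the equation *)

Section Equation.
Variable R : realType.
Local Notation C := (Cplx R).
Implicit Types (r rho t S W e M : R) (b z w p q : C) (f g h : C -> C) (A B Z : seq C) (n i j : nat).

Lemma scaled_bounds f kf lf w p : divisor f kf lf -> w != 0 ->
  exists (c M e : R), [/\ 0 < c, 0 <= M, 0 < e & forall z, 0 < cabs (z - p) < e ->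
    [/\ ~ is_pole f (w * z), cabs (f (w * z)) * cabs (z - p) ^+ lf (w * p) <= M &
        c * cabs (z - p) ^+ kf (w * p) <= cabs (f (w * z))]].
Proof.
move=> [_ /(_ (w * p)) L] w0; have nw : 0 < cabs w by rewrite cabs_gt0.
have [c [M [e [c0 e0 H]]]] := lord_bounds L; have [e1 e10 H1] := lord_reg L.
have [|e2 e20 H2] := @near_le1 _ (w * p) (Num.min e e1); first by rewrite lt_min e0.
exists (c * cabs w ^+ kf (w * p)), (`|M| / cabs w ^+ lf (w * p)), (e2 / cabs w).
have wl : 0 < cabs w ^+ lf (w * p) by rewrite exprn_gt0.
split; [by rewrite mulr_gt0// exprn_gt0|by rewrite divr_ge0// ltW|by rewrite divr_gt0|].
move=> z /andP[z0 z1].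
have E : cabs (w * z - w * p) = cabs w * cabs (z - p) by rewrite -mulrBr cabsM.
have [] := H2 (w * z).
  by rewrite E mulr_gt0//= mulrC -ltr_pdivlMr.
rewrite lt_min => /andP[y0 /andP[ye ye1]] y1.
have [|up lo] := H (w * z); first by rewrite y0.
split; first by apply: reg_not_pole; apply: H1; rewrite y0.
  rewrite ler_pdivlMr// -mulrA -exprMn (mulrC (cabs (z - p))) -E.
  exact: le_trans (ler_norm _).
rewrite -mulrA -exprMn -E; apply: le_trans lo _.
by rewrite ler_piMr ?cabs_ge0// exprn_ile1 ?cabs_ge0.
Qed.

Lemma near_all p n (P : nat -> C -> Prop) :
  (forall j, (j <= n)%N -> exists2 e, 0 < e & forall z, 0 < cabs (z - p) < e -> P j z) ->
  exists2 e, 0 < e & forall z, 0 < cabs (z - p) < e -> forall j, (j <= n)%N -> P j z.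
Proof.
elim: n => [|n IH] H.
  have [e e0 He] := H 0%N (leqnn _); exists e => // z /He h j.
  by rewrite leqn0 => /eqP ->.
have [|e1 e10 H1] := IH; first by move=> j jn; apply: H; exact: leqW.
have [e2 e20 H2] := H n.+1 (leqnn _).
exists (Num.min e1 e2); first by rewrite lt_min e10.
move=> z; rewrite lt_min => /andP[z0 /andP[z1 z2]] j.
rewrite leq_eqVlt => /orP[/eqP ->|]; first by apply: H2; rewrite z0.
by rewrite ltnS; apply: H1; rewrite z0.
Qed.

Definition qdiff_eq q n (a : nat -> C -> C) f := forall z,
  (forall j, (j <= n)%N -> ~ is_pole (a j) z /\ ~ is_pole f (q ^+ j * z)) ->
  \sum_(j < n.+1) a j z * f (q ^+ j * z) = 0.

Lemma isolate q n a f i z : qdiff_eq q n a f -> (i <= n)%N ->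
  (forall j, (j <= n)%N -> ~ is_pole (a j) z /\ ~ is_pole f (q ^+ j * z)) ->
  cabs (a i z) * cabs (f (q ^+ i * z)) <=
  \sum_(j < n.+1 | j != i :> nat) cabs (a j z) * cabs (f (q ^+ j * z)).
Proof.
move=> eqn le_in np; have := eqn z np.
rewrite (bigD1 (Ordinal (le_in : (i < n.+1)%N)))//= => /eqP; rewrite addr_eq0 => /eqP E.
rewrite -cabsM E cabsN; rewrite (eq_bigl (fun j : 'I_n.+1 => j != i :> nat))//.
elim/big_ind2: _ => [|u x v y hu hv|j _]; rewrite ?cabs0 ?cabsM//.
exact: le_trans (cabsD _ _) (lerD hu hv).
Qed.

(** Multiplied by |z - p|^m, all terms with index other than [i] stay bounded near [p], whereas a
    larger [l i p] would make the remaining one unbounded. The summand [kf] allows for a zero of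
    f(q^i z) that absorbs part of the pole. *)
Lemma pole_mult_le q n a i f kf lf (l : nat -> C -> nat) p : q != 0 ->
  (forall j, (j <= n)%N -> pole_mult (a j) (l j)) -> divisor f kf lf -> (i <= n)%N ->
  qdiff_eq q n a f ->
  (l i p <= kf (q ^+ i * p)%R + \sum_(j < n.+1 | j != i :> nat) (l j p + lf (q ^+ j * p)%R))%N.
Proof.
move=> q0 pa df le_in eqn; set m := (\sum_(j < _ | _) _)%N.
rewrite leqNgt; apply/negP => lt_l.
have li0 : (0 < l i p)%N by apply: leq_ltn_trans lt_l.
have [k Li] : exists k, lord (a i) p k (l i p).
  have [[_ l0]|[k [_ d]]] := pa i le_in; first by rewrite l0 in li0.
  by exists (k p).
have k0 : k = 0%N by case: Li => /orP[/eqP//|/eqP l0]; rewrite l0 in li0.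
have [c1 [? [e1 [c10 e10 H1]]]] := lord_bounds Li.
have qj j : q ^+ j != 0 by rewrite expf_neq0.
have [c2 [? [e2 [c20 _ e20 H2]]]] := scaled_bounds p df (qj i).
have [|M HM] := @choice nat R (fun j M => (j <= n)%N -> 0 <= M /\ exists2 e, 0 < e &
    forall z, 0 < cabs (z - p) < e -> [/\ ~ is_pole (a j) z, ~ is_pole f (q ^+ j * z) &
      cabs (a j z) * cabs (f (q ^+ j * z)) * cabs (z - p) ^+ (l j p + lf (q ^+ j * p)) <= M]).
  move=> j; have [jn|nj] := boolP (j <= n)%N; last by exists 0.
  have [M1 [d1 [M10 d10 h1]]] := pole_mult_near p (pa j jn).
  have [? [M2 [d2 [_ M20 d20 h2]]]] := scaled_bounds p df (qj j).
  exists (M1 * M2) => _; split; first exact: mulr_ge0.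
  exists (Num.min d1 d2); first by rewrite lt_min d10.
  move=> z; rewrite lt_min => /andP[z0 /andP[z1 z2]].
  have [|np b1] := h1 z; first by rewrite z0.
  have [|np' b2 _] := h2 z; first by rewrite z0.
  by split=> //; rewrite exprD mulrACA; apply: ler_pM; rewrite ?mulr_ge0 ?exprn_ge0 ?cabs_ge0.
have [|e3 e30 H3] := @near_all p n (fun j z => [/\ ~ is_pole (a j) z, ~ is_pole f (q ^+ j * z) &
      cabs (a j z) * cabs (f (q ^+ j * z)) * cabs (z - p) ^+ (l j p + lf (q ^+ j * p)) <= M j]).
  by move=> j jn; have [] := HM j jn.
pose MM := \sum_(j < n.+1 | j != i :> nat) M j.
have MM0 : 0 <= MM by apply: sumr_ge0 => j _; apply: (HM j _).1; rewrite -ltnS.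
(* The comparison ends in c1 c2 <= MM |z - p|, which fails below this radius. *)
pose e4 := c1 * c2 / (MM + 1).
have c120 : 0 < c1 * c2 by rewrite mulr_gt0.
have e40 : 0 < e4 by rewrite divr_gt0//; lra.
have [|e5 e50 H5] := @near_le1 _ p (Num.min (Num.min e1 e2) (Num.min e3 e4)).
  by rewrite !lt_min e10 e20 e30 e40.
have [z hz _] := punctured_point p e50.
have [] := H5 z hz; rewrite !lt_min => /andP[x0 /andP[/andP[x1 x2] /andP[x3 x4]]] xle1.
have [|_ b1] := H1 z; first by rewrite x0.
have [|_ _ b2] := H2 z; first by rewrite x0.
have {}H3 := H3 z; rewrite x0 x3 in H3; have {}H3 := H3 isT.
set x := cabs (z - p) in x0 x1 x2 x3 x4 xle1 b1 b2 H3.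
rewrite k0 expr0 mulr1 in b1.
have I := isolate eqn le_in (fun j jn => let: And3 h1 h2 _ := H3 j jn in conj h1 h2).
have xm k' : 0 < x ^+ k' by rewrite exprn_gt0.
have U : cabs (a i z) * cabs (f (q ^+ i * z)) * x ^+ m <= MM.
  apply: (@le_trans _ _ (\sum_(j < n.+1 | j != i :> nat)
      cabs (a j z) * cabs (f (q ^+ j * z)) * x ^+ m)).
    by rewrite -mulr_suml ler_pM2r.
  apply: ler_sum => j ji; have [_ _] := H3 j (ltn_ord j : (j <= n)%N).
  apply: le_trans.
  apply: ler_wpM2l; first by rewrite mulr_ge0 ?cabs_ge0.
  apply: ler_wiXn2l; [exact: ltW|exact: xle1|].
  by rewrite /m (bigD1 j)//= leq_addr.
have Lo : c1 * c2 * x ^+ (kf (q ^+ i * p) + m) <= MM * x ^+ l i p.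
  apply: (@le_trans _ _ ((cabs (a i z) * x ^+ l i p) * (cabs (f (q ^+ i * z)) * x ^+ m))).
    rewrite exprD -mulrA (mulrA c2); apply: ler_pM => //; first exact: ltW.
      by rewrite !mulr_ge0// ltW.
    by rewrite ler_pM2r.
  by rewrite mulrACA (mulrC (x ^+ l i p)) mulrA ler_pM2r.
have : x ^+ l i p <= x ^+ (kf (q ^+ i * p) + m) * x.
  rewrite -exprSr; apply: ler_wiXn2l; [exact: ltW|exact: xle1|exact: lt_l].
move=> /(ler_wpM2l MM0) /(le_trans Lo).
move=> Hx; have Hc : c1 * c2 <= MM * x.
  by rewrite -(ler_pM2r (xm (kf (q ^+ i * p)%R + m)%N)) -[leRHS]mulrA (mulrC x).
move: x4; rewrite /e4 ltr_pdivlMr; last by lra.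
by rewrite mulrDr mulr1; lra.
Qed.

(** The inequality of multiplicities is summed over the distinct poles of [a i] with weights [wt r];
    the zeros and poles of [f] met at the points q^j p are counted by the characteristic at radius W
    r. *)
Lemma Ncount_le q n a i f W : q != 0 -> (forall j, (j <= n)%N -> cabs (q ^+ j) <= W) ->
  1 <= W -> (forall j, (j <= n)%N -> meromorphic (a j)) -> meromorphic f ->
  ~ (forall z, f z = 0) -> (i <= n)%N -> qdiff_eq q n a f ->
  exists2 K : R, 0 <= K & forall r, 1 <= r ->
  Ncount (a i) r <= \sum_(j < n.+1 | j != i :> nat) Ncount (a j) r +
    K * (Tchar f (W * r) + 1).
Proof.
move=> q0 qW W1 ma mf f0 le_in eqn.
have [kf [lf df]] := nonzero_divisor mf f0; have [c c0 HT] := Tchar_parts df.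
have [|l pl] := @choice nat (C -> nat) (fun j l => (j <= n)%N -> pole_mult (a j) l).
  move=> j; have [jn|nj] := boolP (j <= n)%N; last by exists (fun=> 0%N).
  by have [l hl] := mero_pole_mult (ma j jn); exists l.
(* At most n + 1 sums over poles of [f] and one over its zeros, the latter costing the constant [c]
   of [Tchar_parts]. *)
exists (n.+2%:R * (1 + c)); first by rewrite mulr_ge0//; lra.
move=> r r1; have r0 : 0 < r := lt_le_trans ltr01 r1.
have W0 : 0 < W := lt_le_trans ltr01 W1.
have Wr : 1 <= W * r by rewrite -[1]mul1r ler_pM.
pose rho := r + 1; have rr : 0 < r < rho by rewrite r0 /rho; lra.
have [|B HB] := @choice nat (seq C) (fun j B => (j <= n)%N ->
   [/\ forall p, cabs p < rho -> count_mem p B = l j p, forall p, p \in B -> cabs p < rho,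
   forall r, 0 < r < rho -> Ncount (a j) r = NS B r &
   forall p, cabs p < rho -> is_pole (a j) p -> p \in B]).
  move=> j; have [jn|nj] := boolP (j <= n)%N; last by exists [::].
  by have [B h] := pole_list rho (pl j jn); exists B.
have [A [D [h F]]] := factorization (W * rho) df.
have WrF : 1 <= W * r < W * rho by rewrite Wr ltr_pM2l//; case/andP: rr.
have [T0 TA TB _] := HT _ _ _ _ _ F WrF; case: (F) => _ F2 _ _.
set T := Tchar f (W * r) in T0 TA TB *.
pose U := undup (B i).
have uU : uniq U := undup_uniq _.
have [Bi1 Bi2 Bi3 _] := HB i le_in.
have Urho p : p \in U -> cabs p < rho by rewrite mem_undup => /Bi2.
have qj j : q ^+ j != 0 by rewrite expf_neq0.
have scale (E : seq C) (k : C -> nat) j : (j <= n)%N ->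
    (forall p, cabs p < W * rho -> count_mem p E = k p) ->
    \sum_(p <- U) (k (q ^+ j * p))%:R * wt r p <= NS E (W * r).
  move=> jn HE; have uM : uniq [seq q ^+ j * p | p <- U].
    by rewrite map_inj_uniq//; exact: mulfI.
  have MW p : p \in [seq q ^+ j * p | p <- U] -> cabs p < W * rho.
    move=> /mapP[p' /Urho p'r ->]; rewrite cabsM.
    apply: (@le_lt_trans _ _ (W * cabs p')); last by rewrite ltr_pM2l.
    by rewrite ler_wpM2r ?cabs_ge0// qW.
  have [+ _] := NS_uniq Wr uM MW HE; apply: le_trans.
  rewrite big_map; apply: ler_sum => p _; rewrite ler_wpM2l//.
  by apply: wt_scale => //; exact: qW.
have BU p : p \in B i -> p \in U by rewrite mem_undup.
rewrite Bi3// ((NS_uniq r1 uU Urho Bi1).2 BU).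
apply: (@le_trans _ _ (\sum_(p <- U) (kf (q ^+ i * p))%:R * wt r p +
   \sum_(j < n.+1 | j != i :> nat) (\sum_(p <- U) (l j p)%:R * wt r p +
     \sum_(p <- U) (lf (q ^+ j * p))%:R * wt r p))).
  under [X in _ <= _ + X]eq_bigr do rewrite -big_split/=.
  rewrite exchange_big/= -big_split/=.
  apply: ler_sum => p _.
  under eq_bigr do rewrite -mulrDl -natrD.
  rewrite -mulr_suml -mulrDl; apply: ler_wpM2r; first exact: wt_ge0.
  rewrite -natr_sum -natrD ler_nat.
  exact: (pole_mult_le p q0 pl df le_in eqn).
rewrite big_split /= addrCA; apply: lerD.
  apply: ler_sum => j _; have jn : (j <= n)%N by rewrite -ltnS.
  have [Bj1 _ Bj3 _] := HB j jn; rewrite Bj3//.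
  exact: (NS_uniq r1 uU Urho Bj1).1.
have s1 := scale A kf i le_in (fun p hp => (F2 p hp).1).
have s2 : \sum_(j < n.+1 | j != i :> nat) \sum_(p <- U) (lf (q ^+ j * p))%:R * wt r p <=
    n.+1%:R * T.
  apply: (@le_trans _ _ (\sum_(j < n.+1 | j != i :> nat) T)).
    apply: ler_sum => j _; have jn : (j <= n)%N by rewrite -ltnS.
    by apply: le_trans TB; exact: (scale D lf j jn (fun p hp => (F2 p hp).2)).
  rewrite sumr_const mulr_natl; apply: ler_wpMn2l => //.
  by rewrite (leq_trans (max_card _))// card_ord.
have n0 : 0 <= n.+1%:R :> R by [].
have nc := mulr_ge0 n0 c0; have nT := mulr_ge0 n0 T0; have cT := mulr_ge0 c0 T0.
have ncT := mulr_ge0 nc T0.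
rewrite -[n.+2]addn1 natrD; nra.
Qed.

(** Every exponent is at most the total sum [s], so [x] is at most N exp(s). *)
Lemma logplus_le_sum (I : finType) (P : pred I) (x : R) (u v : I -> R) N : 0 <= x ->
  (forall k, 0 <= u k) -> (forall k, 0 <= v k) -> (#|I| <= N)%N -> (0 < N)%N ->
  x <= \sum_(k | P k) expR (u k + v k) ->
  Num.max 0 (ln x) <= \sum_(k | P k) u k + \sum_(k | P k) v k + ln N%:R.
Proof.
move=> x0 u0 v0 IN N0 H; rewrite -big_split /=.
set s := \sum_(k | P k) _.
have s0 : 0 <= s by apply: sumr_ge0 => k _; exact: addr_ge0.
have N1 : 1 <= N%:R :> R by rewrite ler1n.
have lN : 0 <= ln N%:R :> R by exact: ln_ge0.
rewrite ge_max addr_ge0//=; move: x0; rewrite le_eqVlt => /orP[/eqP <-|x0].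
  by rewrite ln0// addr_ge0.
rewrite -[s]expRK -lnM ?posrE ?expR_gt0 ?ltr0n// ler_ln ?posrE ?mulr_gt0 ?expR_gt0 ?ltr0n//.
apply: le_trans H _; apply: (@le_trans _ _ (\sum_(k | P k) expR s)).
  apply: ler_sum => k Pj; rewrite ler_expR /s (bigD1 k)//= lerDl.
  by apply: sumr_ge0 => k' _; exact: addr_ge0.
rewrite sumr_const mulr_natr; apply: ler_wpMn2l; first exact: expR_ge0.
exact: leq_trans (max_card _) IN.
Qed.

(** After division by f(q^i z) the coefficient is bounded by the sum of |a_j| |f(q^j z) / f(q^i z)|.
    Its positive logarithm splits into those of the a_j, the moduli of the logarithmic differences
    of [f], and log(n + 1). *)
Lemma mprox_le q n a i f W : q != 0 -> (forall j, (j <= n)%N -> cabs (q ^+ j) <= W) ->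
  1 <= W -> (forall j, (j <= n)%N -> meromorphic (a j)) -> meromorphic f ->
  ~ (forall z, f z = 0) -> (i <= n)%N -> qdiff_eq q n a f ->
  exists2 K : R, 0 <= K & forall r S, 1 <= r -> 4 * W ^+ 2 * r <= S ->
  mprox (a i) r <= \sum_(j < n.+1 | j != i :> nat) mprox (a j) r +
    K * (Tchar f S + Tchar f (3 / 2 * S) + Tchar f (4 * S) + 1) / ln (S / r) + K.
Proof.
move=> q0 qW W1 ma mf f0 le_in eqn.
have [kf [lf df]] := nonzero_divisor mf f0; have [c c0 HT] := Tchar_parts df.
have qj j : q ^+ j != 0 by rewrite expf_neq0.
have [|l pl] := @choice nat (C -> nat) (fun j l => (j <= n)%N -> pole_mult (a j) l).
  move=> j; have [jn|nj] := boolP (j <= n)%N; last by exists (fun=> 0%N).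
  by have [l hl] := mero_pole_mult (ma j jn); exists l.
have [|K HK] := @choice nat R (fun j K => (j <= n)%N -> 0 <= K /\
   forall r S, 1 <= r -> 4 * W ^+ 2 * r <= S ->
   rintegrable (fun t => `|ln (cabs (f (q ^+ j * circ 0 r t))) - ln (cabs (f (q ^+ i * circ 0 r t)))|) /\
   rmean (fun t => `|ln (cabs (f (q ^+ j * circ 0 r t))) - ln (cabs (f (q ^+ i * circ 0 r t)))|) <=
   K * (Tchar f S + Tchar f (3 / 2 * S) + Tchar f (4 * S) + 1) / ln (S / r)).
  move=> j; have [jn|nj] := boolP (j <= n)%N; last by exists 0.
  have [K K0 H] := log_qdifference df (qj j) (qj i) W1 (qW j jn) (qW i le_in).
  by exists K.
have K0 (j : 'I_n.+1) : 0 <= K j by apply: (HK j _).1; rewrite -ltnS.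
have lN : 0 <= ln n.+1%:R :> R by rewrite ln_ge0// ler1n.
have sK0 : 0 <= \sum_(j < n.+1 | j != i :> nat) K j by exact: sumr_ge0.
exists (\sum_(j < n.+1 | j != i :> nat) K j + ln n.+1%:R); first exact: addr_ge0.
move=> r S r1 WS; have r0 : 0 < r := lt_le_trans ltr01 r1.
set TT := Tchar f S + _ + _ + 1.
have W2 : 1 <= W ^+ 2 by rewrite exprn_ege1.
have rS : 4 * r <= S.
  by apply: le_trans WS; rewrite ler_pM2r//; lra.
have S1 : 1 <= S by lra.
have ell0 : 0 < ln (S / r) by rewrite ln_gt0// ltr_pdivlMr// mul1r; lra.
have TT0 : 0 <= TT.
  have [A [B [h F]]] := factorization (5 * S) df.
  have [|T1 _ _ _] := HT _ _ _ _ S F; first lra.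
  have [|T2 _ _ _] := HT _ _ _ _ (3 / 2 * S) F; first lra.
  have [|T3 _ _ _] := HT _ _ _ _ (4 * S) F; first lra.
  by rewrite /TT; lra.
pose u (j : 'I_n.+1) t : R := Num.max 0 (ln (cabs (a j (circ 0 r t)))).
pose v (j : 'I_n.+1) t : R := `|ln (cabs (f (q ^+ j * circ 0 r t))) - ln (cabs (f (q ^+ i * circ 0 r t)))|.
have ord_n (j : 'I_n.+1) : (j <= n)%N by rewrite -ltnS.
have iu (j : 'I_n.+1) : rintegrable (u j) by exact: rintegrable_logplus (pl j (ord_n j)) r0.
have iv (j : 'I_n.+1) : rintegrable (v j) by have [] := (HK j (ord_n j)).2 r S r1 WS.
pose s := [seq j : 'I_n.+1 <- index_enum 'I_n.+1 | j != i :> nat].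
have [A [B [h F]]] := factorization (W * (r + 1)) df.
have wr j : (j <= n)%N -> cabs (q ^+ j) * r < W * (r + 1).
  move=> jn; apply: (@le_lt_trans _ _ (W * r)); first by rewrite ler_pM2r// qW.
  by rewrite ltr_pM2l ?(lt_le_trans ltr01 W1)//; lra.
have [|P HP] := @choice nat (seq C) (fun j P => (j <= n)%N ->
   forall p, cabs p < r + 1 -> is_pole (a j) p -> p \in P).
  move=> j; have [jn|nj] := boolP (j <= n)%N; last by exists [::].
  by have [P [_ _ _ h']] := pole_list (r + 1) (pl j jn); exists P.
(* Off [Z] no coefficient has a pole and no f(q^j z) has a zero or a pole, so the equation holds and
   may be divided. *)
pose Z := flatten [seq P j ++ [seq b / q ^+ j | b <- A ++ B] | j <- iota 0 n.+1].
have ZP j p : (j <= n)%N -> p \in P j ++ [seq b / q ^+ j | b <- A ++ B] -> p \in Z.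
  by move=> jn hp; apply/flattenP; eexists; [apply: map_f; rewrite mem_iota|exact: hp].
have pt t : circ 0 r t \notin Z ->
    Num.max 0 (ln (cabs (a i (circ 0 r t)))) <=
    \sum_(j <- s) u j t + \sum_(j <- s) v j t + ln n.+1%:R.
  set z := circ 0 r t => tZ; rewrite !big_filter.
  have cz : cabs z = r by exact: (cabs_circ0 t (ltW r0)).
  have fz j : (j <= n)%N -> f (q ^+ j * z) != 0 /\ ~ is_pole f (q ^+ j * z).
    move=> jn; have tj : z \notin [seq b / q ^+ j | b <- A ++ B].
      by apply: contra tZ => h1; apply: (ZP j) => //; rewrite mem_cat h1 orbT.
    have [_ fn] := log_factored_circ F r0 (qj j) (wr j jn) tj; split=> // fp.
    move/negP: tj; apply; apply/mapP; exists (q ^+ j * z); last by rewrite mulrAC mulfV ?mul1r.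
    rewrite mem_cat; apply/orP; right; case: (F) => _ F2 _ _.
    rewrite -has_pred1 has_count (F2 _ _).2; first exact: pole_lord fp (df.2 _).
    by rewrite cabsM cz wr.
  have np j : (j <= n)%N -> ~ is_pole (a j) z /\ ~ is_pole f (q ^+ j * z).
    move=> jn; split; last by have [] := fz j jn.
    move=> /(HP j jn) zP; move/negP: tZ; apply; apply: (ZP j) => //.
    by rewrite mem_cat zP// cz; lra.
  apply: logplus_le_sum; rewrite ?cabs_ge0 ?card_ord//.
  - by move=> k; rewrite le_max lexx.
  - by move=> k; exact: normr_ge0.
  have fi : 0 < cabs (f (q ^+ i * z)) by rewrite cabs_gt0; case: (fz i le_in).
  rewrite -(ler_pM2r fi); apply: le_trans (isolate eqn le_in np) _.
  rewrite mulr_suml; apply: ler_sum => j _; rewrite expRD -mulrA.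
  have fj : 0 < cabs (f (q ^+ j * z)) by rewrite cabs_gt0; case: (fz j (ord_n j)).
  apply: ler_pM; rewrite ?cabs_ge0//.
    have := cabs_ge0 (a j z); rewrite le_eqVlt => /orP[/eqP <-|aj0]; first exact: expR_ge0.
    by rewrite -{1}(lnK (aj0 : _ \is Num.pos)) ler_expR le_max lexx orbT.
  rewrite -ler_pdivrMr// -[leLHS]lnK ?posrE ?divr_gt0// ler_expR ln_div ?posrE//.
  exact: ler_norm.
rewrite mproxE; apply: (@le_trans _ _ (rmean (fun t =>
   \sum_(j <- s) u j t + \sum_(j <- s) v j t + ln n.+1%:R))).
  apply: (rmean_le_ae (Z := Z) r0); first exact: rintegrable_logplus (pl i le_in) r0.
    apply: rintegrableD; last exact: rintegrable_cst.
    by apply: rintegrableD; exact: rintegrable_sum.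
  by move=> t _; exact: pt.
rewrite rmeanD; last 2 first.
  by apply: rintegrableD; exact: rintegrable_sum.
  exact: rintegrable_cst.
rewrite rmeanD; [|exact: rintegrable_sum|exact: rintegrable_sum].
rewrite rmean_cst !rmean_sum// !big_filter -!addrA.
apply: lerD; first by apply: ler_sum => j _; rewrite mproxE.
have TL : 0 <= TT / ln (S / r) by rewrite divr_ge0// ltW.
apply: lerD; last by rewrite lerDr.
rewrite -mulrA mulrDl; apply: (@le_trans _ _ ((\sum_(j < n.+1 | j != i :> nat) K j) * (TT / ln (S / r)))).
  rewrite mulr_suml; apply: ler_sum => j _; rewrite mulrA.
  by have [] := (HK j (ord_n j)).2 r S r1 WS.
by rewrite lerDl mulr_ge0.
Qed.

End Equation.

(** * Functions of bounded characteristic *)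

Section BoundedCharacteristic.
Variable R : realType.
Local Notation C := (Cplx R).
Implicit Types (r rho t S W e M : R) (b z w p q : C) (f g h : C -> C) (A B Z : seq C) (n i j : nat).

Lemma wt_unbounded p M : exists2 r0, 1 <= r0 & forall r, r0 <= r -> M < wt r p.
Proof.
exists (Num.max 1 (Num.max (expR (M + 1)) ((cabs p) * expR (`|M| + 1)))).
  by rewrite le_max lexx.
move=> r; rewrite !ge_max => /andP[r1 /andP[r2 r3]].
have r0 : 0 < r := lt_le_trans ltr01 r1.
rewrite /wt; case: ifPn => [_|p0].
  apply: (@lt_le_trans _ _ (ln (expR (M + 1)))); first by rewrite expRK; lra.
  by rewrite ler_ln ?posrE ?expR_gt0.
have np : 0 < cabs p by rewrite cabs_gt0.
have e1 : 1 <= expR (`|M| + 1) :> R by rewrite -[leLHS]expR0 ler_expR; have := normr_ge0 M; lra.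
have -> : cabs p <= r by apply: le_trans r3; rewrite ler_peMr// ltW.
apply: (@lt_le_trans _ _ (ln (expR (`|M| + 1)))); first by rewrite expRK; have := ler_norm M; lra.
by rewrite ler_ln ?posrE ?expR_gt0 ?divr_gt0// ler_pdivlMr// mulrC.
Qed.

Lemma NS_wt A p r : 1 <= r -> p \in A -> wt r p <= NS A r.
Proof.
move=> r1 pA; rewrite /NS (big_rem p)//= lerDl.
by apply: sumr_ge0 => b _; exact: wt_ge0.
Qed.

(** A single zero or pole would already add an unbounded [wt r p]. So g is entire and zero-free, and
    [log_difference] on growing circles shows, as in Liouville's theorem, that log|g| is
    constant. *)
Lemma Tchar_bounded_cst g k l M (K : R) : divisor g k l ->
  (forall r, M <= r -> Tchar g r <= K) -> exists c : R, forall r, 1 <= r -> Tchar g r = c.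
Proof.
move=> dg TK; have [c c0 HT] := Tchar_parts dg.
have nocount p : k p = 0%N /\ l p = 0%N.
  have [r0 r01 Hr0] := wt_unbounded p (K + c).
  pose r := Num.max (Num.max r0 M) (cabs p + 1).
  have [rr0 rM rp] : [/\ r0 <= r, M <= r & cabs p + 1 <= r].
    by rewrite /r !le_max !lexx ?orbT.
  have r1 := le_trans r01 rr0.
  have [A [B [h F]]] := factorization (r + 1) dg.
  have [|_ TA TB _] := HT _ _ _ _ r F; first by rewrite r1; lra.
  have TKr := TK r rM; have w := Hr0 r rr0; case: (F) => _ F2 _ _.
  have [|cA cB] := F2 p; first lra.
  rewrite -cA -cB; split; apply/count_memPn/negP => pin.
    by have := NS_wt r1 pin; lra.
  by have := NS_wt r1 pin; lra.
have nil rho A B h : factored g k l rho A B h -> A = [::] /\ B = [::].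
  move=> [_ F2 F3 _]; split.
    case: A F2 F3 => [//|x A] F2 F3; have [|/eqP + _] := F2 x; first by apply: F3; rewrite mem_head.
    by rewrite (nocount x).1 /= eqxx.
  case: B F2 F3 => [//|x B] F2 F3; have [|_ /eqP] := F2 x; first by apply: F3; rewrite mem_head orbT.
  by rewrite (nocount x).2 /= eqxx.
have unit rho p : cabs p < rho -> (exists d, cder g p d) /\ g p != 0.
  have [_ h0] := nocount p => _; move: (dg.2 p); rewrite h0 (nocount p).1 => L.
  have [hn gn] := lord00_reg dg.1 L; split=> //; exact: holo_near_self.
have meanb r : 1 <= r -> M <= r -> rmean (fun t => `|ln (cabs (g (circ 0 r t)))|) <= 2 * K + c.
  move=> r1 rM; have [A [B [h F]]] := factorization (r + 1) dg.
  have [|_ _ _] := HT _ _ _ _ r F; first by rewrite r1; lra.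
  by have := TK r rM; lra.
have lncst z : ln (cabs (g z)) = ln (cabs (g 0)).
  apply/eqP; rewrite -subr_eq0 -normr_le0; apply/ler_addgt0Pl => e e0; rewrite addr0.
  pose K' := 2 * `|K| + c; have K'0 : 0 <= K' by rewrite addr_ge0// mulr_ge0.
  pose x := cabs z; have x0 : 0 <= x by exact: cabs_ge0.
  (* [log_difference] gives the bound 2 x K' / (S - x), which this radius makes at most [e]. *)
  pose S := Num.max (Num.max 1 M) (2 * x + 4 * x * K' / e + 1).
  have [S1 SM Sx] : [/\ 1 <= S, M <= S & 2 * x + 4 * x * K' / e + 1 <= S].
    by rewrite /S !le_max !lexx ?orbT.
  have xK : 0 <= 4 * x * K' / e by rewrite divr_ge0 ?mulr_ge0// ltW.
  have S0 : 0 < S < S + 1 by lra.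
  have zS : cabs z < S by rewrite -/x; lra.
  have oS : cabs (0 : C) < S by rewrite cabs0; lra.
  have := log_difference S0 (unit (S + 1)) zS oS.
  rewrite subr0 cabs0 subr0 -/x => /le_trans; apply.
  have m1 := meanb S S1 SM; set m := rmean _ in m1 *.
  have m0 : 0 <= m by apply: rmean_ge0.
  have mK : m <= K' by rewrite /K'; have := ler_norm K; lra.
  have -> : S * x / ((S - x) * S) = x / (S - x).
    by field; rewrite !gt_eqF//; lra.
  apply: (@le_trans _ _ (2 * (x / (S - x)) * K')).
    by apply: ler_wpM2l => //; rewrite !mulr_ge0// ?invr_ge0; lra.
  have -> : 2 * (x / (S - x)) * K' = 2 * x * K' / (S - x) by ring.
  rewrite ler_pdivrMr; last by lra.
  have h1 : 4 * x * K' / e * e = 4 * x * K' by rewrite divfK// gt_eqF.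
  have h2 : 4 * x * K' / e <= S - x by lra.
  have := ler_wpM2r (ltW e0) h2; rewrite h1 mulrC.
  have : 0 <= x * K' by rewrite mulr_ge0.
  by lra.
exists (Num.max 0 (ln (cabs (g 0)))) => r r1.
have [A [B [h F]]] := factorization (r + 1) dg.
have [_ EB] := nil _ _ _ _ F.
rewrite /Tchar (NcountE dg F); last by rewrite (lt_le_trans ltr01 r1); lra.
rewrite EB /NS big_nil addr0 mproxE -[RHS]rmean_cst; congr rmean.
by apply/funext => t; rewrite lncst.
Qed.

End BoundedCharacteristic.

(** * Orders with respect to phi *)

Section Orders.
Variable R : realType.
Local Notation C := (Cplx R).
Implicit Types (r x y M sg tau : R) (u phi s T : R -> R) (L : \bar R) (f g : C -> C) (n i j : nat).

Lemma lee_below L x : (forall y, y < x -> (y%:E <= L)%E) -> (x%:E <= L)%E.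
Proof.
case: L => [l| |] H; last 2 first.
- by rewrite leey.
- by have := H (x - 1); rewrite leeNy_eq /=; apply; lra.
rewrite lee_fin leNgt; apply/negP => lx.
by have := H ((l + x) / 2); rewrite lee_fin => /(_ ltac:(lra)); lra.
Qed.

Lemma lee_above L x : (forall y, x < y -> (L <= y%:E)%E) -> (L <= x%:E)%E.
Proof.
case: L => [l| |] H; last 2 first.
- by have := H (x + 1); rewrite leye_eq /=; apply; lra.
- by rewrite leNye.
rewrite lee_fin leNgt; apply/negP => lx.
by have := H ((l + x) / 2); rewrite lee_fin => /(_ ltac:(lra)); lra.
Qed.

Lemma limsup_lt u x : (limsup_infty u < x%:E)%E -> exists M, forall r, M < r -> u r < x.
Proof.
move=> /ereal_inf_lt[y /= [M _ <-] lt]; exists M => r Mr.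
rewrite -lte_fin; apply: le_lt_trans lt; apply: ereal_sup_ubound.
by exists r => //=; rewrite in_itv /= Mr.
Qed.

Lemma limsup_le u x M : (forall r, M < r -> u r <= x) -> (limsup_infty u <= x%:E)%E.
Proof.
move=> H; apply: le_trans (ereal_inf_lbound _) (_ : (ereal_sup [set (u r)%:E | r in `]M, +oo[ ] <= _)%E).
  by exists M.
by apply: ge_ereal_sup => y /= [r]; rewrite in_itv /= andbT => /H h <-; rewrite lee_fin.
Qed.

Lemma liminf_gt u x : (x%:E < liminf_infty u)%E -> exists M, forall r, M < r -> x < u r.
Proof.
move=> /ereal_sup_gt[y /= [M _ <-] lt]; exists M => r Mr.
rewrite -lte_fin; apply: lt_le_trans lt _; apply: ereal_inf_lbound.
by exists r => //=; rewrite in_itv /= Mr.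
Qed.

Lemma liminf_ge u x M : (forall r, M < r -> x <= u r) -> (x%:E <= liminf_infty u)%E.
Proof.
move=> H; apply: le_trans (_ : (_ <= ereal_inf [set (u r)%:E | r in `]M, +oo[ ])%E) (ereal_sup_ubound _).
  by apply: le_ereal_inf_tmp => y /= [r]; rewrite in_itv /= andbT => /H h <-; rewrite lee_fin.
by exists M.
Qed.

Lemma liminf_le u x M : (forall r, M < r -> u r <= x) -> (liminf_infty u <= x%:E)%E.
Proof.
move=> H; apply: ge_ereal_sup => y /= [M' _ <-].
pose r := Num.max M M' + 1.
have [r1 r2] : M < r /\ M' < r.
  by rewrite /r; split; rewrite (@le_lt_trans _ _ (Num.max M M'))// ?ltrDl// le_max lexx ?orbT.
apply: (@le_trans _ _ (u r)%:E); last by rewrite lee_fin H.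
by apply: ereal_inf_lbound; exists r => //=; rewrite in_itv /= r2.
Qed.

Lemma max_gt x y r : Num.max x y < r -> x < r /\ y < r.
Proof. by rewrite gt_max => /andP. Qed.

Definition growth R0 phi := [/\ 0 < R0, forall r, R0 < r -> 0 < phi r,
  forall r1 r2, R0 < r1 -> r1 <= r2 -> phi r1 <= phi r2 &
  forall M, exists r, R0 < r /\ M < phi r].

Lemma growth_ln R0 phi x : growth R0 phi -> exists M, forall r, M < r -> R0 < r /\ x < ln (phi r).
Proof.
move=> [R00 p0 pm pu]; have [r1 [r1R r1x]] := pu (expR x).
exists r1 => r r1r; have rR := lt_trans r1R r1r; split=> //.
rewrite -[x]expRK ltr_ln ?posrE ?expR_gt0 ?p0//.
exact: lt_le_trans r1x (pm _ _ r1R (ltW r1r)).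
Qed.

(** Subadditivity iterated up to the first integer above [k], followed by monotonicity. *)
Lemma phi_scale R0 phi (k : R) : growth R0 phi ->
  (forall x y, R0 < x -> R0 < y -> phi (x + y) <= phi x + phi y) -> 1 <= k ->
  exists2 N : R, 1 <= N & forall x, R0 < x -> phi (k * x) <= N * phi x.
Proof.
move=> [R00 p0 pm _] sub k1.
have H (N : nat) x : R0 < x -> phi (N.+1%:R * x) <= N.+1%:R * phi x.
  move=> xR; have x0 := lt_trans R00 xR.
  elim: N => [|N IH]; first by rewrite !mul1r.
  rewrite -(natr1 N.+1) !mulrDl !mul1r; apply: le_trans (sub _ _ _ xR) _.
    by apply: lt_le_trans xR _; rewrite (ler_peMl (ltW x0))// ler1n.
  by rewrite lerD2r.
pose N := Num.truncn k.
have kN : k <= N.+1%:R by rewrite ltW// truncnS_gt.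
exists N.+1%:R; first by rewrite ler1n.
move=> x xR; have x0 := lt_trans R00 xR; apply: le_trans (H N x xR).
by apply: pm; [apply: lt_le_trans xR _; rewrite ler_peMl// ltW|rewrite ler_pM2r].
Qed.

Lemma order_lt_bound R0 phi T sg : growth R0 phi -> (phi_order_fun phi T < sg%:E)%E ->
  exists M, forall r, M < r -> T r <= expR (sg * ln (phi r)).
Proof.
move=> gphi /limsup_lt[M1 H1]; have [M2 H2] := growth_ln 0 gphi.
exists (Num.max M1 M2) => r /max_gt[/H1 h /H2[_ lp]].
have [T0|T0] := leP (T r) 0; first exact: le_trans T0 (expR_ge0 _).
rewrite -[T r]lnK ?posrE// ler_expR ltW//.
by move: h; rewrite ltr_pdivrMr.
Qed.

(** The constant [D] disappears because ln(phi r) is unbounded. The condition on [tau] covers radii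
    with T(r) <= 0, where [ln] is 0. *)
Lemma order_le_bound R0 phi T tau (D M : R) : growth R0 phi -> 0 <= tau ->
  (forall r, M < r -> T r <= D * expR (tau * ln (phi r))) ->
  (phi_order_fun phi T <= tau%:E)%E.
Proof.
move=> gphi t0 H; apply: lee_above => x tx.
pose D' := Num.max 1 D.
have D'0 : 0 < D' by rewrite lt_max ltr01.
have [M1 H1] := growth_ln 0 gphi; have [M2 H2] := growth_ln (ln D' / (x - tau)) gphi.
apply: (@limsup_le _ _ (Num.max M (Num.max M1 M2))) => r.
move=> /max_gt[/H HT /max_gt[/H1[_ l0] /H2[_ lD]]].
rewrite ler_pdivrMr//; have [T0|T0] := leP (T r) 0.
  by rewrite ln0// mulr_ge0 ?ltW//; lra.
have : T r <= D' * expR (tau * ln (phi r)).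
  by apply: le_trans HT _; rewrite ler_wpM2r ?expR_ge0// le_max lexx orbT.
rewrite -ler_ln ?posrE ?mulr_gt0 ?expR_gt0// lnM ?posrE ?expR_gt0// expRK.
by move: lD; rewrite ltr_pdivrMr ?subr_gt0// mulrBr !(mulrC (ln (phi r))); lra.
Qed.

(** A negative order would make the characteristic eventually less than 1, hence constant; but then
    ln T / ln phi tends to 0. For the zero function the quotient is 0 by [ln 0 = 0]. *)
Lemma order_ge0 R0 phi g : growth R0 phi -> meromorphic g -> (0 <= phi_order phi g)%E.
Proof.
move=> gphi mg; apply: lee_below => x x0; rewrite leNgt; apply/negP => /limsup_lt[M H].
have [M1 H1] := growth_ln 0 gphi.
have small r : Num.max M M1 < r -> ln (Tchar g r) < x * ln (phi r) /\ 0 < ln (phi r).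
  by move=> /max_gt[/H h /H1[_ l0]]; move: h; rewrite ltr_pdivrMr.
have [g0|ng] := pselect (forall z, g z = 0).
  have [|] := small (Num.max M M1 + 1); first lra.
  rewrite /Tchar Ncount0// mproxE addr0 (_ : (fun _ => _) = fun=> 0); last first.
    by apply/funext => t; rewrite g0 cabs0 ln0// maxxx.
  by rewrite rmean_cst ln0// => h1 h2; nra.
have [k [l dg]] := nonzero_divisor mg ng.
have [|c Hc] := @Tchar_bounded_cst _ g k l (Num.max M M1 + 1) 1 dg.
  move=> r Mr; have [|h1 h2] := small r; first lra.
  rewrite leNgt; apply/negP => /ltW /ln_ge0; nra.
have [M2 H2] := growth_ln (ln c / x) gphi.
pose r := Num.max (Num.max M M1) (Num.max M2 1) + 1.
have /max_gt[/small[h1 h2] /max_gt[/H2[_ h3] r1]] : Num.max (Num.max M M1) (Num.max M2 1) < r.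
  by rewrite /r; lra.
move: h1 h3; rewrite (Hc r (ltW r1)) => h1.
by rewrite ltr_ndivrMr// mulrC; lra.
Qed.

Lemma real_below L (x : R) : (L < x%:E)%E -> exists2 y, y < x & (L < y%:E)%E.
Proof.
case: L => [l| |]; rewrite ?lte_fin ?ltNge ?leey//.
- by move=> lx; exists ((l + x) / 2); rewrite ?lte_fin; lra.
- by move=> _; exists (x - 1); rewrite ?leNgt ?ltNyr//; lra.
Qed.

Lemma choose_between n i (rho : nat -> \bar R) (A x : R) : x < A ->
  (forall j, (j <= n)%N -> j != i -> (rho j < A%:E)%E) ->
  exists2 tau, x < tau < A & forall j, (j <= n)%N -> j != i -> (rho j < tau%:E)%E.
Proof.
move=> xA; elim: n => [|n IH] H.
  have [i0|i0] := eqVneq 0%N i.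
    exists ((x + A) / 2); first lra.
    by move=> j; rewrite leqn0 => /eqP ->; rewrite i0 eqxx.
  have [y yA Hy] := real_below (H 0%N (leqnn _) i0).
  exists (Num.max y ((x + A) / 2)); first by rewrite lt_max gt_max yA; lra.
  move=> j; rewrite leqn0 => /eqP -> _; apply: lt_le_trans Hy _.
  by rewrite lee_fin le_max lexx.
have [|tau /andP[tx tA] Ht] := IH; first by move=> j jn; apply: H; exact: leqW.
have [i0|i0] := eqVneq n.+1 i.
  exists tau; first by rewrite tx.
  move=> j; rewrite leq_eqVlt => /orP[/eqP ->|]; first by rewrite i0 eqxx.
  by rewrite ltnS; exact: Ht.
have [y yA Hy] := real_below (H n.+1 (leqnn _) i0).
exists (Num.max y tau); first by rewrite lt_max gt_max yA tx tA orbT.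
move=> j; rewrite leq_eqVlt => /orP[/eqP -> _|].
  by apply: lt_le_trans Hy _; rewrite lee_fin le_max lexx.
rewrite ltnS => jn ji; apply: lt_le_trans (Ht j jn ji) _.
by rewrite lee_fin le_max lexx orbT.
Qed.

(** The only use of subadditivity: passing from radius x to k x changes phi^sg by a constant
    factor. *)
Lemma scaled_order_bound R0 phi T sg (k : R) : growth R0 phi ->
  (forall x y, R0 < x -> R0 < y -> phi (x + y) <= phi x + phi y) ->
  (phi_order_fun phi T < sg%:E)%E -> 0 <= sg -> 1 <= k ->
  exists D M : R, 0 <= D /\ forall x, M < x -> T (k * x) <= D * expR (sg * ln (phi x)).
Proof.
move=> gphi sub oT sg0 k1; have [M1 H1] := order_lt_bound gphi oT.
have [N N1 HN] := phi_scale gphi sub k1; case: (gphi) => R00 p0 _ _.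
exists (expR (sg * ln N)), (Num.max M1 R0); split; first exact: expR_ge0.
move=> x /max_gt[xM xR]; have x0 := lt_trans R00 xR.
have kx : x <= k * x by rewrite ler_peMl// ltW.
apply: le_trans (H1 _ (lt_le_trans xM kx)) _.
rewrite -expRD ler_expR -mulrDr ler_wpM2l//.
have N0 : 0 < N := lt_le_trans ltr01 N1.
have px := p0 x xR; have pkx := p0 _ (lt_le_trans xR kx).
by rewrite -lnM ?posrE// ler_ln ?posrE ?mulr_gt0// HN.
Qed.

End Orders.

(** * Lower bounds for the order of a solution *)

Section Main.
Variable R : realType.
Local Notation C := (Cplx R).
Implicit Types (r x y M sg tau : R) (phi s T : R -> R) (f g : C -> C) (q : C) (n i j : nat).

Lemma order_of_sum R0 phi n i (T : nat -> R -> R) (E : R -> R) tau (D M : R) :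
  growth R0 phi -> 0 <= tau ->
  (forall j, (j <= n)%N -> j != i -> (phi_order_fun phi (T j) < tau%:E)%E) ->
  (forall r, M < r -> E r <= D * expR (tau * ln (phi r))) ->
  (forall r, M < r -> T i r <= \sum_(j < n.+1 | j != i :> nat) T j r + E r) ->
  (phi_order_fun phi (T i) <= tau%:E)%E.
Proof.
move=> gphi t0 Ho HE HT.
have [M' HM'] : exists M', forall r, M' < r -> forall j, (j <= n)%N -> j != i ->
    T j r <= expR (tau * ln (phi r)).
  elim: n Ho {HT} => [|n IH] Ho.
    have [i0|i0] := eqVneq 0%N i.
      by exists 0 => r _ j; rewrite leqn0 => /eqP ->; rewrite i0 eqxx.
    have [M1 H1] := order_lt_bound gphi (Ho 0%N (leqnn _) i0).
    by exists M1 => r /H1 h j; rewrite leqn0 => /eqP ->.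
  have [|M1 H1] := IH; first by move=> j jn; apply: Ho; exact: leqW.
  have [i0|i0] := eqVneq n.+1 i.
    exists M1 => r /H1 h j; rewrite leq_eqVlt => /orP[/eqP ->|]; first by rewrite i0 eqxx.
    by rewrite ltnS; exact: h.
  have [M2 H2] := order_lt_bound gphi (Ho n.+1 (leqnn _) i0).
  exists (Num.max M1 M2) => r /max_gt[/H1 h1 /H2 h2] j.
  by rewrite leq_eqVlt => /orP[/eqP ->//|]; rewrite ltnS; exact: h1.
apply: (@order_le_bound _ R0 _ _ _ (n.+1%:R + D) (Num.max M M')) => // r /max_gt[rM rM'].
apply: le_trans (HT r rM) _; rewrite mulrDl; apply: lerD; last exact: HE.
apply: (@le_trans _ _ (\sum_(j < n.+1 | j != i :> nat) expR (tau * ln (phi r)))).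
  by apply: ler_sum => j ji; apply: HM' => //; rewrite -ltnS.
rewrite sumr_const mulr_natl; apply: ler_wpMn2l; first exact: expR_ge0.
by rewrite (leq_trans (max_card _))// card_ord.
Qed.

(** For n = 0 the equation reads a_0 f = 0, which fails at a point where both are regular. A second
    coefficient therefore exists, and the dominant order exceeds its nonnegative order. *)
Lemma solution_order_pos n a q f : meromorphic (a 0%N) -> ~ (forall z, a 0%N z = 0) ->
  meromorphic f -> ~ (forall z, f z = 0) -> qdiff_eq q n a f -> (0 < n)%N.
Proof.
move=> ma a0 mf f0 eqn; rewrite lt0n; apply/eqP => n0; rewrite {}n0 in eqn.
have [ka [la [_ /(_ 0) La]]] := nonzero_divisor ma a0.
have [kf [lf [_ /(_ 0) Lf]]] := nonzero_divisor mf f0.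
have [e1 e10 H1] := lord_reg La; have [e2 e20 H2] := lord_reg Lf.
have [|z] := @punctured_point _ 0 (Num.min e1 e2); first by rewrite lt_min e10.
rewrite lt_min => /andP[z0 /andP[z1 z2]] _.
have ra : reg (a 0%N) z by apply: H1; rewrite z0.
have rf : reg f z by apply: H2; rewrite z0.
have /eqP : \sum_(j < 1) a j z * f (q ^+ j * z) = 0.
  apply: eqn => j; rewrite leqn0 => /eqP ->; rewrite expr0 mul1r.
  by split; exact: reg_not_pole.
by rewrite big_ord1 expr0 mul1r mulf_eq0 (negbTE ra.2) (negbTE rf.2).
Qed.

Lemma Tchar_ge0 g r : meromorphic g -> 1 <= r -> 0 <= Tchar g r.
Proof.
move=> /mero_pole_mult[l pl] r1.
exact: addr_ge0 (mprox_ge0 _ _) (Ncount_ge0 pl r1).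
Qed.

(** One bound for |q|^j with j <= n that is at least 1 whether |q| is small or large. *)
Definition qbound q n : R := (1 + cabs q) ^+ n.

Lemma qbound_ge1 q n : 1 <= qbound q n.
Proof. by rewrite exprn_ege1// lerDl cabs_ge0. Qed.

Lemma qboundP q n j : (j <= n)%N -> cabs (q ^+ j) <= qbound q n.
Proof.
move=> jn; rewrite cabsX; apply: (@le_trans _ _ ((1 + cabs q) ^+ j)).
  by apply: lerXn2r; rewrite ?nnegrE ?cabs_ge0 ?addr_ge0 ?cabs_ge0// lerDr.
by apply: ler_weXn2l => //; rewrite lerDl cabs_ge0.
Qed.

Section Solution.
Variables (R0 : R) (phi : R -> R) (q : C) (n : nat) (a : nat -> C -> C) (i : nat) (f : C -> C).
Hypotheses (gphi : growth R0 phi)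
  (sub : forall x y, R0 < x -> R0 < y -> phi (x + y) <= phi x + phi y)
  (q0 : q != 0) (ma : forall j, (j <= n)%N -> meromorphic (a j))
  (a0 : ~ (forall z, a 0%N z = 0)) (le_in : (i <= n)%N)
  (dom : forall j, (j <= n)%N -> j != i -> (phi_order phi (a j) < phi_order phi (a i))%E)
  (fin : (phi_order phi (a i) < +oo)%E)
  (mf : meromorphic f) (f0 : ~ (forall z, f z = 0)) (eqn : qdiff_eq q n a f).

Let W := qbound q n.

Lemma dominant_order : exists2 A : R, 0 < A & phi_order phi (a i) = A%:E.
Proof.
have n0 := solution_order_pos (ma (leq0n n)) a0 mf f0 eqn.
have [j jn ji] : exists2 j, (j <= n)%N & j != i.
  by have [i0|i0] := eqVneq 0%N i; [exists 1%N => //; rewrite -i0|exists 0%N].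
have := dom jn ji; have := order_ge0 gphi (ma jn).
case: (phi_order phi (a i)) fin => [A| |]//; last by move=> _ _; rewrite ltNge leNye.
by move=> _ h1 h2; exists A => //; rewrite -lte_fin (le_lt_trans h1).
Qed.

Let K1W : 1 <= 4 * W ^+ 2.
Proof. by have W2 : 1 <= W ^+ 2 := exprn_ege1 2 (qbound_ge1 q n); lra. Qed.

Let expR_ge1' (x y : R) : 0 <= x -> 0 < y -> 1 <= expR (x * y).
Proof. by move=> x0 y0; rewrite -[leLHS]expR0 ler_expR mulr_ge0// ltW. Qed.

Theorem solution_order_ge : (phi_order phi (a i) <= phi_order phi f)%E.
Proof.
have [A A0 EA] := dominant_order; have rf0 := order_ge0 gphi mf.
rewrite leNgt EA; apply/negP => lt.
have [y yA ry] := real_below lt.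
have domA j : (j <= n)%N -> j != i -> (phi_order phi (a j) < A%:E)%E by rewrite -EA; exact: dom.
have [tau /andP[ytau tauA] Htau] := choose_between yA domA.
have y0 : 0 < y by rewrite -lte_fin (le_lt_trans rf0).
have tau0 : 0 <= tau by lra.
have ftau : (phi_order_fun phi (Tchar f) < tau%:E)%E.
  by apply: lt_trans ry _; rewrite lte_fin.
have [K1 K10 H1] := mprox_le q0 (@qboundP q n) (qbound_ge1 q n) ma mf f0 le_in eqn.
have [K2 K20 H2] := Ncount_le q0 (@qboundP q n) (qbound_ge1 q n) ma mf f0 le_in eqn.
have b k := @scaled_order_bound _ _ _ _ _ k gphi sub ftau tau0.
have [D0 [M0 [D00 B0]]] := b _ (qbound_ge1 q n).
have [D1 [M1 [D10 B1]]] := b _ K1W.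
have [|D2 [M2 [D20 B2]]] := b (3 / 2 * (4 * W ^+ 2)); first by have := K1W; lra.
have [|D3 [M3 [D30 B3]]] := b (4 * (4 * W ^+ 2)); first by have := K1W; lra.
have [M4 B4] := growth_ln 0 gphi.
(* With S = 4 W^2 r, the smallest admissible value, log(S / r) is this constant and every radius is
   a fixed multiple of [r]. *)
pose ell := ln (4 * W ^+ 2).
have ell0 : 0 < ell.
  by rewrite ln_gt0//; have W2 : 1 <= W ^+ 2 := exprn_ege1 2 (qbound_ge1 q n); lra.
suff : (phi_order phi (a i) <= tau%:E)%E by rewrite EA lee_fin leNgt tauA.
pose E r := K1 * (Tchar f (4 * W ^+ 2 * r) + Tchar f (3 / 2 * (4 * W ^+ 2) * r) +
    Tchar f (4 * (4 * W ^+ 2) * r) + 1) / ell + K1 + K2 * (Tchar f (W * r) + 1).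
apply: (@order_of_sum R0 phi n i (fun j => Tchar (a j)) E tau
   (K1 * (D1 + D2 + D3 + 1) / ell + K1 + K2 * (D0 + 1))
   (Num.max 1 (Num.max (Num.max M0 M1) (Num.max (Num.max M2 M3) M4)))) => //.
- move=> r /max_gt[r1 /max_gt[/max_gt[/B0 b0 /B1 b1] /max_gt[/max_gt[/B2 b2 /B3 b3] /B4[_ lp]]]].
  have e1 := expR_ge1' tau0 lp; set e := expR _ in b0 b1 b2 b3 e1 *.
  rewrite /E [leRHS]mulrDl; apply: lerD; last first.
    rewrite -mulrA; apply: ler_wpM2l => //; rewrite mulrDl mul1r; exact: lerD.
  rewrite [leRHS]mulrDl; apply: lerD; last by rewrite ler_peMr.
  rewrite [leRHS]mulrAC ler_wpM2r ?invr_ge0 ?(ltW ell0)// -[leRHS]mulrA ler_wpM2l//.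
  have -> : (D1 + D2 + D3 + 1) * e = D1 * e + D2 * e + D3 * e + e by ring.
  exact: lerD (lerD (lerD b1 b2) b3) e1.
- move=> r /max_gt[/ltW r1 _].
  have h1 := H1 r (4 * W ^+ 2 * r) r1 (lexx _); have h2 := H2 r r1.
  rewrite mulfK ?gt_eqF ?(lt_le_trans ltr01 r1)// -/ell !mulrA in h1.
  rewrite {1}/Tchar big_split /= /E !mulrA; lra.
Qed.

(** With S = 4 W^2 s(r), the error term is at most of order phi(s(r))^sg / log(s(r) / r), that is
    phi(r)^(sg / al1 - ga1) for any al1 < al, ga1 < ga and sg above the order of [f]. *)
Theorem entire_solution_order_ge s (al ga : R) :
  (forall r, R0 < r -> r < s r) ->
  alpha_phis phi s = al%:E -> gamma_phis phi s = ga%:E -> 0 <= al ->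
  (forall j, (j <= n)%N -> entire (a j)) ->
  (al%:E * phi_order phi (a i) + al%:E * ga%:E <= phi_order phi f)%E.
Proof.
move=> s_gt Eal Ega al0 ea.
have [A A0 EA] := dominant_order; have rf0 := order_ge0 gphi mf.
rewrite EA; move: rf0; case Erf: (phi_order phi f) => [rf| |]; last 2 first.
- by move=> _; rewrite leey.
- by rewrite leeNy_eq.
rewrite lee_fin => rf0; rewrite -!EFinM -EFinD lee_fin.
(* For [al = 0] the claim is that the order of [f] is nonnegative; otherwise division by [al] is
   allowed. *)
move: al0; rewrite le_eqVlt => /orP[/eqP <-|al0]; first by rewrite !mul0r addr0.
rewrite leNgt; apply/negP => lt.
have [al1 [ga1 [sg [al1_gt0 lt_al1 lt_ga1 lt_rf lt_A]]]] : exists al1 ga1 sg : R,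
    [/\ 0 < al1, al1 < al, ga1 < ga, rf < sg & sg / al1 - ga1 < A].
  (* [d] is the slack in the negated claim divided by [al]. Half of it is spent on [sg / al1], which
     stays below [Y], and a third on [ga1]; the remaining sixth keeps the inequality strict. *)
  pose d := A + ga - rf / al.
  have d0 : 0 < d.
    by rewrite subr_gt0 ltr_pdivrMr// mulrC mulrDr.
  have y0 : 0 <= rf / al by rewrite divr_ge0// ltW.
  pose Y := rf / al + d / 2.
  have Y0 : 0 < Y by rewrite /Y; lra.
  have rfY : rf / Y < al.
    rewrite ltr_pdivrMr// /Y mulrDr mulrCA divff ?mulr1 ?gt_eqF//.
    by have := mulr_gt0 al0 d0; lra.
  have rY0 : 0 <= rf / Y by rewrite divr_ge0// ltW.
  pose al1 := (rf / Y + al) / 2; have al10 : 0 < al1 by rewrite /al1; lra.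
  have rfal1 : rf < al1 * Y by rewrite -ltr_pdivrMr// /al1; lra.
  exists al1, (ga - d / 3), ((rf + al1 * Y) / 2); split=> //.
  - by rewrite /al1; lra.
  - by lra.
  - by lra.
  have : (rf + al1 * Y) / 2 / al1 < Y by rewrite ltr_pdivrMr// (mulrC Y); lra.
  by move: (_ / al1) => X; rewrite /Y; move: d0; rewrite /d; lra.
have [M5 B5] : exists M, forall r, M < r -> al1 < ln (phi r) / ln (phi (s r)).
  by apply: liminf_gt; rewrite -/(alpha_phis phi s) Eal lte_fin.
have [M6 B6] : exists M, forall r, M < r -> ga1 < ln (ln (s r / r)) / ln (phi r).
  by apply: liminf_gt; rewrite -/(gamma_phis phi s) Ega lte_fin.
have domA j : (j <= n)%N -> j != i -> (phi_order phi (a j) < A%:E)%E by rewrite -EA; exact: dom.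
(* The maximum with 0 keeps [tau] positive, so that bounded terms are also O(phi^tau). *)
have xA : Num.max 0 (sg / al1 - ga1) < A by rewrite gt_max A0.
have [tau /andP[] ] := choose_between xA domA.
rewrite gt_max => /andP[tau0 th_tau] tauA Htau.
have fsg : (phi_order_fun phi (Tchar f) < sg%:E)%E.
  by rewrite -/(phi_order phi f) Erf lte_fin.
have sg0 : 0 <= sg by lra.
have [K1 K10 H1] := mprox_le q0 (@qboundP q n) (qbound_ge1 q n) ma mf f0 le_in eqn.
have b k := @scaled_order_bound _ _ _ _ _ k gphi sub fsg sg0.
have [D1 [M1 [D10 B1]]] := b _ K1W.
have [|D2 [M2 [D20 B2]]] := b (3 / 2 * (4 * W ^+ 2)); first by have := K1W; lra.
have [|D3 [M3 [D30 B3]]] := b (4 * (4 * W ^+ 2)); first by have := K1W; lra.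
have [M4 B4] := growth_ln 0 gphi.
(* Entire coefficients have no poles to count, so the proximity bound with its divisor log(S / r) is
   the whole estimate. *)
have TmE j r : (j <= n)%N -> 0 < r -> Tchar (a j) r = mprox (a j) r.
  move=> jn r0; have [l pl] := mero_pole_mult (ma jn).
  by rewrite /Tchar (entire_Ncount pl (ea j jn) r0) addr0.
suff : (phi_order phi (a i) <= tau%:E)%E by rewrite EA lee_fin leNgt tauA.
pose E r := K1 * (Tchar f (4 * W ^+ 2 * s r) + Tchar f (3 / 2 * (4 * W ^+ 2) * s r) +
    Tchar f (4 * (4 * W ^+ 2) * s r) + 1) / ln (4 * W ^+ 2 * s r / r) + K1.
apply: (@order_of_sum R0 phi n i (fun j => Tchar (a j)) E tau
   (K1 * (D1 + D2 + D3 + 1) + K1)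
   (Num.max 1 (Num.max (Num.max M5 M6) (Num.max (Num.max M1 M2) (Num.max M3 M4))))) => //.
- exact: ltW.
- move=> r /max_gt[r1 /max_gt[/max_gt[r5 r6] /max_gt[/max_gt[r1' r2] /max_gt[r3 r4]]]].
  have r0 : 0 < r := lt_trans ltr01 r1.
  have [rR lp] := B4 r r4; have rs := s_gt r rR.
  have b1 := B1 _ (lt_trans r1' rs); have b2 := B2 _ (lt_trans r2 rs).
  have b3 := B3 _ (lt_trans r3 rs); have [_ lps] := B4 _ (lt_trans r4 rs).
  have e1 := expR_ge1' sg0 lps; set e := expR (sg * ln (phi (s r))) in b1 b2 b3 e1.
  have e0 : 0 < e := expR_gt0 _.
  have sr1 : 1 < s r / r by rewrite ltr_pdivlMr// mul1r.
  have l0 : 0 < ln (s r / r) by rewrite ln_gt0.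
  have lS : ln (s r / r) <= ln (4 * W ^+ 2 * s r / r).
    have sr0 : 0 < s r / r := lt_trans ltr01 sr1.
    rewrite -mulrA ler_ln ?posrE// ?ler_peMl ?(ltW sr0)//.
    by rewrite mulr_gt0// (lt_le_trans ltr01 K1W).
  have lg : expR (ga1 * ln (phi r)) <= ln (s r / r).
    rewrite -[leRHS]lnK ?posrE// ler_expR ltW//.
    by have := B6 r r6; rewrite ltr_pdivlMr.
  (* The definition of alpha turns phi(s(r)) into phi(r)^(1 / al1). *)
  have le_e : e <= expR (sg / al1 * ln (phi r)).
    rewrite ler_expR -mulrA ler_wpM2l// mulrC ler_pdivlMr// mulrC ltW//.
    by have := B5 r r5; rewrite ltr_pdivlMr.
  have eT := expR_ge1' (ltW tau0) lp.
  rewrite /E [leRHS]mulrDl; apply: lerD; last by rewrite ler_peMr.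
  apply: (@le_trans _ _ (K1 * (D1 + D2 + D3 + 1) * (e / ln (s r / r)))).
    rewrite [leRHS]mulrA; apply: ler_pM.
    + rewrite mulr_ge0//; have s1 : 1 <= s r by lra.
      have k1 := ler_pM ler01 ler01 K1W s1; rewrite mulr1 in k1.
      have t1 : 0 <= Tchar f (4 * W ^+ 2 * s r) by apply: Tchar_ge0.
      have t2 : 0 <= Tchar f (3 / 2 * (4 * W ^+ 2) * s r) by apply: Tchar_ge0 => //; rewrite -mulrA; lra.
      have t3 : 0 <= Tchar f (4 * (4 * W ^+ 2) * s r) by apply: Tchar_ge0 => //; rewrite -mulrA; lra.
      exact: addr_ge0 (addr_ge0 (addr_ge0 t1 t2) t3) ler01.
    + by rewrite invr_ge0 (le_trans (ltW l0)).
    + have eE : (D1 + D2 + D3 + 1) * e = D1 * e + D2 * e + D3 * e + e by ring.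
      by rewrite -[leRHS]mulrA ler_wpM2l// eE; exact: lerD (lerD (lerD b1 b2) b3) e1.
    + by rewrite lef_pV2 ?posrE// (lt_le_trans l0).
  apply: ler_wpM2l; first by rewrite mulr_ge0//; lra.
  rewrite ler_pdivrMr//; apply: le_trans le_e _.
  apply: (@le_trans _ _ (expR (tau * ln (phi r)) * expR (ga1 * ln (phi r)))); last first.
    by rewrite ler_pM2l ?expR_gt0.
  by rewrite -expRD ler_expR -mulrDl ler_pM2r//; lra.
- move=> r /max_gt[/ltW r1 /max_gt[_ /max_gt[_ /max_gt[_ r4]]]].
  have r0 : 0 < r := lt_le_trans ltr01 r1; have [rR _] := B4 r r4.
  have rs : 4 * W ^+ 2 * r <= 4 * W ^+ 2 * s r.
    by rewrite ler_pM2l ?(ltW (s_gt _ rR))// (lt_le_trans ltr01 K1W).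
  have h1 := H1 r (4 * W ^+ 2 * s r) r1 rs.
  rewrite TmE// (eq_bigr (fun j : 'I_n.+1 => mprox (a j) r)); last first.
    by move=> j _; rewrite TmE// -ltnS.
  by rewrite /E -(mulrA 4 (4 * W ^+ 2)) -(mulrA (3 / 2) (4 * W ^+ 2)) addrA.
Qed.

End Solution.

Lemma fin_unit (L : \bar R) : (0 <= L <= 1)%E -> exists2 x, 0 <= x <= 1 & L = x%:E.
Proof.
case: L => [x| |]; rewrite ?leye_eq ?leeNy_eq ?andbF//.
by rewrite !lee_fin => x01; exists x.
Qed.

Lemma alpha_unit R0 phi s : growth R0 phi -> (forall r, R0 < r -> r < s r) ->
  exists2 al, 0 <= al <= 1 & alpha_phis phi s = al%:E.
Proof.
move=> gphi s_gt; apply: fin_unit; have [M H] := growth_ln 0 gphi.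
have P r : M < r -> [/\ 0 < ln (phi r), 0 < ln (phi (s r)) & ln (phi r) <= ln (phi (s r))].
  move=> Mr; have [rR l1] := H r Mr; have rs := s_gt r rR.
  have [srR l2] := H _ (lt_trans Mr rs); split=> //.
  case: gphi => _ p0 pm _; rewrite ler_ln ?posrE ?p0//.
  exact: pm rR (ltW rs).
apply/andP; split.
  by apply: (@liminf_ge _ _ _ M) => r /P[l1 l2 _]; rewrite divr_ge0// ltW.
by apply: (@liminf_le _ _ _ M) => r /P[l1 l2 l12]; rewrite ler_pdivrMr// mul1r.
Qed.

(** Above: log(s(r) / r) <= log r <= phi(r). Below: s(r) / r eventually exceeds some y > 1, so the
    numerator is at least the constant log log y while ln(phi r) grows without bound. *)
Lemma gamma_unit R0 phi s : growth R0 phi -> (forall r, R0 < r -> ln r <= phi r) ->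
  (forall r, R0 < r -> r < s r <= r ^+ 2) -> (1 < liminf_infty (fun r => (s r / r)%R))%E ->
  exists2 ga, 0 <= ga <= 1 & gamma_phis phi s = ga%:E.
Proof.
move=> gphi lnphi s_bd lim1; apply: fin_unit; have [M H] := growth_ln 0 gphi.
have [R00 p0 _ _] := gphi.
apply/andP; split; last first.
  apply: (@liminf_le _ _ _ M) => r Mr; have [rR l1] := H r Mr.
  have r0 := lt_trans R00 rR; have /andP[rs sr] := s_bd r rR.
  have sr1 : 1 < s r / r by rewrite ltr_pdivlMr// mul1r.
  have l0 : 0 < ln (s r / r) by rewrite ln_gt0.
  rewrite ler_pdivrMr// mul1r ler_ln ?posrE ?p0//; apply: le_trans (lnphi r rR).
  rewrite ler_ln ?posrE ?(lt_trans ltr01 sr1)//.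
  by rewrite ler_pdivrMr// -expr2.
have [y y1 [M1 H1]] : exists2 y : R, 1 < y & exists M1, forall r, M1 < r -> y < s r / r.
  move: lim1 => /ereal_sup_gt[v /= [M1 _ <-] lt1].
  have ub r : M1 < r -> (ereal_inf [set (s r / r)%:E | r in `]M1, +oo[ ] <= (s r / r)%:E)%E.
    by move=> Mr; apply: ereal_inf_lbound; exists r => //=; rewrite in_itv /= Mr.
  move: lt1 ub; case: ereal_inf => [w| |] lt1 ub //.
  - exists ((1 + w) / 2); first by move: lt1; rewrite lte_fin; lra.
    by exists M1 => r /ub; move: lt1; rewrite lte_fin lee_fin; lra.
  - by have := ub (M1 + 1); rewrite leye_eq /= => /(_ ltac:(lra)).
apply: lee_below => x x0; have [M2 H2] := growth_ln (ln (ln y) / x) gphi.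
apply: (@liminf_ge _ _ _ (Num.max (Num.max M M1) M2)) => r.
move=> /max_gt[/max_gt[/H[rR l1] /H1 ys] /H2[_ l2]].
rewrite ler_pdivlMr//; apply: (@le_trans _ _ (ln (ln y))).
  by move: l2; rewrite ltr_ndivrMr// mulrC => /ltW.
have ly0 : 0 < ln y by rewrite ln_gt0.
have y0 := lt_trans ltr01 y1.
have lys : ln y <= ln (s r / r) by rewrite ler_ln ?posrE ?(ltW ys)// (lt_trans y0).
by rewrite ler_ln ?posrE// (lt_le_trans ly0).
Qed.

End Main.

Theorem theorem2p1 (R : realType) (R0 : R) (phi s : R -> R)
  (q : Cplx R) (n : nat) (a : nat -> Cplx R -> Cplx R) (i : nat)
  (f : Cplx R -> Cplx R) :
  (* standing assumptions on phi *)
  0 < R0 ->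
  (forall r, R0 < r -> 0 < phi r) ->
  (forall r1 r2, R0 < r1 -> r1 <= r2 -> phi r1 <= phi r2) ->
  (forall M, exists r, R0 < r /\ M < phi r) ->
  (forall r, R0 < r -> ln r <= phi r <= r) ->
  (* standing assumptions on s *)
  (forall r, R0 < r -> 0 < s r) ->
  (forall r1 r2, R0 < r1 -> r1 <= r2 -> s r1 <= s r2) ->
  (forall r, R0 < r -> r < s r <= r ^+ 2) ->
  (1 < liminf_infty (fun r => (s r / r)%R))%E ->
  (* phi is subadditive *)
  (forall x y, R0 < x -> R0 < y -> phi (x + y) <= phi x + phi y) ->
  (* the coefficients: meromorphic, of finite phi-order, hence of order < 1 *)
  q != 0 ->
  (forall j, (j <= n)%N -> meromorphic (a j)) ->
  (forall j, (j <= n)%N -> (phi_order phi (a j) < +oo)%E) ->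
  (forall j, (j <= n)%N -> (classical_order (a j) < 1%:E)%E) ->
  (exists z, ~ is_pole (a 0%N) z /\ ~ is_pole (a n) z /\ a 0%N z * a n z != 0) ->
  (i <= n)%N ->
  (forall j, (j <= n)%N -> j != i ->
     (phi_order phi (a j) < phi_order phi (a i))%E) ->
  (* f is a non-trivial meromorphic solution *)
  meromorphic f ->
  ((phi_order phi f < +oo)%E -> (classical_order f < 1%:E)%E) ->
  (exists z, ~ is_pole f z /\ f z != 0) ->
  (forall z, (forall j, (j <= n)%N -> ~ is_pole (a j) z /\ ~ is_pole f (q ^+ j * z)) ->
     \sum_(j < n.+1) a j z * f (q ^+ j * z) = 0) ->
  (* (a) *)
  ((limsup_infty (fun r => (s r / r)%R) = +oo)%E ->
   (forall x y t, R0 < x -> R0 < y -> 0 <= t <= 1 ->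
      s (t * x + (1 - t) * y) <= t * s x + (1 - t) * s y) ->
   (forall r, R0 < r -> derivable s r 1) ->
   let rf := phi_order phi f in
   let al := alpha_phis phi s in
   let ga := gamma_phis phi s in
   (maxe (rf - al * ga) (al * rf) <= rf)%E /\
   (al * phi_order phi (a i) <= maxe (rf - al * ga) (al * rf))%E /\
   ((forall j, (j <= n)%N -> entire (a j)) ->
      (al * phi_order phi (a i) + al * ga <= rf)%E)) /\
  (* (b) *)
  ((limsup_infty (fun r => (s r / r)%R) < +oo)%E ->
   (phi_order phi (a i) <= phi_order phi f)%E).
Proof.
move=> R00 p0 pm pu p_bd s0 sm s_bd slim sub q0 ma fin _ [z0 [_ [_ a0z]]] le_in dom mf _ [z1 [_ f0z]] eqn.
have gphi : growth R0 phi by [].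
have a0 : ~ (forall z, a 0%N z = 0).
  by move=> /(_ z0) h; move: a0z; rewrite h mul0r eqxx.
have f0 : ~ (forall z, f z = 0) by move=> /(_ z1) h; move: f0z; rewrite h eqxx.
(* This is (b); multiplied by alpha >= 0 it also gives the lower bound for the maximum in (a). *)
have ge_order := solution_order_ge gphi sub q0 ma a0 le_in dom (fin i le_in) mf f0 eqn.
have s_gt r : R0 < r -> r < s r by move=> /s_bd /andP[].
split=> // _ _ _ rf al ga.
have lnphi r : R0 < r -> ln r <= phi r by move=> /p_bd /andP[].
have [al' /andP[al0 al1] Eal] := alpha_unit gphi s_gt.
have [ga' /andP[ga0 ga1] Ega] := gamma_unit gphi lnphi s_bd slim.
have rf0 : (0 <= rf)%E := order_ge0 gphi mf.
rewrite /al /ga Eal Ega; split; last split.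
- rewrite ge_max -EFinM; apply/andP; split.
    by rewrite leeBlDr// leeDl// lee_fin mulr_ge0.
  by apply: gee_pMl.
- by rewrite le_max; apply/orP; right; apply: lee_wpmul2l.
- by move=> ea; apply: (entire_solution_order_ge gphi sub q0 ma a0 le_in dom (fin i le_in) mf f0 eqn s_gt Eal Ega al0 ea).
Qed.
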